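(* Let $K$ be a field of characteristic zero and let $R$ be a finitely generated $\mathbb{N}$-graded $K$-algebra with $R_0=K$. Suppose that there exists a nonzerodivisor $f\in R$ in the singular locus of $R$ whose sandwich Bernstein-Sato polynomial $\mathrm{SBS}^R_f(s)$ has no nonnegative integer roots (in particular it is not the zero polynomial). Then Bernstein's inequality holds for $D_R=D_{R|K}$: for every Bernstein filtration $\mathcal{B}^\bullet$ on $D_R$ and every nonzero left $D_R$-module $M$, one has $\operatorname{Dim}(M)\ge \dim(R)$, where $\operatorname{Dim}(M)=\inf\{\operatorname{Dim}(\mathcal{F}^\bullet) : \mathcal{F}^\bullet \text{ is a filtration on } M \text{ compatible with } \mathcal{B}^\bullet\}$ and $\dim(R)$ is the Krull dimension.
   Context: Differential operators: for a commutative $K$-algebra $R$, $D_{R|K}\subseteq \operatorname{End}_K(R)$ is the ring of $K$-linear differential operators: $D^0_{R|K}$ is the set of multiplication operators by elements of $R$ (identified with $R$), $D^{n+1}_{R|K}=\{\delta\in\operatorname{End}_K(R): [\delta,r]\in D^n_{R|K}\text{ for all } r\in R\}$, and $D_{R|K}=\bigcup_n D^n_{R|K}$, with composition as product. The order $\operatorname{ord}(\delta)$ is the least $n$ with $\delta\in D^n_{R|K}$. Singular locus: ''$f$ is in the singular locus of $R$'' means that $f$ lies in every prime $P$ of $R$ such that $R_P$ is not regular; equivalently, $R_f$ is regular. Sandwich Bernstein-Sato polynomial: a sandwich Bernstein-Sato equation for $f\in R$ consists of finitely many $\alpha_i(s),\beta_i(s)\in D_{R|K}[s]$ and $b(s)\in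 K[s]$ with $\sum_i \alpha_i(n) f^{n+1}\beta_i(n)=b(n)f^n$ as operators in $D_{R|K}$ (products are compositions, $f^n$ is multiplication by $f^n$) for all $n\in\mathbb{N}=\{0,1,2,\dots\}$. The set of $b(s)$ occurring is an ideal of $K[s]$; $\mathrm{SBS}^R_f(s)$ is its monic generator, or $0$ if the ideal is zero. Bernstein filtration: an operator $\delta$ is homogeneous of degree $d$ if $\delta([R]_j)\subseteq [R]_{j+d}$ for all $j$. For an integer $w$ such that $R$ is generated as a $K$-algebra by homogeneous elements of degree strictly less than $w$, the Bernstein filtration with slope $w$ on $D_{R|K}$ is $B^i=K\text{-span}\{\delta\text{ homogeneous}: \deg(\delta)+w\operatorname{ord}(\delta)\le i\}$, $i\ge 0$. A Bernstein filtration is one of these for some such $w$. Compatible filtration: a filtration on a left $D_R$-module $M$ compatible with $\mathcal{B}^\bullet$ is an ascending sequence of $K$-subspaces $F^0\subseteq F^1\subseteq\cdots$ of $M$ with $\bigcup_i F^i=M$ and $B^iF^j\subseteq F^{i+j}$ for all $i,j$. Its dimension is $\operatorname{Dim}(\mathcal{F}^\bullet)=\inf\{t\in\mathbb{R}_{\ge0}: \lim_{n\to\infty}\dim_K(F^n)/n^t=0\}$ (equal to $\infty$ if there is no such $t$). *)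

(* Defs.v *)
From HB Require Import structures.
From mathcomp Require Import all_boot all_order all_algebra.
From mathcomp Require Import all_classical all_reals all_analysis.
From mathcomp Require Import ring.

Set Implicit Arguments.
Unset Strict Implicit.
Unset Printing Implicit Defensive.

Import Order.TTheory GRing.Theory Num.Theory.
Import numFieldNormedType.Exports.

Local Open Scope classical_set_scope.
Local Open Scope ring_scope.

(* Localization of a commutative ring, possibly with zero divisors, at a      *)
(* prime ideal. The library only has fraction fields of integral domains.     *)
Module Localization.
Section Localization.
Local Open Scope quotient_scope.
Variables (R : comNzRingType) (P : prime_idealr R).
Local Notation I := (P : pred R).

Record frac := Frac { num_den :> R * R; _ : num_den.2 \notin I }.
HB.instance Definition _ := [isSub for num_den].
HB.instance Definition _ := [Choice of frac by <:].

Lemma denP (x : frac) : x.2 \notin I. Proof. by case: x. Qed.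

Lemma den1 : 1 \notin I. Proof. by rewrite idealr1. Qed.

Lemma denM u v : u \notin I -> v \notin I -> u * v \notin I.
Proof. by move=> uP vP; rewrite prime_idealrM negb_or uP. Qed.

Definition equiv (x y : frac) : bool :=
  `[< exists2 u : R, u \notin I & u * (x.1 * y.2) = u * (y.1 * x.2) >].

Lemma equiv_refl : reflexive equiv.
Proof. by move=> x; apply/asboolP; exists 1; rewrite ?den1. Qed.

Lemma equiv_sym : symmetric equiv.
Proof. by move=> x y; apply/asboolP/asboolP => -[u uP e]; exists u. Qed.

Lemma equiv_trans : transitive equiv.
Proof.
move=> y x z /asboolP[u uP e] /asboolP[v vP e']; apply/asboolP.
exists (u * v * y.2); first by rewrite !denM ?denP.
transitivity (v * z.2 * (u * (x.1 * y.2))); first by ring.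
by rewrite e; transitivity (u * x.2 * (v * (y.1 * z.2))); [ring|rewrite e'; ring].
Qed.

Canonical equiv_equiv := EquivRel equiv equiv_refl equiv_sym equiv_trans.

Definition type := {eq_quot equiv}.
HB.instance Definition _ : EqQuotient _ equiv type := EqQuotient.on type.
HB.instance Definition _ := Choice.on type.

Definition addfrac (x y : frac) : frac :=
  @Frac (x.1 * y.2 + y.1 * x.2, x.2 * y.2) (denM (denP x) (denP y)).
Definition mulfrac (x y : frac) : frac :=
  @Frac (x.1 * y.1, x.2 * y.2) (denM (denP x) (denP y)).
Definition oppfrac (x : frac) : frac := @Frac (- x.1, x.2) (denP x).
Definition embed (a : R) : frac := @Frac (a, 1) den1.

Definition zero : type := lift_cst type (embed 0).
Definition one : type := lift_cst type (embed 1).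
Definition add := lift_op2 type addfrac.
Definition mul := lift_op2 type mulfrac.
Definition opp := lift_op1 type oppfrac.

Canonical pi_zero_morph := PiConst zero.
Canonical pi_one_morph := PiConst one.

Lemma repr_equiv x : equiv (repr (\pi_type x)) x.
Proof. by apply/eqmodP; rewrite reprK. Qed.

Lemma pi_eq (x y : frac) :
  (exists2 u : R, u \notin I & u * (x.1 * y.2) = u * (y.1 * x.2)) ->
  x = y %[mod type].
Proof. by move=> h; apply/eqmodP/asboolP. Qed.

Lemma pi_add : {morph \pi_type : x y / addfrac x y >-> add x y}.
Proof.
move=> x y; unlock add; apply: pi_eq => /=.
case/asboolP: (repr_equiv x) => u uP; case/asboolP: (repr_equiv y) => v vP.
set x' := repr (\pi_type x); set y' := repr (\pi_type y) => ey ex.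
exists (u * v); first exact: denM.
transitivity (v * y.2 * y'.2 * (u * (x'.1 * x.2)) +
              u * x.2 * x'.2 * (v * (y'.1 * y.2))); last by ring.
by rewrite ex ey; ring.
Qed.
Canonical pi_add_morph := PiMorph2 pi_add.

Lemma pi_mul : {morph \pi_type : x y / mulfrac x y >-> mul x y}.
Proof.
move=> x y; unlock mul; apply: pi_eq => /=.
case/asboolP: (repr_equiv x) => u uP; case/asboolP: (repr_equiv y) => v vP.
set x' := repr (\pi_type x); set y' := repr (\pi_type y) => ey ex.
exists (u * v); first exact: denM.
transitivity ((u * (x'.1 * x.2)) * (v * (y'.1 * y.2))); last by ring.
by rewrite ex ey; ring.
Qed.
Canonical pi_mul_morph := PiMorph2 pi_mul.

Lemma pi_opp : {morph \pi_type : x / oppfrac x >-> opp x}.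
Proof.
move=> x; unlock opp; apply: pi_eq => /=.
case/asboolP: (repr_equiv x) => u uP ex.
by exists u => //; rewrite !(mulNr, mulrN) ex.
Qed.
Canonical pi_opp_morph := PiMorph1 pi_opp.

Lemma frac_eq (x y : frac) : x.1 = y.1 -> x.2 = y.2 -> x = y.
Proof. by case: x y => [[a b] ?] [[c d] ?] /= ? ?; apply: val_inj; congr pair. Qed.

Lemma addA : associative add.
Proof.
elim/quotW=> x; elim/quotW=> y; elim/quotW=> z; rewrite !piE.
congr (\pi_type _); apply: frac_eq => /=; last by rewrite mulrA.
by ring.
Qed.

Lemma addC : commutative add.
Proof.
elim/quotW=> x; elim/quotW=> y; rewrite !piE.
by congr (\pi_type _); apply: frac_eq => /=; rewrite ?(addrC (x.1 * _)) // mulrC.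
Qed.

Lemma add0 : left_id zero add.
Proof.
elim/quotW=> x; rewrite !piE; congr (\pi_type _).
by apply: frac_eq; rewrite /= ?mul1r // mul0r mulr1 add0r.
Qed.

Lemma addN : left_inverse zero opp add.
Proof.
elim/quotW=> x; rewrite !piE; apply: pi_eq => /=.
by exists 1; rewrite ?den1 // mulNr addNr !mul0r.
Qed.

HB.instance Definition _ := GRing.isZmodule.Build type addA addC add0 addN.

Lemma mulA : associative mul.
Proof.
elim/quotW=> x; elim/quotW=> y; elim/quotW=> z; rewrite !piE.
by congr (\pi_type _); apply: frac_eq; rewrite /= mulrA.
Qed.

Lemma mulC : commutative mul.
Proof.
elim/quotW=> x; elim/quotW=> y; rewrite !piE.
by congr (\pi_type _); apply: frac_eq; rewrite /= mulrC.
Qed.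

Lemma mul1 : left_id one mul.
Proof.
elim/quotW=> x; rewrite !piE.
by congr (\pi_type _); apply: frac_eq; rewrite /= mul1r.
Qed.

Lemma mul_addl : left_distributive mul add.
Proof.
elim/quotW=> x; elim/quotW=> y; elim/quotW=> z; rewrite !piE.
by apply: pi_eq; exists 1; rewrite ?den1 //=; ring.
Qed.

Lemma nonzero1 : one != zero.
Proof.
rewrite piE; apply/asboolPn => -[u uP] /=.
by rewrite mul0r mulr0 !mulr1 => u0; rewrite u0 idealr0 in uP.
Qed.

HB.instance Definition _ :=
  GRing.Zmodule_isComNzRing.Build type mulA mulC mul1 mul_addl nonzero1.

End Localization.
End Localization.
HB.export Localization.

Notation localization := Localization.type.

Section CommutativeAlgebra.
Variable A : comNzRingType.

Definition ideal_span n (x : 'I_n -> A) : set A :=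
  [set y | exists a : 'I_n -> A, y = \sum_(i < n) a i * x i].

(* [idealr A] only contains proper ideals; the unit ideal is principal. *)
Definition noetherian : Prop :=
  forall I : idealr A, exists n (x : 'I_n -> A),
    [set y | y \in (I : pred A)] = ideal_span x.

Definition maximal_ideal (m : idealr A) : Prop :=
  forall I : idealr A,
    {subset (m : pred A) <= (I : pred A)} -> (I : pred A) =i (m : pred A).

(* strict chains P 0 < ... < P n of prime ideals *)
Definition prime_chain (n : nat) : Prop :=
  exists P : nat -> prime_idealr A, forall i, (i < n)%N ->
    {subset (P i : pred A) <= (P i.+1 : pred A)} /\
    ~ {subset (P i.+1 : pred A) <= (P i : pred A)}.

Definition krull_dim (Re : realType) : \bar Re :=
  ereal_sup [set (n%:R)%:E | n in prime_chain].

(* Noetherian local ring whose maximal ideal is generated by dim A elements *)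
Definition regular_local : Prop :=
  noetherian /\
  exists m : idealr A,
    [/\ maximal_ideal m,
        forall m' : idealr A, maximal_ideal m' -> (m' : pred A) =i (m : pred A) &
        exists d : nat,
          (prime_chain d /\ forall n, prime_chain n -> (n <= d)%N) /\
          exists x : 'I_d -> A, [set y | y \in (m : pred A)] = ideal_span x].

End CommutativeAlgebra.

Definition in_singular_locus (R : comNzRingType) (f : R) : Prop :=
  forall P : prime_idealr R,
    ~ regular_local (localization P) -> f \in (P : pred R).

Section Algebras.
Variables (K : fieldType) (R : comAlgType K).
Implicit Types (d e : R -> R) (a : R).

Definition generates (X : set R) : Prop :=
  forall S : {pred R}, GRing.subalg_closed S ->
    (forall x, X x -> x \in S) -> forall x, x \in S.

Definition finitely_generated : Prop :=
  exists s : seq R, generates [set x | x \in s].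

Record is_grading (G : nat -> {pred R}) : Prop := IsGrading {
  grading_submod : forall i, GRing.submod_closed (G i);
  grading1 : 1 \in G 0%N;
  gradingM : forall i j x y, x \in G i -> y \in G j -> x * y \in G (i + j)%N;
  grading_sum : forall x, exists n (c : nat -> R),
    (forall i, c i \in G i) /\ x = \sum_(i < n) c i;
  grading_direct : forall n (c : nat -> R), (forall i, c i \in G i) ->
    \sum_(i < n) c i = 0 -> forall i, (i < n)%N -> c i = 0
}.

(* [diffop_le n d] says that d lies in D^n *)
Fixpoint diffop_le (n : nat) (d : R -> R) : Prop :=
  match n with
  | 0 => exists a, forall x, d x = a * x
  | n'.+1 => linear d /\ forall r, diffop_le n' (fun x => d (r * x) - r * d x)
  end.

Lemma diffop_le_ext n d e : d =1 e -> diffop_le n d -> diffop_le n e.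
Proof. by move=> /funext ->. Qed.

Lemma diffop_le_linear n d : diffop_le n d -> linear d.
Proof.
case: n => [[a da] k x y|n []//].
by rewrite !da mulrDr scalerAr.
Qed.

Lemma diffop_leS n d : diffop_le n d -> diffop_le n.+1 d.
Proof.
elim: n d => [d d0|n IH d [ld hd]].
  split; first exact: diffop_le_linear d0.
  by case: d0 => a da r; exists 0 => x; rewrite !da; ring.
by split=> [|r]; [exact: ld|apply: IH; exact: hd].
Qed.

Lemma diffop_leW m n d : (m <= n)%N -> diffop_le m d -> diffop_le n d.
Proof.
move=> /subnK <- dm; elim: (n - m)%N => [//|k IH].
by rewrite addSn; apply: diffop_leS.
Qed.

Lemma diffop_leP n k d e : diffop_le n d -> diffop_le n e ->
  diffop_le n (fun x => k *: d x + e x).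
Proof.
elim: n d e => [|n IH] d e.
  move=> [a da] [b eb]; exists (k *: a + b) => x.
  by rewrite da eb mulrDl scalerAl.
move=> [ld hd] [le he]; split.
  move=> l x y; rewrite ld le !scalerDr !scalerA [k * l]mulrC.
  by rewrite -!addrA; congr (_ + _); rewrite addrCA.
move=> r; apply: diffop_le_ext (IH _ _ (hd r) (he r)) => x /=.
rewrite scalerBr mulrDr -scalerAr opprD -!addrA; congr (_ + _).
by rewrite addrCA.
Qed.

Lemma diffop_le0 n : diffop_le n (fun=> 0).
Proof. by apply: (@diffop_leW 0) => //; exists 0 => x; rewrite mul0r. Qed.

Lemma diffop_leM m n d e : diffop_le m d -> diffop_le n e ->
  diffop_le (m + n) (d \o e).
Proof.
have linB d' x y : linear d' -> d' (x - y) = d' x - d' y.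
  by move=> ld; rewrite -scaleN1r addrC ld scaleN1r addrC.
have lcomp d' e' : linear d' -> linear e' -> linear (d' \o e').
  by move=> ld le k x y /=; rewrite le ld.
have commE d' e' r x : linear d' -> (d' \o e') (r * x) - r * (d' \o e') x =
    1 *: (d' \o (fun x => e' (r * x) - r * e' x)) x +
    ((fun x => d' (r * x) - r * d' x) \o e') x.
  by move=> ld /=; rewrite scale1r (linB d') //; ring.
have [N le_mnN] := ubnP (m + n)%N; elim: N m n d e le_mnN => // N IH m n d e.
case: m => [|m]; case: n => [|n] lN.
- by case=> a da [b eb]; exists (a * b) => x /=; rewrite eb da mulrA.
- move=> d0 [le he]; have ld := diffop_le_linear d0; split; first exact: lcomp.
  move=> r; apply: diffop_le_ext (IH 0 n _ _ _ d0 (he r)) => // x.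
  by rewrite commE // scale1r; case: d0 => a da /=; rewrite !da; ring.
- move=> [ld hd] e0; have le := diffop_le_linear e0.
  rewrite addSn; split; first exact: lcomp.
  move=> r; apply: diffop_le_ext (IH m 0 _ _ _ (hd r) e0) => // x.
  rewrite commE //; case: e0 => b eb /=; rewrite !eb.
  by rewrite [b * (r * x)]mulrCA subrr -(subrr 0) (linB d) // subrr scaler0 add0r.
- move=> [ld hd] [le he]; rewrite addSn; split; first exact: lcomp.
  move=> r; apply: diffop_le_ext => [x|]; first exact/esym/commE.
  apply: diffop_leP.
    rewrite addnS -addSn; apply: (IH m.+1 n _ _ _ (conj ld hd) (he r)).
    by move: lN; rewrite addnS.
  exact: (IH m n.+1 _ _ _ (hd r) (conj le he)).
Qed.

Definition is_diffop (d : R -> R) : bool := `[< exists n, diffop_le n d >].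

Lemma is_diffopP d : reflect (exists n, diffop_le n d) (is_diffop d).
Proof. exact: asboolP. Qed.

(* The ring D_{R|K}, with composition as product *)
Record diffop := DiffOp {
  diffop_fun :> R -> R;
  _ : is_diffop diffop_fun
}.
HB.instance Definition _ := [isSub for diffop_fun].
HB.instance Definition _ := [Choice of diffop by <:].

Lemma diffopP (u : diffop) : exists n, diffop_le n u.
Proof. by case: u => u /= h; apply/is_diffopP. Qed.

Lemma diffop_linear (u : diffop) : linear u.
Proof. by have [n /diffop_le_linear] := diffopP u. Qed.

Lemma is_diffop_submod_closed : GRing.submod_closed is_diffop.
Proof.
split=> [|k u v].
  by apply/is_diffopP; exists 0%N; exact: diffop_le0.
move=> /is_diffopP[m um] /is_diffopP[n vn]; apply/is_diffopP; exists (maxn m n).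
apply: diffop_leP; first exact: (diffop_leW (leq_maxl m n)).
exact: (diffop_leW (leq_maxr m n)).
Qed.
HB.instance Definition _ := GRing.isSubmodClosed.Build K (R -> R) is_diffop
  is_diffop_submod_closed.
HB.instance Definition _ := [SubChoice_isSubLmodule of diffop by <:].

Lemma diffop_eq (u v : diffop) : u =1 v -> u = v.
Proof. by move=> /funext uv; apply: val_inj. Qed.

Lemma diffop_mul_subproof (u v : diffop) :
  is_diffop (u \o v).
Proof.
have [m um] := diffopP u; have [n vn] := diffopP v.
by apply/is_diffopP; exists (m + n)%N; apply: diffop_leM.
Qed.
Definition diffop_mul (u v : diffop) : diffop := DiffOp (diffop_mul_subproof u v).

Lemma mulop_subproof a : is_diffop ( *%R a).
Proof. by apply/is_diffopP; exists 0%N; exists a. Qed.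
Definition mulop a : diffop := DiffOp (mulop_subproof a).

Fact diffop_mulA : associative diffop_mul.
Proof. by move=> u v w; apply: diffop_eq. Qed.
Fact diffop_mul1 : left_id (mulop 1) diffop_mul.
Proof. by move=> u; apply: diffop_eq => x /=; rewrite mul1r. Qed.
Fact diffop_mulr1 : right_id (mulop 1) diffop_mul.
Proof. by move=> u; apply: diffop_eq => x /=; rewrite mul1r. Qed.
Fact diffop_mulDl : left_distributive diffop_mul +%R.
Proof. by move=> u v w; apply: diffop_eq. Qed.
Fact diffop_mulDr : right_distributive diffop_mul +%R.
Proof.
move=> u v w; apply: diffop_eq => x.
have /= := diffop_linear u 1 (v x) (w x); rewrite !scale1r; exact.
Qed.
Fact diffop_1neq0 : mulop 1 != 0.
Proof.
apply/eqP => /(congr1 (fun u : diffop => u 1)) /=; rewrite mulr1.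
by move/eqP; rewrite oner_eq0.
Qed.
HB.instance Definition _ := GRing.Zmodule_isNzRing.Build diffop
  diffop_mulA diffop_mul1 diffop_mulr1 diffop_mulDl diffop_mulDr diffop_1neq0.

Fact diffop_scaleAl k (u v : diffop) : k *: (u * v) = (k *: u) * v.
Proof. by apply: diffop_eq. Qed.
HB.instance Definition _ :=
  GRing.Lmodule_isLalgebra.Build K diffop diffop_scaleAl.
Fact diffop_scaleAr k (u v : diffop) : k *: (u * v) = u * (k *: v).
Proof.
have u0 : u 0 = 0.
  by have := diffop_linear u (-1) 0 0; rewrite scaler0 addr0 scaleN1r addNr.
apply: diffop_eq => x; have := diffop_linear u k (v x) 0.
by rewrite u0 !addr0 => h; apply: esym h.
Qed.
HB.instance Definition _ :=
  GRing.Lalgebra_isAlgebra.Build K diffop diffop_scaleAr.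

Lemma diffop_ex_ord (u : diffop) : exists n, `[< diffop_le n u >].
Proof. by have [n un] := diffopP u; exists n; apply/asboolP. Qed.
Definition ord (u : diffop) : nat := ex_minn (diffop_ex_ord u).

(* [b] satisfies a sandwich Bernstein-Sato equation for [f]; the pairs in [s] *)
(* are the (alpha_i, beta_i).                                                 *)
Definition sandwich_bs (f : R) (b : {poly K}) : Prop :=
  exists s : seq ({poly diffop} * {poly diffop}), forall n : nat,
    \sum_(ab <- s) ab.1.[n%:R] * mulop (f ^+ n.+1) * ab.2.[n%:R] =
    b.[n%:R] *: mulop (f ^+ n).

(* The monic generator of the ideal [sandwich_bs f] of K[s], or 0 if that     *)
(* ideal is zero; see [SBSP].                                                 *)
Definition SBS (f : R) : {poly K} :=
  xget 0 [set p | (p \is monic \/ p = 0) /\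
                  forall b : {poly K}, sandwich_bs f b <-> p %| b].

Lemma sandwich_bs0 f : sandwich_bs f 0.
Proof. by exists [::] => n; rewrite big_nil horner0 scale0r. Qed.

Lemma sandwich_bsD f (b b' : {poly K}) :
  sandwich_bs f b -> sandwich_bs f b' -> sandwich_bs f (b + b').
Proof.
move=> [s hs] [s' hs']; exists (s ++ s') => n.
by rewrite big_cat hs hs' hornerD scalerDl.
Qed.

Lemma sandwich_bsM f (b c : {poly K}) : sandwich_bs f b -> sandwich_bs f (c * b).
Proof.
move=> [s hs]; pose C := map_poly (in_alg diffop) c.
exists [seq (C * ab.1, ab.2) | ab <- s] => n; rewrite big_map.
have Cn : C.[n%:R] = (c.[n%:R])%:A.
  by rewrite -[n%:R in LHS](rmorph_nat (in_alg diffop)) horner_map.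
rewrite hornerM -scalerA -hs scaler_sumr; apply: eq_bigr => ab _ /=.
rewrite hornerM_comm; last by rewrite /comm_poly (commr_nat ab.1.[n%:R]).
by rewrite Cn -!scalerAl mul1r.
Qed.

Lemma SBSP f : (SBS f \is monic \/ SBS f = 0) /\
  forall b : {poly K}, sandwich_bs f b <-> SBS f %| b.
Proof.
suff : exists p : {poly K}, (p \is monic \/ p = 0) /\
    forall b : {poly K}, sandwich_bs f b <-> p %| b.
  by case=> p hp; rewrite /SBS; case: xgetP => [q _ //|/(_ p)].
have [[b0 [b0f b0_neq0]]|noB] :=
    pselect (exists b, sandwich_bs f b /\ b != 0); last first.
  exists 0; split; first by right.
  move=> b; rewrite dvd0p; split=> [bf|/eqP->]; last exact: sandwich_bs0.
  by apply/negPn/negP => b_neq0; apply: noB; exists b.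
have exn : exists n, `[< exists b, [/\ sandwich_bs f b, b != 0 & size b = n] >].
  by exists (size b0); apply/asboolP; exists b0.
case: (ex_minnP exn) => n /asboolP[p [pf p_neq0 sp]] minn.
have lp_neq0 : (lead_coef p)^-1 != 0 by rewrite invr_eq0 lead_coef_eq0.
exists ((lead_coef p)^-1 *: p); split.
  by left; rewrite monicE lead_coefZ mulVf ?lead_coef_eq0.
move=> b; rewrite dvdpZl //; split=> [bf|/dvdpP[q ->]]; last exact: sandwich_bsM.
apply: contrapT => /negP; rewrite /dvdp => r_neq0.
have rf : sandwich_bs f (b %% p).
  have -> : b %% p = b + (- (b %/ p)) * p.
    by rewrite {2}(divp_eq b p) mulNr [_ * p + _]addrC addrK.
  by apply: sandwich_bsD => //; apply: sandwich_bsM.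
have /minn : `[< exists c, [/\ sandwich_bs f c, c != 0 & size c = size (b %% p)] >].
  by apply/asboolP; exists (b %% p).
by rewrite -sp leqNgt ltn_modp p_neq0.
Qed.

Definition lspan (V : lmodType K) (A : set V) : set V :=
  [set v | exists n (c : 'I_n -> K) (u : 'I_n -> V),
    (forall i, A (u i)) /\ v = \sum_(i < n) c i *: u i].

Section Filtrations.
Variable G : nat -> {pred R}.

(* graded pieces in integer degrees: [R]_j = 0 for j < 0 *)
Definition piece (j : int) : {pred R} :=
  match j with Posz n => G n | Negz _ => pred1 0 end.

Definition homogeneous_of_degree (j : int) (u : diffop) : Prop :=
  forall (i : nat) x, x \in piece i -> u x \in piece (i%:Z + j).

Definition admissible_slope (w : int) : Prop :=
  generates [set x | exists2 j : nat, (j%:Z < w)%R & x \in G j].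

Definition bernstein_slope (w : int) (i : nat) : set diffop :=
  lspan [set u | exists2 j : int,
    homogeneous_of_degree j u & (j + w * (ord u)%:Z <= i%:Z)%R].

Definition bernstein_filtration (B : nat -> set diffop) : Prop :=
  exists2 w : int, admissible_slope w & B = bernstein_slope w.

End Filtrations.

(* A left D-module M is a K-vector space through k |-> k%:A. *)
Section Modules.
Variables (Re : realType) (M : lmodType diffop).

Definition Ksubspace (F : set M) : Prop :=
  F 0 /\ forall (k : K) x y, F x -> F y -> F (k%:A *: x + y).

Definition Kfree n (x : 'I_n -> M) : Prop :=
  forall k : 'I_n -> K, \sum_(i < n) (k i)%:A *: x i = 0 -> forall i, k i = 0.

Definition Kdim (F : set M) : \bar Re :=
  ereal_sup [set (n%:R)%:E | n in
    [set n | exists x : 'I_n -> M, (forall i, F (x i)) /\ Kfree x]].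

Record compatible_filtration (B : nat -> set diffop) (F : nat -> set M) : Prop :=
  CompatibleFiltration {
    filt_subspace : forall i, Ksubspace (F i);
    filt_le : forall i, F i `<=` F i.+1;
    filt_cover : \bigcup_i F i = setT;
    filt_act : forall i j u x, B i u -> F j x -> F (i + j)%N (u *: x)
  }.

Definition filtration_dim (F : nat -> set M) : \bar Re :=
  ereal_inf [set t%:E | t in [set t : Re | 0 <= t /\
    (Kdim (F n) * ((n%:R `^ t)^-1)%:E)%E @[n --> \oo] --> 0%E]].

Definition module_dim (B : nat -> set diffop) : \bar Re :=
  ereal_inf [set filtration_dim F | F in compatible_filtration B].

End Modules.

End Algebras.

Arguments diffop {K} R.

(* Main.v *)
Require Import Defs.
From HB Require Import structures.
From mathcomp Require Import all_boot all_order all_algebra.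
From mathcomp Require Import all_classical all_reals all_analysis.
From mathcomp Require Import -(notations) mpoly.
From mathcomp Require Import ring zify.

(* Bernstein's argument.  If [dim F^n] grows more slowly than [n^d], then among the
   [k^(2d)] operators [z^a Z_b], which behave like [z^a (d/dz)^b] in étale coordinates
   [z], some nonzero combination [u] annihilates [F^(Ck)].  This is impossible when
   [1] lies in [B^(Ck) u B^(Ck)] with [C] independent of [u], since then [1] kills a
   nonzero element of [F^0].

   Linear bound.  Commutators with the [z_i] and [h d/dz_i] reduce [u] to a power
   [h^N], [N = O(k)], of the denominator [h] of the coordinates.  A power of [f] lies
   in the ideal generated by the denominators of finitely many coordinate systems;
   passing from one system to another costs a linear number of steps because [h]
   divides a nonzero polynomial in the other coordinates.  The sandwich equations at
   [0, 1, ..., N-1] finally lead from [f^N] to [1].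

   Étale coordinates at a prime [P] not containing [f] consist of generators [x] of
   the maximal ideal of the regular ring [R_P] and of a transcendence basis [t] of the
   residue field.  For a chain of primes [P_0 < ... < P_e] inside [P] with [e = dim R_P],
   elements of the successive differences are, together with [t], algebraically
   independent modulo [P_0], so in characteristic zero the derivations of [R] into
   [Frac(R/P_0)] have rank at least the number of coordinates; by Nakayama such a
   derivation is determined by its values on the coordinates.

   [R] is a domain: Krull's intersection theorem and the coordinates show that
   [P_0 R_P = 0], so [f^k = q + q'] with [q] in [P_0], [q' P_0 = 0]; since [D f^k D = D],
   this gives a central idempotent of [D], hence an idempotent of the graded ring
   [R], and these are [0] and [1]. *)

Set Implicit Arguments.
Unset Strict Implicit.
Unset Printing Implicit Defensive.

Import Order.TTheory GRing.Theory Num.Theory.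

Local Open Scope classical_set_scope.
Local Open Scope ring_scope.

(** * Ideals as sets *)

(** Over a singular ring [D] need not be generated by functions and derivations, and a filtered
    module cannot simply be localized. The operators [Z_b] make sense only after multiplication by
    powers of [h], and these powers have to be removed again inside [D]. Every reduction is
    therefore recorded as a two-sided combination with a level, and levels must stay linear in [k]:
    the comparison of [k^(2d)] with dimensions at levels [O(k)] tolerates a constant factor but no
    higher power of [k]. In this descent the sandwich equations are the only source of operators not
    built from functions and derivations.

    Two levels [n1 < n2] of the module filtration occur because the operators are counted as linear
    maps from [F n1] to [F n2]; if free families in both have fewer than [k^d / 2] members, there
    are too many operators.

    Charts serve twice. The first time [R] is not yet known to be a domain, so derivations take
    values in a residue field along a map [i]; the second time they are pulled back to [R]. Of the
    number [d] of coordinates the inequality [dim R <= d] is what enters. *)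

Lemma Zorn_above (T : Type) (good : set (set T)) (I : set T) :
  good I ->
  (forall F : set (set T), F !=set0 -> F `<=` good -> total_on F subset ->
     good (\bigcup_(X in F) X)) ->
  exists A, [/\ good A, I `<=` A & forall B, A `<=` B -> good B -> B `<=` A].
Proof.
move=> gI chain.
(* The union with [I] takes care of the empty chain, which [Zorn_bigcup] includes: it gives back
   [I]. *)
have [|A [gA maxA]] := @Zorn_bigcup T [set A | good (A `|` I)].
  move=> F Fgood totF.
  have [[X0 FX0]|F0] := pselect (F !=set0); last first.
    by rewrite /= (_ : \bigcup_(X in F) X = set0) ?set0U // -subset0 => x [X FX];
       case: F0; exists X.
  rewrite /= -bigcupUl; last by exists X0.
  rewrite -(bigcup_image F (fun X => X `|` I) idfun); apply: chain.
  - by exists (X0 `|` I); exists X0.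
  - by move=> _ [X FX <-]; exact: Fgood.
  move=> _ _ [X FX <-] [Y FY <-].
  by case: (totF _ _ FX FY) => h; [left|right]; apply: setSU.
exists (A `|` I); split => // B AB gB.
have BI : B `|` I = B by apply/seteqP; split=> x; [case=> // Ix; apply: AB; right|left].
have [AeB|AnB] := pselect (B `<=` A); first by move=> x /AeB; left.
case: (maxA B); last by rewrite /= BI.
by split=> [x Ax|//]; apply: AB; left.
Qed.

Section IdealSets.
Variable R : comNzRingType.
Implicit Types (I J P N : set R).

Definition ideal_set I :=
  [/\ I 0, forall x y, I x -> I y -> I (x + y) & forall a x, I x -> I (a * x)].

Definition prime_set P :=
  [/\ ideal_set P, ~ P 1 & forall a b, P (a * b) -> P a \/ P b].

Lemma ideal_setN I x : ideal_set I -> I x -> I (- x).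
Proof. by case=> _ _ IM Ix; rewrite -mulN1r; apply: IM. Qed.

Lemma ideal_setB I x y : ideal_set I -> I x -> I y -> I (x - y).
Proof. by move=> idI Ix Iy; case: (idI) => _ ID _; apply: ID => //; apply: ideal_setN. Qed.

Lemma ideal_set_sum I (T : Type) (r : seq T) (Q : pred T) (F : T -> R) :
  ideal_set I -> (forall i, Q i -> I (F i)) -> I (\sum_(i <- r | Q i) F i).
Proof. by case=> I0 ID _ IF; elim/big_ind: _. Qed.

Lemma ideal_set_add I J : ideal_set I -> ideal_set J ->
  ideal_set [set x | exists a b, [/\ I a, J b & x = a + b]].
Proof.
move=> [I0 ID IM] [J0 JD JM]; split.
- by exists 0, 0; rewrite addr0.
- move=> _ _ [a [b [Ia Jb ->]]] [c [d [Ic Jd ->]]]; exists (a + c), (b + d).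
  by split; [exact: ID|exact: JD|rewrite addrACA].
- move=> r _ [a [b [Ia Jb ->]]]; exists (r * a), (r * b).
  by split; [exact: IM|exact: JM|rewrite mulrDr].
Qed.

Lemma ideal_set_chain (F : set (set R)) : F !=set0 -> F `<=` ideal_set ->
  total_on F subset -> ideal_set (\bigcup_(X in F) X).
Proof.
move=> [X0 FX0] Fid totF; split.
- by exists X0 => //; case: (Fid _ FX0).
- move=> x y [X FX Xx] [Y FY Yy].
  have [XY|YX] := totF _ _ FX FY.
    by exists Y => //; case: (Fid _ FY) => _ YD _; apply: YD => //; apply: XY.
  by exists X => //; case: (Fid _ FX) => _ XD _; apply: XD => //; apply: YX.
- by move=> a x [X FX Xx]; exists X => //; case: (Fid _ FX) => _ _; apply.
Qed.

Lemma ideal_set_colon I z : ideal_set I -> ideal_set [set a | I (a * z)].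
Proof.
move=> [I0 ID IM]; split=> [|x y Ix Iy|a x Ix] /=.
- by rewrite mul0r.
- by rewrite mulrDl; apply: ID.
- by rewrite -mulrA; apply: IM.
Qed.

(** An ideal [P] maximal among those above [I] that miss all powers of [f] is prime: for [a], [b]
    outside [P], powers of [f] lie in [P + (a)] and in [P + (b)], and their product would lie in [P]
    if [a * b] did. *)
Lemma exists_prime_avoiding I f : ideal_set I -> (forall k, ~ I (f ^+ k)) ->
  exists P, [/\ prime_set P, I `<=` P & ~ P f].
Proof.
move=> idI If.
have [|P [[idP Pf] IP maxP]] := @Zorn_above R
    [set J | ideal_set J /\ forall k, ~ J (f ^+ k)] I (conj idI If).
  move=> F F0 Fg totF; split; first by apply: ideal_set_chain => // X /Fg[].
  by move=> k [X FX Xf]; have [_ /(_ k)] := Fg _ FX.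
have [P0 PD PM] := idP.
exists P; split => //; last by move: (Pf 1%N); rewrite expr1.
split=> //; first by move: (Pf 0%N); rewrite expr0.
have key a : ~ P a -> exists k r p, P p /\ f ^+ k = r * a + p.
  move=> nPa; apply: contrapT => no; apply: nPa.
  apply: (maxP [set x | exists r p, P p /\ x = r * a + p]).
  - by move=> x Px /=; exists 0, x; rewrite mul0r add0r.
  - split; last by move=> k [r [p [Pp fk]]]; apply: no; exists k, r, p.
    split; first by exists 0, 0; rewrite mul0r add0r.
      move=> _ _ [r [p [Pp ->]]] [s [q [Pq ->]]]; exists (r + s), (p + q).
      by split; [exact: PD|rewrite mulrDl addrACA].
    move=> c _ [r [p [Pp ->]]]; exists (c * r), (c * p).
    by split; [exact: PM|rewrite mulrDr mulrA].
  - by exists 1, 0; rewrite mul1r addr0.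
move=> a b Pab; apply: contrapT => /not_orP[/key[k [r [p [Pp fk]]]]].
move=> /key[l [s [q [Pq fl]]]]; apply: (Pf (k + l)%N).
rewrite exprD fk fl (_ : _ * _ = (r * s) * (a * b) + (r * a * q + (s * b + q) * p)).
  by apply: (PD); [exact: PM|apply: PD; exact: PM].
by ring.
Qed.

Definition ispan n (x : 'I_n -> R) : set R :=
  [set y | exists a : 'I_n -> R, y = \sum_(i < n) a i * x i].

Definition noeth := forall I, ideal_set I -> exists n (x : 'I_n -> R), I = ispan x.

Lemma noeth_chain (I : nat -> set R) : noeth -> (forall k, ideal_set (I k)) ->
  (forall k, I k `<=` I k.+1) -> exists k, I k.+1 `<=` I k.
Proof.
move=> noe idI incI.
have leI m n : (m <= n)%N -> I m `<=` I n.
  move=> /subnK <-; elim: (n - m)%N => // k IH; rewrite addSn.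
  by apply: subset_trans IH _; apply: incI.
have idU : ideal_set [set x | exists k, I k x].
  split; first by exists 0%N; case: (idI 0%N).
    move=> x y [k Ix] [l Iy]; exists (maxn k l).
    by case: (idI (maxn k l)) => _ ID _; apply: ID; [apply: leI Ix; apply: leq_maxl|apply: leI Iy; apply: leq_maxr].
  by move=> a x [k Ix]; exists k; case: (idI k) => _ _; apply.
have [n [x Ux]] := noe _ idU.
have xI i : exists k, I k (x i).
  suff : [set x | exists k, I k x] (x i) by [].
  rewrite Ux; exists (fun j => (j == i)%:R).
  by rewrite (bigD1 i) //= eqxx mul1r big1 ?addr0 // => j /negbTE->; rewrite mul0r.
have [k kI] := choice xI.
exists (\max_i k i) => y Iy.
have : [set x | exists k, I k x] y by exists (\max_i k i).+1.
rewrite Ux => -[a ->]; apply: ideal_set_sum => // i _.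
by case: (idI (\max_i k i)) => _ _; apply; apply: (leI (k i)) => //; apply: leq_bigmax.
Qed.

End IdealSets.
(** * Hilbert's basis theorem *)

Section Hilbert.
Variable R : comNzRingType.
Implicit Types (E I : set R) (p q : {poly R}).

Definition subring_set E :=
  [/\ E 1, forall x y, E x -> E y -> E (x - y) & forall x y, E x -> E y -> E (x * y)].

Definition over E p := forall i, E p`_i.

(** The subring [E[y]]. Subalgebras are kept as subsets of one fixed ring, so that no quotient of a
    polynomial ring in several variables has to be formed. *)
Definition adj E y : set R := [set x | exists2 p, over E p & x = p.[y]].

Section Subring.
Variable E : set R.
Hypothesis sE : subring_set E.

Lemma subring1 : E 1. Proof. by case: sE. Qed.
Lemma subringB x y : E x -> E y -> E (x - y). Proof. by case: sE => _ B _; apply: B. Qed.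
Lemma subringM x y : E x -> E y -> E (x * y). Proof. by case: sE => _ _; apply. Qed.
Lemma subring0 : E 0. Proof. by rewrite -(subrr 1); apply: subringB; exact: subring1. Qed.
Lemma subringN x : E x -> E (- x).
Proof. by rewrite -sub0r => Ex; apply: subringB => //; exact: subring0. Qed.
Lemma subringD x y : E x -> E y -> E (x + y).
Proof. by move=> Ex Ey; rewrite -(opprK y); apply: subringB => //; apply: subringN. Qed.
Lemma subring_sum (T : Type) (r : seq T) (Q : pred T) (F : T -> R) :
  (forall i, Q i -> E (F i)) -> E (\sum_(i <- r | Q i) F i).
Proof. by move=> EF; elim/big_ind: _ => //; [exact: subring0|exact: subringD]. Qed.
Lemma subringMn x n : E x -> E (x *+ n).
Proof. by move=> Ex; elim: n => [|n IH]; rewrite ?mulrS; [exact: subring0|apply: subringD]. Qed.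
Lemma subringX x n : E x -> E (x ^+ n).
Proof. by move=> Ex; elim: n => [|n IH]; rewrite ?exprS; [exact: subring1|apply: subringM]. Qed.

Lemma over0 : over E 0. Proof. by move=> i; rewrite coef0; exact: subring0. Qed.
Lemma overB p q : over E p -> over E q -> over E (p - q).
Proof. by move=> Ep Eq i; rewrite coefB; apply: subringB. Qed.
Lemma overD p q : over E p -> over E q -> over E (p + q).
Proof. by move=> Ep Eq i; rewrite coefD; apply: subringD. Qed.
Lemma overM p q : over E p -> over E q -> over E (p * q).
Proof. by move=> Ep Eq i; rewrite coefM; apply: subring_sum => j _; apply: subringM. Qed.
Lemma overC c : E c -> over E c%:P.
Proof. by move=> Ec i; rewrite coefC; case: eqP => // _; exact: subring0. Qed.
Lemma overXn n : over E 'X^n.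
Proof. by move=> i; rewrite coefXn; case: eqP => // _; [exact: subring1|exact: subring0]. Qed.
Lemma overX : over E 'X. Proof. by rewrite -['X]expr1; exact: overXn. Qed.
Lemma over_deriv p : over E p -> over E p^`().
Proof. by move=> Ep i; rewrite coef_deriv; apply: subringMn. Qed.
Lemma subring_horner p y : over E p -> E y -> E p.[y].
Proof.
by move=> Ep Ey; rewrite horner_coef; apply: subring_sum => i _; apply: subringM => //; apply: subringX.
Qed.

Lemma subring_adj y : subring_set (adj E y).
Proof.
split; first by exists 1%:P; [apply: overC; exact: subring1|rewrite hornerC].
  by move=> _ _ [p Ep ->] [q Eq ->]; exists (p - q); [apply: overB|rewrite hornerD hornerN].
by move=> _ _ [p Ep ->] [q Eq ->]; exists (p * q); [apply: overM|rewrite hornerM].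
Qed.

Lemma sub_adj y : E `<=` adj E y.
Proof. by move=> x Ex; exists x%:P; [apply: overC|rewrite hornerC]. Qed.

Lemma mem_adj y : adj E y y.
Proof. by exists 'X; [exact: overX|rewrite hornerX]. Qed.

End Subring.

Definition adjs E (s : seq R) := foldl adj E s.

Lemma subring_adjs E s : subring_set E -> subring_set (adjs E s).
Proof. by elim: s E => //= y s IH E sE; apply: IH; apply: subring_adj. Qed.

Lemma sub_adjs E s : subring_set E -> E `<=` adjs E s.
Proof.
elim: s E => [E _ x|y s IH E sE x Ex] /=; first exact.
apply: IH; first exact: subring_adj.
exact: sub_adj.
Qed.

Lemma mem_adjs E s y : subring_set E -> y \in s -> adjs E s y.
Proof.
elim: s E => //= z s IH E sE; rewrite inE => /orP[/eqP ->|ys].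
  by apply: sub_adjs; [exact: subring_adj|exact: mem_adj].
by apply: IH => //; exact: subring_adj.
Qed.

Lemma adjs_sub E E' s : subring_set E' -> E `<=` E' -> (forall y, y \in s -> E' y) ->
  adjs E s `<=` E'.
Proof.
move=> sE'; elim: s E => //= z s IH E EE' sE'z; apply: IH.
  move=> _ [p Ep ->]; apply: subring_horner => //; first by move=> i; apply: EE'.
  by apply: sE'z; rewrite inE eqxx.
by move=> y ys; apply: sE'z; rewrite inE ys orbT.
Qed.

Lemma adjs_rcons E s y : adjs E (rcons s y) = adj (adjs E s) y.
Proof. by rewrite /adjs foldl_rcons. Qed.

Definition E_ideal E I :=
  [/\ I `<=` E, I 0, forall x y, I x -> I y -> I (x + y)
    & forall a x, E a -> I x -> I (a * x)].

Definition Espan E (s : seq R) : set R :=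
  [set x | exists2 a : nat -> R, forall i, E (a i) & x = \sum_(i < size s) a i * s`_i].

Definition noeth_sub E :=
  forall I, E_ideal E I -> exists2 s, forall x, x \in s -> I x & I `<=` Espan E s.

Lemma Espan_sub E I s : E_ideal E I -> (forall x, x \in s -> I x) -> Espan E s `<=` I.
Proof.
move=> [_ I0 ID IM] sI _ [a Ea ->]; elim/big_ind: _ => // i _.
by apply: IM => //; apply: sI; rewrite mem_nth.
Qed.

Section EspanTheory.
Variables (E : set R) (s : seq R).
Hypothesis sE : subring_set E.

Lemma EspanD x y : Espan E s x -> Espan E s y -> Espan E s (x + y).
Proof.
move=> [a Ea ->] [b Eb ->]; exists (fun i => a i + b i).
  by move=> i; exact: subringD.
by rewrite -big_split; apply: eq_bigr => i _; rewrite mulrDl.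
Qed.

Lemma EspanM a x : E a -> Espan E s x -> Espan E s (a * x).
Proof.
move=> Ea [b Eb ->]; exists (fun i => a * b i); first by move=> i; apply: subringM.
by rewrite mulr_sumr; apply: eq_bigr => i _; rewrite mulrA.
Qed.

Lemma Espan0 : Espan E s 0.
Proof.
exists (fun=> 0) => [i|]; first exact: subring0.
by rewrite big1 // => i _; rewrite mul0r.
Qed.

Lemma mem_Espan x : x \in s -> Espan E s x.
Proof.
move=> xs; exists (fun i => (i == index x s)%:R).
  by move=> i; case: eqP => _; [exact: subring1|exact: subring0].
have lt_is : (index x s < size s)%N by rewrite index_mem.
rewrite (bigD1 (Ordinal lt_is)) //= eqxx mul1r nth_index // big1 ?addr0 // => i.
by rewrite -val_eqE /= => /negbTE->; rewrite mul0r.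
Qed.

Lemma Espan_sum (T : Type) (r : seq T) (Q : pred T) (F : T -> R) :
  (forall i, Q i -> Espan E s (F i)) -> Espan E s (\sum_(i <- r | Q i) F i).
Proof. by move=> EF; elim/big_ind: _ => //; [exact: Espan0|exact: EspanD]. Qed.

End EspanTheory.

(** Hilbert's argument on leading coefficients, run on the polynomials [J] whose value at [y] lies
    in [I]; thus [y] may be algebraic over [E]. *)
Lemma Hilbert_basis E y : subring_set E -> noeth_sub E -> noeth_sub (adj E y).
Proof.
move=> sE noe I [IE I0 ID IM]; have sE' := subring_adj sE y.
pose J p := over E p /\ I p.[y].
have JM a p : over E a -> J p -> J (a * p).
  move=> Ea [Ep Ip]; split; first exact: overM.
  by rewrite hornerM; apply: IM => //; exists a.
have JD p q : J p -> J q -> J (p + q).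
  by move=> [Ep Ip] [Eq Iq]; split; [exact: overD|rewrite hornerD; apply: ID].
have J0 : J 0 by split; [exact: over0|rewrite horner0].
have JB p q : J p -> J q -> J (p - q).
  move=> Jp Jq; apply: (JD) => //; rewrite -mulN1r -polyC1 -polyCN.
  by apply: JM => //; apply: overC => //; apply: subringN => //; exact: subring1.
(* Coefficients of degree [n] of members of [J] of degree at most [n]; [L n] grows with [n] because
   [J] is stable under multiplication by ['X]. *)
pose L n : set R := [set c | exists p, [/\ J p, (size p <= n.+1)%N & p`_n = c]].
have idL n : E_ideal E (L n).
  split.
  - by move=> _ [p [[Ep _] _ <-]].
  - by exists 0; split=> //; rewrite ?size_poly0 ?coef0.
  - move=> _ _ [p [Jp sp <-]] [q [Jq sq <-]]; exists (p + q); split; first exact: JD.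
      by rewrite (leq_trans (size_polyD _ _)) // geq_max sp.
    by rewrite coefD.
  - move=> a _ Ea [p [Jp sp <-]]; exists (a%:P * p); split.
    + by apply: JM => //; exact: overC.
    + by rewrite mul_polyC (leq_trans (size_scale_leq _ _)).
    + by rewrite coefCM.
have LX n m c : L n c -> exists p, [/\ J p, (size p <= (n + m).+1)%N & p`_(n + m) = c].
  move=> [p [Jp sp <-]]; exists ('X^m * p); split; first by apply: JM => //; exact: overXn.
    by rewrite (leq_trans (size_polyMleq _ _)) // size_polyXn addSn /= addnC -addSn leq_add2r.
  by rewrite coefXnM ltnNge leq_addl /= addnK.
have leL m n : (m <= n)%N -> L m `<=` L n.
  by move=> /subnKC <- c /(LX _ (n - m)%N).
have idU : E_ideal E [set c | exists n, L n c].
  split; first by move=> c [n]; case: (idL n) => LE _ _ _; exact: LE.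
  - by exists 0%N; case: (idL 0%N).
  - move=> a b [m La] [n Lb]; exists (maxn m n); case: (idL (maxn m n)) => _ _ LD _.
    by apply: LD; [apply: leL La; rewrite leq_maxl|apply: leL Lb; rewrite leq_maxr].
  - by move=> a c Ea [n Lc]; exists n; case: (idL n) => _ _ _; apply.
have [u uU Us] := noe _ idU.
have [N UN] : exists N, [set c | exists n, L n c] `<=` L N.
  suff [N uN] : exists N, forall x, x \in u -> L N x.
    exists N => c /Us; exact: (Espan_sub (idL N)).
  elim: {Us} u uU => [|x u IH] uU; first by exists 0%N.
  have [|N NP] := IH; first by move=> z zu; apply: uU; rewrite inE zu orbT.
  have [n Ln] : exists n, L n x by apply: uU; rewrite inE eqxx.
  exists (maxn n N) => z; rewrite inE => /orP[/eqP->|/NP].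
    by apply: leL Ln; rewrite leq_maxl.
  by apply: leL; rewrite leq_maxr.
have /choice[t tP] n : exists t, (forall x, x \in t -> L n x) /\ L n `<=` Espan E t.
  by have [t tL Lt] := noe _ (idL n); exists t.
have /choice[g gP] (ni : nat * nat) : exists p,
    J p /\ ((ni.2 < size (t ni.1))%N -> (size p <= ni.1.+1)%N /\ p`_ni.1 = (t ni.1)`_ni.2).
  case: (ltnP ni.2 (size (t ni.1))) => [lt|_]; last by exists 0.
  by have [p [Jp sp pc]] := (tP ni.1).1 _ (mem_nth 0 lt); exists p.
pose G := [seq (g ni).[y] | ni <- [seq (n, i) | n <- iota 0 N.+1, i <- iota 0 (size (t n))]].
exists G => [_ /mapP[ni _ ->]|x Ix]; first by case: (gP ni) => -[].
have [p Ep xp] := IE _ Ix; rewrite xp in Ix *.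
have GP n i : (n <= N)%N -> (i < size (t n))%N -> Espan (adj E y) G (g (n, i)).[y].
  move=> nN it; apply: mem_Espan => //; apply: map_f; apply/allpairsPdep.
  by exists n, i; rewrite !mem_iota !add0n !ltnS.
have {x xp Ep Ix} : J p by [].
have [k] := ubnP (size p); elim: k p => // k IH p; rewrite ltnS => spk Jp.
have [->|p0] := eqVneq p 0; first by rewrite horner0; exact: Espan0.
pose n := (size p).-1; have spn : size p = n.+1 by rewrite /n prednK // size_poly_gt0.
have Lp : L n p`_n by exists p; rewrite spn.
(* Beyond degree [N] the leading coefficient is already in [L N]; the lifts chosen there are raised
   by ['X^(n - m)] to cancel the leading term of [p]. *)
pose m := minn n N.
have Lm : L m p`_n.
  rewrite /m; case: (leqP n N) => _; first exact: Lp.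
  by apply: UN; exists n.
have [a Ea pa] := (tP m).2 _ Lm.
pose q := \sum_(i < size (t m)) (a i)%:P * ('X^(n - m) * g (m, val i)).
have mn : (m <= n)%N by rewrite geq_minl.
have Jq : J q.
  rewrite /q; elim/big_ind: _ => // i _; apply: (JM); first exact: overC.
  by apply: (JM); [exact: overXn|case: (gP (m, val i))].
have sq : (size q <= n.+1)%N.
  apply: (leq_trans (size_sum _ _ _)); apply/bigmax_leqP => i _.
  rewrite mul_polyC (leq_trans (size_scale_leq _ _)) // (leq_trans (size_polyMleq _ _)) //.
  have [_ /(_ (ltn_ord i))[sg _]] := gP (m, val i).
  by rewrite size_polyXn addSn /= (leq_trans (leq_add (leqnn _) sg)) //= addnS subnK.
have qn : q`_n = p`_n.
  rewrite pa /q coef_sum; apply: eq_bigr => i _.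
  have [_ /(_ (ltn_ord i))[_ gm]] := gP (m, val i).
  by rewrite coefCM coefXnM ltnNge leq_subr /= subKn // gm.
rewrite -(subrK q p) hornerD; apply: EspanD => //.
  apply: IH; last exact: JB.
  apply: leq_trans spk; rewrite spn ltnS; apply/leq_sizeP => j; rewrite leq_eqVlt.
  case/orP => [/eqP <-|nj]; first by rewrite coefB qn subrr.
  by rewrite coefB !nth_default ?subrr ?spn // (leq_trans sq).
rewrite horner_sum; apply: Espan_sum => // i _.
rewrite 2!hornerM mulrA; apply: EspanM => //.
  exists ((a i)%:P * 'X^(n - m)); last by rewrite hornerM.
  by apply: overM => //; [exact: overC|exact: overXn].
by apply: GP; [rewrite geq_minr|exact: ltn_ord].
Qed.

Lemma noeth_adjs E s : subring_set E -> noeth_sub E -> noeth_sub (adjs E s).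
Proof.
elim: s E => //= y s IH E sE noe; apply: IH; first exact: subring_adj.
exact: Hilbert_basis.
Qed.

End Hilbert.

(** * Finitely generated algebras are noetherian *)

Section FinitelyGenerated.
Variables (K : fieldType) (R : comAlgType K).

Definition scalars : set R := [set x | exists k : K, x = k%:A].

Lemma subring_scalars : subring_set scalars.
Proof.
split; first by exists 1; rewrite scale1r.
  by move=> _ _ [k ->] [l ->]; exists (k - l); rewrite scalerBl.
by move=> _ _ [k ->] [l ->]; exists (k * l); rewrite -scalerAl mul1r scalerA.
Qed.

Lemma noeth_scalars : noeth_sub scalars.
Proof.
move=> I [IE I0 ID IM].
have [[x [Ix x0]]|no] := pselect (exists x, I x /\ x <> 0); last first.
  exists [::] => // x Ix; have -> : x = 0.
    by apply: contrapT => x0; apply: no; exists x.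
  by apply: Espan0; exact: subring_scalars.
have [k xk] := IE _ Ix; have k0 : k != 0.
  by apply/eqP => k0; apply: x0; rewrite xk k0 scale0r.
exists [:: x] => [z|z Iz]; first by rewrite inE => /eqP->.
have [l ->] := IE _ Iz; exists (fun=> (l / k)%:A) => [i|]; first by exists (l / k).
by rewrite big_ord1 /= xk -scalerAl mul1r scalerA divfK.
Qed.

Lemma generates_adjs (s : seq R) : generates [set x | x \in s] ->
  forall x, adjs scalars s x.
Proof.
move=> gen x; pose S : {pred R} := fun x => `[< adjs scalars s x >].
have sA : subring_set (adjs scalars s) := subring_adjs s subring_scalars.
have cA k : adjs scalars s k%:A.
  by apply: sub_adjs; [exact: subring_scalars|exists k].
suff : x \in S by move/asboolP.
apply: gen => [|y ys]; last first.
  by apply/asboolP; apply: mem_adjs => //; exact: subring_scalars.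
split; first by apply/asboolP; exact: subring1.
  move=> k u v /asboolP Au /asboolP Av; apply/asboolP; apply: subringD => //.
  by rewrite -[u]mul1r scalerAl; apply: subringM.
by move=> u v /asboolP Au /asboolP Av; apply/asboolP; exact: subringM.
Qed.

Lemma fg_noeth : finitely_generated R -> noeth R.
Proof.
move=> [s gen] I [I0 ID IM].
have [|t tI It] := @noeth_adjs _ scalars s subring_scalars noeth_scalars I.
  by split=> // [x _|a x _]; [exact: generates_adjs|exact: IM].
exists (size t), (fun i => t`_i); apply/seteqP; split=> [x /It[a _ ->]|x [a ->]].
  by exists (fun i => a i).
elim/big_ind: _ => // i _; apply: (IM); apply: tI; exact: mem_nth.
Qed.

End FinitelyGenerated.
(** * Residue fields *)

Lemma pred_prime (R : comNzRingType) (Q : set R) : prime_set Q ->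
  exists P : prime_idealr R, forall x, (x \in (P : pred R)) = `[< Q x >].
Proof.
move=> [[Q0 QD QM] Q1 Qpr]; pose S : {pred R} := fun x => `[< Q x >].
have idS : idealr_closed S.
  split; [exact/asboolP|exact/asboolP|].
  by move=> a u v /asboolP Qu /asboolP Qv; apply/asboolP; apply: QD => //; apply: QM.
have prS : prime_idealr_closed S.
  move=> u v /asboolP /Qpr[Qu|Qv]; apply/orP; [left|right]; exact/asboolP.
pose I1 := isIdealr.Build R S idS.
pose I2 := isPrimeIdealrClosed.Build R S prS.
pose P : prime_idealr R := HB.pack S I1 I2.
by exists P.
Qed.

Lemma integral_frac_field (A : comNzRingType) :
  (forall x y : A, x * y = 0 -> (x == 0) || (y == 0)) ->
  exists (F : fieldType) (i : {rmorphism A -> F}), injective i.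
Proof.
move=> intA.
pose unitA : {pred A} := fun x => `[< exists y, y * x = 1 >].
(* Elements without inverse are sent to themselves, the default that a unit ring prescribes. *)
have exinv (x : A) : exists y, if x \in unitA then y * x = 1 else y = x.
  by case: (boolP (x \in unitA)) => [/asboolP//|_]; exists x.
have [inv invP] := choice exinv.
have mulVx : {in unitA, left_inverse 1 inv *%R}.
  by move=> x xU; have := invP x; rewrite xU.
have unitPl x y : y * x = 1 -> x \in unitA by move=> yx; apply/asboolP; exists y.
have inv_out : {in [predC unitA], inv =1 id}.
  by move=> x; rewrite inE /= => /negbTE xU; have := invP x; rewrite xU.
pose M1 := GRing.ComNzRing_hasMulInverse.Build A mulVx unitPl inv_out.
pose A1 : comUnitRingType := HB.pack A M1.
pose M2 := GRing.ComUnitRing_isIntegral.Build A1 intA.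
pose A2 : idomainType := HB.pack A1 M2.
pose i : {rmorphism A2 -> {fraction A2}} := @FracField.tofrac A2.
have inji : injective i.
  by move=> x y /eqP; rewrite /i /= (@tofrac_eq A2 x y) => /eqP.
by exists {fraction A2}, i.
Qed.

Lemma residue_field (R : comNzRingType) (Q : set R) : prime_set Q ->
  exists (F : fieldType) (i : {rmorphism R -> F}), forall x, i x = 0 <-> Q x.
Proof.
move=> /pred_prime[P PQ].
have [F [i inji]] := @integral_frac_field (Quotient.quot P) (@Quotient.rquot_IdomainAxiom R P).
pose p : {rmorphism R -> Quotient.quot P} := \pi_(Quotient.quot P)%qT.
exists F, (i \o p : {rmorphism R -> F}) => x /=.
have px : p x = 0 <-> Q x.
  have -> : p x = 0 <-> (x == 0 %[mod Quotient.quot P])%qT.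
    by rewrite -(rmorph0 p); split=> [/eqP|/eqP].
  by rewrite -Quotient.idealrBE subr0 PQ; split=> /asboolP.
by rewrite -px; split=> [|->]; rewrite ?rmorph0 // -(rmorph0 i) => /inji.
Qed.
(** * Extension of derivations *)

Section DerivationExtension.
Variable F : fieldType.
Implicit Types (E : set F) (D : F -> F) (p q : {poly F}).

Definition dern E D :=
  (forall a b, E a -> E b -> D (a + b) = D a + D b) /\
  (forall a b, E a -> E b -> D (a * b) = a * D b + b * D a).

(* The value at [p.[y]] of the extension of [D] sending [y] to [v]. *)
Definition ext_val D (y v : F) p := (map_poly D p).[y] + p^`().[y] * v.

Section OneStep.
Variables (E : set F) (D : F -> F) (y : F).
Hypotheses (sE : subring_set E) (dD : dern E D).

Lemma dern0 : D 0 = 0.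
Proof.
have E0 := subring0 sE; have := dD.1 _ _ E0 E0.
by rewrite addr0 => /(congr1 (fun x => x - D 0)); rewrite subrr addrK.
Qed.

Lemma dern_sum (T : Type) (r : seq T) (f : T -> F) : (forall i, E (f i)) ->
  D (\sum_(i <- r) f i) = \sum_(i <- r) D (f i).
Proof.
move=> Ef; elim: r => [|x r IH]; first by rewrite !big_nil dern0.
by rewrite !big_cons dD.1 // ?IH //; apply: subring_sum.
Qed.

Lemma map_dernD p q : over E p -> over E q ->
  map_poly D (p + q) = map_poly D p + map_poly D q.
Proof.
by move=> Ep Eq; apply/polyP => i; rewrite !(coefD, coef_map_id0 _ _ dern0) dD.1.
Qed.

Lemma map_dernM p q : over E p -> over E q ->
  map_poly D (p * q) = p * map_poly D q + q * map_poly D p.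
Proof.
move=> Ep Eq; apply/polyP => i; rewrite coefD (coef_map_id0 _ _ dern0) coefM.
rewrite dern_sum; last by move=> j; apply: subringM.
rewrite [q * _]mulrC !coefM -big_split; apply: eq_bigr => j _.
by rewrite !(coef_map_id0 _ _ dern0) dD.2 // [q`__ * _]mulrC.
Qed.

Lemma ext_valD v p q : over E p -> over E q ->
  ext_val D y v (p + q) = ext_val D y v p + ext_val D y v q.
Proof. by move=> Ep Eq; rewrite /ext_val map_dernD // derivD !hornerD; ring. Qed.

Lemma ext_valM v p q : over E p -> over E q ->
  ext_val D y v (p * q) = p.[y] * ext_val D y v q + q.[y] * ext_val D y v p.
Proof. by move=> Ep Eq; rewrite /ext_val map_dernM // derivM !(hornerD, hornerM); ring. Qed.

Lemma ext_valC v c : ext_val D y v c%:P = D c.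
Proof.
rewrite /ext_val (_ : map_poly D c%:P = (D c)%:P).
  by rewrite hornerC derivC horner0 mul0r addr0.
apply/polyP => i; rewrite (coef_map_id0 _ _ dern0) !coefC.
by case: eqP => _; rewrite ?dern0.
Qed.

Lemma ext_valX v : ext_val D y v 'X = v + D 1 * y.
Proof.
rewrite /ext_val derivX hornerC mul1r addrC; congr (_ + _).
have -> : map_poly D 'X = (D 1)%:P * 'X.
  apply/polyP => i; rewrite (coef_map_id0 _ _ dern0) coefCM coefX.
  by case: eqP => _; rewrite ?mulr1 // mulr0 dern0.
by rewrite hornerM hornerC hornerX.
Qed.

Lemma dern1 : D 1 = 0.
Proof.
have E1 := subring1 sE; have := dD.2 _ _ E1 E1.
by rewrite !mul1r => /(congr1 (fun x => x - D 1)); rewrite subrr addrK.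
Qed.

(** The hypothesis says exactly that the value on [p.[y]] is independent of the polynomial [p]
    representing the element. *)
Lemma dern_ext v : (forall p, over E p -> p.[y] = 0 -> ext_val D y v p = 0) ->
  exists D', [/\ dern (adj E y) D', forall x, E x -> D' x = D x & D' y = v].
Proof.
move=> cons.
have exp x : exists p, adj E y x -> over E p /\ x = p.[y].
  have [[p Ep xp]|n] := pselect (adj E y x); last by exists 0.
  by exists p.
have [P PP] := choice exp.
have PE p : over E p -> ext_val D y v (P p.[y]) = ext_val D y v p.
  move=> Ep; have [|E1 e] := PP p.[y]; first by exists p.
  have Eq := overB sE Ep E1.
  have d0 : ext_val D y v (p - P p.[y]) = 0.
    by apply: cons => //; rewrite hornerD hornerN -e subrr.
  by rewrite -[p in RHS](subrK (P p.[y])) ext_valD // d0 add0r.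
exists (fun x => ext_val D y v (P x)); split.
- split=> _ _ [p Ep ->] [q Eq ->].
    by rewrite -hornerD !PE ?ext_valD //; apply: overD.
  by rewrite -hornerM !PE ?ext_valM //; apply: overM.
- by move=> x Ex; rewrite -[x in P x](hornerC x y) PE ?ext_valC //; apply: overC.
- by rewrite -{1}[y in P y](hornerX y) PE ?ext_valX ?dern1 ?mul0r ?addr0 //; apply: overX.
Qed.

(** If [y] is algebraic over [E], the derivative of a relation [m] of least degree does not vanish
    at [y] in characteristic zero, and this determines [v]. Every other relation is reduced to [m]
    by pseudo-division, since [E] need not be a field. *)
Lemma dern_alg_consistent : [pchar F] =i pred0 ->
  exists v, forall p, over E p -> p.[y] = 0 -> ext_val D y v p = 0.
Proof.
move=> /pcharf0P char0.
have [tr|ntr] := pselect (forall p, over E p -> p.[y] = 0 -> p = 0).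
  by exists 0 => p Ep py; rewrite (tr p) // /ext_val map_poly0 deriv0 !horner0 mul0r addr0.
have exn : exists n, `[< exists p, [/\ over E p, p.[y] = 0, p != 0 & size p = n] >].
  apply: contrapT => no; apply: ntr => p Ep py; apply/eqP/negP => /negP p0; apply: no.
  by exists (size p); apply/asboolP; exists p.
case: (ex_minnP exn) => n /asboolP[m [Em my m0 sm]] minn.
have small p : over E p -> p.[y] = 0 -> (size p < size m)%N -> p = 0.
  move=> Ep py lt; apply/eqP/negP => /negP p0.
  have /minn : `[< exists q, [/\ over E q, q.[y] = 0, q != 0 & size q = size p] >].
    by apply/asboolP; exists p.
  by rewrite -sm leqNgt lt.
have m1 : (1 < size m)%N.
  rewrite ltnNge; apply/negP => /size1_polyC mC; move: m0 my.
  by rewrite mC hornerC polyC_eq0 => /eqP.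
have m'y : m^`().[y] != 0.
  apply/negP => /eqP m'y.
  have /polyP/(_ (size m).-2) : m^`() = 0.
    by apply: small => //; [exact: over_deriv|apply: lt_size_deriv].
  rewrite coef_deriv coef0 => /eqP; rewrite -mulr_natr mulf_eq0.
  have -> : ((size m).-2.+1 = (size m).-1)%N by case: (size m) m1 => [|[]].
  by rewrite -lead_coefE lead_coef_eq0 (negbTE m0) char0 /=; case: (size m) m1 => [|[]].
pose v := - (map_poly D m).[y] / m^`().[y].
have vm : ext_val D y v m = 0.
  by rewrite /ext_val /v [X in _ + X]mulrC divfK // subrr.
exists v => p; have [k] := ubnP (size p); elim: k p => // k IH p; rewrite ltnS => spk Ep py.
have [lt|le] := ltnP (size p) (size m).
  by rewrite (small p) // /ext_val map_poly0 deriv0 !horner0 mul0r addr0.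
pose c := lead_coef m; pose d := lead_coef p.
pose t : {poly F} := d%:P * 'X^(size p - size m).
have Et : over E t by apply: overM => //; [apply: overC => //; exact: Ep|exact: overXn].
have Ec : over E c%:P by apply: overC => //; exact: Em.
(* The leading term of [p] is cancelled after multiplication by [c]. The factor [c] comes off at the
   end, because [p.[y] = 0] removes the term in [D c]. *)
pose q := c%:P * p - t * m.
have Eq : over E q by apply: overB => //; apply: overM.
have p0 : (0 < size p)%N by apply: leq_trans le; apply: ltnW.
have qy : ext_val D y v q = 0.
  apply: IH => //; last by rewrite hornerD hornerN !hornerM py my !mulr0 subrr.
  apply: leq_trans spk; rewrite -(prednK p0) ltnS; apply/leq_sizeP => j.
  rewrite leq_eqVlt => /orP[/eqP <-|lj]; rewrite coefB -mulrA !coefCM coefXnM.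
    have -> : ((size p).-1 < size p - size m)%N = false by lia.
    have -> : ((size p).-1 - (size p - size m) = (size m).-1)%N by lia.
    by rewrite -!lead_coefE mulrC subrr.
  rewrite prednK // in lj; rewrite nth_default //.
  case: ltnP => h; rewrite ?mulr0 ?subrr // nth_default ?mulr0 ?subrr //.
  move: (size p) (size m) le lj => a b; lia.
have : ext_val D y v (c%:P * p) = 0.
  rewrite -(subrK (t * m) (c%:P * p)) ext_valD ?qy ?add0r //; last exact: overM.
  by rewrite ext_valM // vm my mulr0 mul0r addr0.
rewrite ext_valM // py mul0r addr0 hornerC => /eqP; rewrite mulf_eq0 lead_coef_eq0.
by rewrite (negbTE m0) => /eqP.
Qed.

End OneStep.

(** Algebraic independence over [E], stated one element at a time to match the extension of
    derivations one generator at a time. *)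
Fixpoint trseq E (s : seq F) : Prop :=
  if s is w :: s' then (forall p, over E p -> p.[w] = 0 -> p = 0) /\ trseq (adj E w) s'
  else True.

Lemma dern_trseq E D s (c : nat -> F) : subring_set E -> dern E D -> trseq E s ->
  exists D', [/\ dern (adjs E s) D', forall x, E x -> D' x = D x
    & forall i, (i < size s)%N -> D' s`_i = c i].
Proof.
elim: s E D c => [|w s IH] E D c sE dD /=; first by move=> _; exists D.
move=> [trw trs].
have [|D1 [dD1 D1E D1w]] := @dern_ext E D w sE dD (c 0%N).
  by move=> p Ep /(trw _ Ep) ->; rewrite /ext_val map_poly0 deriv0 !horner0 mul0r addr0.
have [D2 [dD2 D2E D2s]] := IH _ D1 (fun i => c i.+1) (subring_adj sE w) dD1 trs.
exists D2; split=> // [x Ex|[|i] lt_i /=].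
- by rewrite D2E ?D1E //; apply: sub_adj.
- by rewrite D2E ?D1w //; apply: mem_adj.
- exact: D2s.
Qed.

Lemma dern_adjs E D s : [pchar F] =i pred0 -> subring_set E -> dern E D ->
  exists2 D', dern (adjs E s) D' & forall x, E x -> D' x = D x.
Proof.
move=> char0; elim: s E D => [|w s IH] E D sE dD /=; first by exists D.
have [v cons] := dern_alg_consistent w sE dD char0.
have [D1 [dD1 D1E _]] := dern_ext sE dD cons.
have [D2 dD2 D2E] := IH _ D1 (subring_adj sE w) dD1.
by exists D2 => // x Ex; rewrite D2E ?D1E //; apply: sub_adj.
Qed.

End DerivationExtension.

(** [K]-derivations with values in [F], an [R]-module through [i]. With [i] a map to a residue field
    they are available before [R] is known to be a domain; with [idfun] they are the derivations of
    [R]. *)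
Definition is_der (K : fieldType) (R : comAlgType K) (F : comNzRingType)
    (i : {rmorphism R -> F}) (D : R -> F) :=
  [/\ forall a b, D (a + b) = D a + D b,
      forall a b, D (a * b) = i a * D b + i b * D a & forall k : K, D k%:A = 0].

(** * Derivations of an algebra into a field *)

Section AlgebraDerivations.
Variables (K : fieldType) (R : comAlgType K) (F : fieldType) (i : {rmorphism R -> F}).

Lemma adjs_image E s x : adjs E s x -> adjs [set i z | z in E] (map i s) (i x).
Proof.
suff H E' : [set i z | z in E] `<=` E' -> adjs E s x -> adjs E' (map i s) (i x) by exact: H.
elim: s E E' => [|y s IH] E E' EE' /= Ax; first by apply: EE'; exists x.
apply: IH Ax => _ [_ [p Ep ->] <-]; exists (map_poly i p); last by rewrite horner_map.
by move=> j; rewrite coef_map; apply: EE'; exists p`_j.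
Qed.

Lemma subring_image E : subring_set E -> subring_set [set i z | z in E].
Proof.
move=> sE; split; first by exists 1; rewrite ?rmorph1 //; exact: subring1.
  by move=> _ _ [a Ea <-] [b Eb <-]; exists (a - b); [exact: subringB|rewrite rmorphB].
by move=> _ _ [a Ea <-] [b Eb <-]; exists (a * b); [exact: subringM|rewrite rmorphM].
Qed.

Lemma pchar_codomain : [pchar K] =i pred0 -> [pchar F] =i pred0.
Proof.
move=> /pcharf0P charK; apply/pcharf0P => n.
have -> : n%:R = i (n%:R%:A) :> F by rewrite scaler_nat !rmorph_nat.
have [->|n0] := eqVneq n 0%N; first by rewrite scale0r rmorph0 eqxx.
apply/negbTE/eqP => e; have := oner_neq0 F.
rewrite -(rmorph1 i) -(scale1r 1) -(@mulVf _ n%:R) ?charK // -scalerA -mulr_algl.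
by rewrite rmorphM e mulr0 eqxx.
Qed.

(** The derivation is built on subrings of [F]: zero on the image of [E], free values along [w],
    then any extension to the generators. Composition with [i] makes it vanish on the kernel of
    [i]. *)
Lemma exists_der E (gens w : seq R) (c : nat -> F) : [pchar K] =i pred0 ->
  generates [set x | x \in gens] -> subring_set E -> @scalars K R `<=` E ->
  trseq [set i z | z in E] (map i w) ->
  exists D, [/\ is_der i D, forall j, (j < size w)%N -> D w`_j = c j
    & forall x, i x = 0 \/ E x -> D x = 0].
Proof.
move=> charK gen sE scE trw; have sS := subring_image sE.
have d0 : dern [set i z | z in E] (fun=> 0).
  by split=> *; rewrite ?addr0 ?mulr0 ?addr0.
have [D1 [dD1 D1E D1w]] := dern_trseq c sS d0 trw.
have sw := subring_adjs (map i w) sS.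
have [D2 dD2 D2E] := dern_adjs (map i gens) (pchar_codomain charK) sw dD1.
have all2 x : adjs (adjs [set i z | z in E] (map i w)) (map i gens) (i x).
  have : adjs [set i z | z in E] (map i gens) (i x).
    apply: adjs_image; apply: (adjs_sub (subring_adjs gens sE)) (generates_adjs gen x).
      by move=> z /scE; apply: sub_adjs.
    by move=> z; apply: mem_adjs.
  apply: adjs_sub; first exact: subring_adjs.
    by move=> z /(sub_adjs (map i w) sS); apply: sub_adjs.
  by move=> z zg; apply: mem_adjs.
have s2 := subring_adjs (map i gens) sw.
have DE x : E x -> D2 (i x) = 0.
  move=> Ex; have Ei : [set i z | z in E] (i x) by exists x.
  by rewrite D2E ?D1E //; apply: sub_adjs.
exists (D2 \o i); split=> [|j lt_j|x /= [->|]]; last exact: DE; last 2 first.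
- rewrite /= -(nth_map 0 0 i lt_j) D2E ?D1w ?size_map //.
  by apply: mem_adjs => //; rewrite mem_nth // size_map.
- exact: dern0 s2 dD2.
split=> [a b|a b|k] /=.
- by rewrite rmorphD; apply: dD2.1.
- by rewrite rmorphM; apply: dD2.2.
- by apply: DE; apply: scE; exists k.
Qed.

End AlgebraDerivations.
(** * Regular local rings *)

Section LocalData.
Variables (R : comNzRingType) (P : prime_idealr R).
Local Notation L := (localization P).
Local Notation I := (P : pred R).
Local Open Scope quotient_scope.

Definition loc (a : R) : L := \pi_L (Localization.embed P a).

Lemma loc1 : loc 1 = 1.
Proof. by rewrite [RHS](_ : _ = Localization.one P) // /Localization.one; unlock. Qed.

Lemma loc0 : loc 0 = 0.
Proof. by rewrite [RHS](_ : _ = Localization.zero P) // /Localization.zero; unlock. Qed.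

Lemma locD a b : loc (a + b) = loc a + loc b.
Proof.
rewrite [RHS](_ : _ = Localization.add (loc a) (loc b)) // -Localization.pi_add.
by congr (\pi_L _); apply: Localization.frac_eq; rewrite /= ?mulr1.
Qed.

Lemma locM a b : loc (a * b) = loc a * loc b.
Proof.
rewrite [RHS](_ : _ = Localization.mul (loc a) (loc b)) // -Localization.pi_mul.
by congr (\pi_L _); apply: Localization.frac_eq; rewrite /= ?mulr1.
Qed.

Lemma loc_sum (T : Type) (r : seq T) (F : T -> R) :
  loc (\sum_(i <- r) F i) = \sum_(i <- r) loc (F i).
Proof. exact: (big_morph loc locD loc0). Qed.

Lemma loc_unit s : s \notin I -> exists v, loc s * v = 1.
Proof.
move=> sI; exists (\pi_L (@Localization.Frac R P (1, s) sI)).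
rewrite [LHS](_ : _ = Localization.mul (loc s) (\pi_L (@Localization.Frac R P (1, s) sI))) //.
rewrite -Localization.pi_mul -loc1; apply: Localization.pi_eq.
by exists 1; [exact: Localization.den1|rewrite /= !mulr1 !mul1r].
Qed.

Lemma loc_frac (z : L) : exists a s, s \notin I /\ z * loc s = loc a.
Proof.
elim/quotW: z => -[[a s] sI]; exists a, s; split=> //.
rewrite [LHS](_ : _ = Localization.mul (\pi_L (@Localization.Frac R P (a, s) sI)) (loc s)) //.
rewrite -Localization.pi_mul; apply: Localization.pi_eq.
by exists 1; [exact: Localization.den1|rewrite /= !mulr1 !mul1r mulrC].
Qed.

Lemma loc_eq a b : loc a = loc b -> exists2 u, u \notin I & u * a = u * b.
Proof.
move=> /eqP; rewrite eqmodE => /asboolP[u uI /=]; rewrite !mulr1.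
by exists u.
Qed.

Lemma notinM u v : u \notin I -> v \notin I -> u * v \notin I.
Proof. exact: Localization.denM. Qed.

Lemma common_denominator n (d : 'I_n -> L) :
  exists T (b : 'I_n -> R), T \notin I /\ forall i, d i * loc T = loc (b i).
Proof.
have /choice[t tP] (i : 'I_n) : exists t : R * R, t.2 \notin I /\ d i * loc t.2 = loc t.1.
  by have [a [s [sI e]]] := loc_frac (d i); exists (a, s).
exists (\prod_i (t i).2), (fun i => (t i).1 * \prod_(j | j != i) (t j).2); split.
  elim/big_ind: _ => [|x y|i _]; [exact: Localization.den1|exact: notinM|by case: (tP i)].
by move=> i; rewrite (bigD1 i) //= !locM mulrA; case: (tP i) => _ ->.
Qed.

Lemma idealr_notin_loc (J : idealr L) a : a \notin I -> loc a \in (J : pred L) -> False.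
Proof.
move=> /loc_unit[v av] aJ; have := idealr1 J.
by rewrite -av mulrC idealMr.
Qed.

(** Clearing denominators turns regularity of the localization into statements about elements and
    primes of [R]. What is retained of the dimension is a chain as long as the number of generators
    of the maximal ideal. *)
Lemma regular_local_data : regular_local L ->
  exists e (x : 'I_e -> R) (C : nat -> set R),
    [/\ forall i, x i \in I,
        forall a, a \in I -> exists s (b : 'I_e -> R),
          s \notin I /\ s * a = \sum_(i < e) b i * x i,
        forall i, prime_set (C i),
        forall i, C i `<=` [set a | a \in I] &
        forall i, (i < e)%N -> C i `<=` C i.+1 /\ exists2 u, C i.+1 u & ~ C i u].
Proof.
move=> [_ [m [maxm _ [e [[[Q Qchain] _] [z mz]]]]]].
(* The extension of the prime to the localization. It contains [m], as a fraction with numerator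
   outside the prime is a unit, and maximality gives equality. *)
pose S : {pred L} := fun z => `[< exists a s, [/\ a \in I, s \notin I & z * loc s = loc a] >].
have idS : idealr_closed S.
  split.
  - apply/asboolP; exists 0, 1; rewrite idealr0 loc0 mul0r; split=> //.
    exact: Localization.den1.
  - apply/asboolPn => -[a [s [aI sI]]]; rewrite mul1r => /loc_eq[u uI e1].
    by have := notinM uI sI; rewrite e1 idealMr.
  - move=> c u v /asboolP[a [s [aI sI ea]]] /asboolP[b [t [bI tI eb]]].
    have [k [r [rI er]]] := loc_frac c.
    apply/asboolP; exists (k * t * a + (r * s) * b), (r * s * t); split.
    + by rewrite rpredD // idealMr.
    + by rewrite !notinM.
    + rewrite locD !locM -ea -eb -er; ring.
pose J : idealr L := HB.pack S (isIdealr.Build L S idS).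
have mJ w : w \in (J : pred L) -> w \in (m : pred L).
  move=> wJ; rewrite -(maxm J) // => y ym; apply/asboolP.
  have [a [s [sI es]]] := loc_frac y; exists a, s; split=> //.
  apply/negPn/negP => aI; apply: (idealr_notin_loc (J := m) aI).
  by rewrite -es mulrC idealMr.
have Jm w : w \in (m : pred L) -> w \in (J : pred L).
  move=> wm; apply/asboolP; have [a [s [sI es]]] := loc_frac w; exists a, s; split=> //.
  apply/negPn/negP => aI; apply: (idealr_notin_loc (J := m) aI).
  by rewrite -es mulrC idealMr.
have zm i : z i \in (m : pred L).
  suff : [set y | y \in (m : pred L)] (z i) by [].
  rewrite mz; exists (fun j => (j == i)%:R).
  by rewrite (bigD1 i) //= eqxx mul1r big1 ?addr0 // => j /negbTE->; rewrite mul0r.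
have /choice[x xP] (i : 'I_e) : exists x, exists2 s, x \in I & s \notin I /\ z i * loc s = loc x.
  by have /asboolP[a [s [aI sI es]]] := Jm _ (zm i); exists a, s.
exists e, x, (fun i => [set a | loc a \in (Q i : pred L)]); split.
- by move=> i; have [] := xP i.
- move=> a aI; have : [set y | y \in (m : pred L)] (loc a).
    apply: mJ; apply/asboolP; exists a, 1; rewrite loc1 mulr1; split=> //.
    exact: Localization.den1.
  rewrite mz => -[c ec].
  have /choice[d dP] (i : 'I_e) : exists d, d * loc (x i) = z i.
    have [s _ [/loc_unit[v sv] zs]] := xP i.
    by exists v; rewrite -zs mulrCA [v * _]mulrC sv mulr1.
  have [T [b [TI bP]]] := common_denominator (fun i => c i * d i).
  have : loc (T * a) = loc (\sum_(i < e) b i * x i).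
    rewrite locM ec loc_sum mulr_sumr; apply: eq_bigr => i _.
    by rewrite locM -bP -dP; ring.
  move=> /loc_eq[u uI eu]; exists (u * T), (fun i => u * b i); split; first exact: notinM.
  by rewrite -mulrA eu mulr_sumr; apply: eq_bigr => i _; rewrite mulrA.
- move=> i; split.
  + split; rewrite /= ?loc0 ?idealr0 //.
      by move=> a b aQ bQ; rewrite locD rpredD.
    by move=> a b bQ; rewrite locM idealMr.
  + by rewrite /= loc1 idealr1.
  + by move=> a b; rewrite /= locM prime_idealrM => /orP.
- move=> i a /= aQ; apply/negPn/negP => aI; exact: (idealr_notin_loc (J := Q i) aI).
- move=> i lt_i; have [sQ nQ] := Qchain _ lt_i; split=> [a /sQ//|].
  apply: contrapT => no; apply: nQ => w wQ.
  have [a [s [sI es]]] := loc_frac w; have [v sv] := loc_unit sI.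
  have aQ : loc a \in (Q i.+1 : pred L) by rewrite -es mulrC idealMr.
  apply/negPn/negP => wQ'; apply: no; exists a => // aQ'; case/negP: wQ'.
  by rewrite -[w]mulr1 -sv mulrA es mulrC idealMr.
Qed.

End LocalData.

Lemma regular_prime_data (R : comNzRingType) (f : R) (P : set R) :
  in_singular_locus f -> prime_set P -> ~ P f ->
  exists e (x : 'I_e -> R) (C : nat -> set R),
    [/\ forall i, P (x i),
        forall a, P a -> exists s (b : 'I_e -> R), ~ P s /\ s * a = \sum_(i < e) b i * x i,
        forall i, prime_set (C i),
        forall i, C i `<=` P &
        forall i, (i < e)%N -> C i `<=` C i.+1 /\ exists2 u, C i.+1 u & ~ C i u].
Proof.
move=> sing /pred_prime[Q QP] nPf.
have Q_P x : (x \in (Q : pred R)) <-> P x by rewrite QP; split=> /asboolP.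
have reg : regular_local (localization Q).
  by apply: contrapT => /sing /Q_P.
have [e [x [C [xI gen pC CI chain]]]] := regular_local_data reg.
exists e, x, C; split=> //.
- by move=> i; apply/Q_P.
- move=> a /Q_P/gen[s [b [sI e1]]]; exists s, b; split=> // /Q_P.
  by rewrite (negbTE sI).
- by move=> i a /CI /= /Q_P.
Qed.
(** * Transcendence modulo a prime *)

Section TranscendenceModulo.
Variable R : comNzRingType.
Implicit Types (E P Q C : set R) (w t : seq R).

(** Algebraic independence modulo [Q], stated in [R] itself: along a chain of primes [Q] changes
    while the elements stay the same. *)
Fixpoint trmod E w Q : Prop :=
  if w is y :: w' then (forall p, over E p -> Q p.[y] -> p = 0) /\ trmod (adj E y) w' Q
  else True.

Lemma trmod_rcons E w y Q : trmod E w Q ->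
  (forall p, over (adjs E w) p -> Q p.[y] -> p = 0) -> trmod E (rcons w y) Q.
Proof. by elim: w E => [|z w IH] E //= [trz trw] H; split=> //; apply: IH. Qed.

Lemma trmod_sub E w Q Q' : Q' `<=` Q -> trmod E w Q -> trmod E w Q'.
Proof.
move=> sQ; elim: w E => [|z w IH] E //= [trz trw]; split; last exact: IH.
by move=> p Ep /sQ; apply: trz.
Qed.

Lemma trseq_sub (F : fieldType) (E E' : set F) (w : seq F) :
  E' `<=` E -> trseq E w -> trseq E' w.
Proof.
elim: w E E' => [|z w IH] E E' //= sE [trz trw]; split.
  by move=> p Ep; apply: trz => i; apply: sE.
by apply: IH trw => _ [p Ep ->]; exists p => // i; apply: sE.
Qed.

Lemma over_image (F : fieldType) (i : {rmorphism R -> F}) E (p : {poly F}) :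
  subring_set E -> over [set i z | z in E] p -> exists2 q, over E q & p = map_poly i q.
Proof.
move=> sE Ep.
have [q qP] := choice (fun j => let: ex_intro2 x Ex e := Ep j in ex_intro _ x (conj Ex e)).
exists (\poly_(j < size p) q j) => [j|].
  by rewrite coef_poly; case: ifP => _; [case: (qP j)|exact: subring0].
apply/polyP => j; rewrite coef_map coef_poly; case: ltnP => [_|le] /=.
  by case: (qP j) => _ <-.
by rewrite rmorph0 nth_default.
Qed.

Lemma trmod_trseq (F : fieldType) (i : {rmorphism R -> F}) E w Q :
  (forall x, i x = 0 -> Q x) -> subring_set E -> trmod E w Q ->
  trseq [set i z | z in E] (map i w).
Proof.
move=> iQ; elim: w E => [|y w IH] E sE //= [try trw]; split.
  move=> _ /(over_image sE)[q Eq ->]; rewrite horner_map => /iQ/(try _ Eq) ->.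
  by rewrite rmorph0.
apply: trseq_sub (IH _ (subring_adj sE y) trw) => _ [_ /(over_image sE)[q Eq ->] ->].
by exists q.[y]; [exists q|rewrite horner_map].
Qed.

Definition meets_trivially E P := forall a, E a -> P a -> a = 0.

Lemma adj_meets E P y : meets_trivially E P ->
  (forall p, over E p -> P p.[y] -> p = 0) -> meets_trivially (adj E y) P.
Proof. by move=> EP tr _ [p Ep ->] /(tr _ Ep) ->; rewrite horner0. Qed.

Lemma exists_transcendental E P (s : seq R) : subring_set E -> ideal_set P ->
  meets_trivially E P ->
  exists t, [/\ trmod E t P, meets_trivially (adjs E t) P &
    forall y, y \in s -> exists p, [/\ over (adjs E t) p, p <> 0 & P p.[y]]].
Proof.
move=> sE [P0 _ _] EP.
(* Greedy choice of a transcendence basis from [s]: the elements [t] already chosen are carried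
   along, and algebraicity persists because the subring only grows. *)
suff H t : trmod E t P -> meets_trivially (adjs E t) P ->
  exists t', [/\ trmod E t' P, meets_trivially (adjs E t') P, adjs E t `<=` adjs E t' &
    forall y, y \in s -> exists p, [/\ over (adjs E t') p, p <> 0 & P p.[y]]].
  by have [t [tr mt _ alg]] := H [::] I EP; exists t.
elim: s t => [|y s IH] t trt mt; first by exists t; split=> // y; rewrite in_nil.
have [alg|tr] := pselect (exists p, [/\ over (adjs E t) p, p <> 0 & P p.[y]]).
  have [t' [trt' mt' stt' algs]] := IH t trt mt.
  exists t'; split=> // z; rewrite inE => /orP[/eqP->|]; last exact: algs.
  by have [p [Ep p0 Pp]] := alg; exists p; split=> // i; apply: stt'.
have try p : over (adjs E t) p -> P p.[y] -> p = 0.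
  by move=> Ep Pp; apply: contrapT => p0; apply: tr; exists p.
have [||t' [trt' mt' stt' algs]] := IH (rcons t y).
- exact: trmod_rcons.
- by rewrite adjs_rcons; apply: adj_meets.
have sEt := subring_adjs t sE; have sEt' := subring_adjs t' sE.
rewrite adjs_rcons in stt'.
exists t'; split=> //; first by move=> x Ex; apply: stt'; apply: sub_adj.
move=> z; rewrite inE => /orP[/eqP->|]; last exact: algs.
exists ('X - y%:P); split.
- apply: overB => //; first exact: overX.
  by apply: overC => //; apply: stt'; apply: mem_adj.
- by apply/eqP; rewrite polyXsubC_eq0.
- by rewrite hornerXsubC subrr.
Qed.

(** The constant term of [p] is [p.[u]] minus a multiple of [u], so it lies in both [C] and [E] and
    vanishes. Hence [p.[u]] is a multiple of [u], and [u], being outside the prime [C'], can be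
    cancelled. *)
Lemma chain_step E C C' u : subring_set E -> ideal_set C -> prime_set C' ->
  meets_trivially E C -> C' `<=` C -> C u -> ~ C' u ->
  forall p, over E p -> C' p.[u] -> p = 0.
Proof.
move=> sE idC [_ _ prC'] EC sC Cu nCu p; elim/poly_ind: p => [//|p c IH Ep].
rewrite hornerMXaddC => Cp.
have coefs j : (p * 'X + c%:P)`_j = if j is k.+1 then p`_k else c.
  by case: j => [|j]; rewrite coefD coefMX coefC /= ?add0r ?addr0.
have c0 : c = 0.
  apply: EC; first by have := Ep 0%N; rewrite coefs.
  by rewrite -(addKr (p.[u] * u) c) addrC; apply: ideal_setB => //;
     [exact: sC|case: idC => _ _; apply].
move: Cp; rewrite c0 addr0 => /prC'[Cp|//]; rewrite IH ?mul0r ?add0r //.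
by move=> j; have := Ep j.+1; rewrite coefs.
Qed.

(** Each step down the chain adds one element, transcendental modulo the smaller prime over those
    chosen before. This converts the length of a chain into a number of independent elements. *)
Lemma chain_transcendental E (C : nat -> set R) n t : subring_set E ->
  (forall j, prime_set (C j)) ->
  (forall j, (j < n)%N -> C j `<=` C j.+1 /\ exists2 u, C j.+1 u & ~ C j u) ->
  trmod E t (C n) -> meets_trivially (adjs E t) (C n) ->
  exists w, size w = (n + size t)%N /\ trmod E w (C 0%N).
Proof.
move=> sE prC; elim: n t => [|n IH] t chain trt mt; first by exists t.
have [sC [u Cu nCu]] := chain n (ltnSn n).
have [idC _ _] := prC n.+1.
have tru := chain_step (subring_adjs t sE) idC (prC n) mt sC Cu nCu.
have [|||w [sw trw]] := IH (rcons t u).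
- by move=> j jn; apply: chain; apply: ltnW.
- by apply: trmod_rcons => //; apply: trmod_sub trt.
- by rewrite adjs_rcons; apply: adj_meets => // a Ea /sC; apply: mt.
by exists w; rewrite sw size_rcons addnS.
Qed.

End TranscendenceModulo.

(** * Separable equations modulo a prime *)

Section SeparableModulo.
Variables (K : fieldType) (R : comAlgType K).
Hypothesis charK : [pchar K] =i pred0.

Lemma alg_mulrn_eq0 (x : R) n : x *+ n.+1 = 0 -> x = 0.
Proof.
move/pcharf0P: charK => ch; rewrite -scaler_nat => e.
by rewrite -(scale1r x) -(@mulVf _ n.+1%:R) ?ch // -scalerA e scaler0.
Qed.

Lemma scalars_meets (P : set R) : prime_set P -> meets_trivially (@scalars K R) P.
Proof.
move=> [[P0 _ PM] P1 _] _ [k ->] Pk; have [->|k0] := eqVneq k 0; first by rewrite scale0r.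
case: P1; rewrite -(scale1r 1) -(mulVf k0) -scalerA -mulr_algl; exact: PM.
Qed.

(** A relation of least degree works: its derivative is nonzero in characteristic zero and of
    smaller degree, so its value cannot lie in [P]. *)
Lemma separable_mod E (P : set R) y p : subring_set E -> prime_set P -> meets_trivially E P ->
  over E p -> p <> 0 -> P p.[y] -> exists m, [/\ over E m, P m.[y] & ~ P m^`().[y]].
Proof.
move=> sE [[P0 _ _] P1 _] EP Ep p0 Pp.
have exn : exists n, `[< exists p, [/\ over E p, P p.[y], p != 0 & size p = n] >].
  by exists (size p); apply/asboolP; exists p; split=> //; apply/eqP.
case: (ex_minnP exn) => n /asboolP[m [Em Pm m0 sm]] minn.
have small q : over E q -> P q.[y] -> (size q < size m)%N -> q = 0.
  move=> Eq Pq lt; apply/eqP/negP => /negP q0.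
  have /minn : `[< exists r, [/\ over E r, P r.[y], r != 0 & size r = size q] >].
    by apply/asboolP; exists q.
  by rewrite -sm leqNgt lt.
have m1 : (1 < size m)%N.
  rewrite ltnNge; apply/negP => /size1_polyC mC; move: m0 Pm (Em 0%N).
  by rewrite mC hornerC coefC /= polyC_eq0 => /eqP m0 Pm /EP/(_ Pm).
exists m; split=> // Pm'.
have /polyP/(_ (size m).-2) : m^`() = 0.
  by apply: small => //; [exact: over_deriv|apply: lt_size_deriv].
rewrite coef_deriv coef0 => /alg_mulrn_eq0.
have -> : ((size m).-2.+1 = (size m).-1)%N by case: (size m) m1 => [|[]].
by rewrite -lead_coefE => /eqP; rewrite lead_coef_eq0 (negbTE m0).
Qed.

End SeparableModulo.
(** * Étale coordinates *)

Section DerivationTheory.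
Variables (K : fieldType) (R : comAlgType K) (F : comNzRingType) (i : {rmorphism R -> F}).
Local Notation der := (@is_der K R F i).

Lemma derD D a b : der D -> D (a + b) = D a + D b. Proof. by case. Qed.
Lemma derM D a b : der D -> D (a * b) = i a * D b + i b * D a. Proof. by case. Qed.
Lemma der0 D : der D -> D 0 = 0.
Proof. by case=> _ _ /(_ 0); rewrite scale0r. Qed.
Lemma derN D a : der D -> D (- a) = - D a.
Proof.
move=> dD; apply/eqP; rewrite -subr_eq0 opprK addrC -derD // addrN.
by rewrite der0.
Qed.
Lemma der_sum D (T : Type) (r : seq T) (f : T -> R) : der D ->
  D (\sum_(j <- r) f j) = \sum_(j <- r) D (f j).
Proof.
by move=> dD; elim: r => [|j r IH]; rewrite ?big_nil ?der0 // !big_cons derD // IH.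
Qed.

Lemma der_comb d (c : 'I_d -> F) (D : 'I_d -> R -> F) : (forall a, der (D a)) ->
  der (fun r => \sum_(a < d) c a * D a r).
Proof.
move=> dD; split=> [a b|a b|k].
- by rewrite -big_split; apply: eq_bigr => j _; rewrite derD // mulrDr.
- rewrite !mulr_sumr -big_split; apply: eq_bigr => j _.
  by rewrite derM //= mulrDr !(mulrCA (c j)).
- by rewrite big1 // => j _; case: (dD j) => _ _ ->; rewrite mulr0.
Qed.

Lemma derX D a n : der D -> D (a ^+ n) = i a ^+ n.-1 * D a *+ n.
Proof.
move=> dD; elim: n => [|n IH].
  by rewrite expr0 mulr0n -(scale1r 1); case: dD.
rewrite exprS derM // IH rmorphXn /=; case: n {IH} => [|n] /=.
  by rewrite !expr0 mulr0n mulr0 add0r.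
by rewrite mulrnAr mulrA -exprS [in RHS]mulrS addrC.
Qed.

Lemma der_prod0 D (T : Type) (r : seq T) (Q : pred T) (f : T -> R) : der D ->
  (forall j, Q j -> D (f j) = 0) -> D (\prod_(j <- r | Q j) f j) = 0.
Proof.
move=> dD f0; elim/big_ind: _ => //; first by rewrite -(scale1r 1); case: dD.
by move=> a b a0 b0; rewrite derM // a0 b0 !mulr0 addr0.
Qed.

(** Applied to coefficients in [R], where the second sum only matters in higher order, and to
    constant coefficients, where it vanishes. *)
Lemma der_meval D n (x : 'I_n -> R) (j : 'I_n) (c : F) (p : mpoly n R) : der D ->
  (forall b, D (x b) = (j == b)%:R * c) ->
  D (meval x p) = i (meval x (mderiv j p)) * c +
    \sum_(m <- msupp p) i (meval x (mpolyX R m)) * D (mcoeff m p).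
Proof.
move=> dD Dx; rewrite {1}[p]mpolyE raddf_sum /= der_sum //.
have DX m : D (meval x (mpolyX R m)) = i (meval x (mpolyX R (mnm_sub m (mnm1 j)))) * c *+ m j.
  rewrite !mevalX (bigD1 j) //= [in RHS](bigD1 j) //= (derM _ _ dD) (derX _ _ dD) Dx eqxx mul1r.
  rewrite (der_prod0 _ dD); last first.
    by move=> b bj; rewrite (derX _ _ dD) Dx eq_sym (negbTE bj) mul0r mulr0 mul0rn.
  rewrite mulr0 add0r mnmBE mnm1E eqxx subn1 rmorphM rmorphXn mulrnAr.
  rewrite mulrA [i (\prod_(_ | _) _) * _]mulrC; congr (_ * i _ * _ *+ _).
  by apply: eq_bigr => b bj; rewrite mnmBE mnm1E eq_sym (negbTE bj) subn0.
have -> : meval x (mderiv j p) = \sum_(m <- msupp p)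
    ((m j)%:R * mcoeff m p) * meval x (mpolyX R (mnm_sub m (mnm1 j))).
  by rewrite /mderiv raddf_sum; apply: eq_bigr => m _; rewrite /= mevalZ.
rewrite rmorph_sum mulr_suml -big_split; apply: eq_bigr => m _ /=.
rewrite !mevalZ (derM _ _ dD) DX; congr (_ + _).
rewrite 2!rmorphM rmorph_nat mulr_natl; move: (i (mcoeff m p)) (i (meval _ _)) => a b.
by rewrite mulrnAr mulrA !mulrnAl.
Qed.

(** The [c l] do not depend on [D]: this is the relation [dr = sum c_l dw_l] between Kähler
    differentials, expressed through all derivations at once. *)
Lemma der_adjs (w : seq R) (r : R) : adjs (@scalars K R) w r ->
  exists c : 'I_(size w) -> R, forall D, der D -> D r = \sum_(l < size w) i (c l) * D w`_l.
Proof.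
move: r; pose S : set R := [set r | exists c : 'I_(size w) -> R,
  forall D, der D -> D r = \sum_(l < size w) i (c l) * D w`_l].
apply: (@adjs_sub _ _ S).
- split.
  + exists (fun=> 0) => D dD; rewrite -(scale1r 1); case: dD => _ _ ->.
    by rewrite big1 // => l _; rewrite rmorph0 mul0r.
  + move=> x y [c cx] [c' cy]; exists (fun l => c l - c' l) => D dD.
    rewrite derD // derN // (cx D dD) (cy D dD) -sumrB; apply: eq_bigr => l _.
    by rewrite rmorphB mulrBl.
  + move=> x y [c cx] [c' cy]; exists (fun l => x * c' l + y * c l) => D dD.
    rewrite derM // (cx D dD) (cy D dD) !mulr_sumr -big_split; apply: eq_bigr => l _ /=.
    by rewrite rmorphD !rmorphM mulrDl !mulrA.
- move=> _ [k ->]; exists (fun=> 0) => D [_ _ ->].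
  by rewrite big1 // => l _; rewrite rmorph0 mul0r.
- move=> y yw; have lt_y : (index y w < size w)%N by rewrite index_mem.
  exists (fun l => (l == Ordinal lt_y)%:R) => D dD.
  rewrite (bigD1 (Ordinal lt_y)) //= eqxx rmorph1 mul1r nth_index // big1 ?addr0 //.
  by move=> l /negbTE->; rewrite rmorph0 mul0r.
Qed.

Lemma der_horner (t : seq R) (m : {poly R}) (y : R) : over (adjs (@scalars K R) t) m ->
  exists c : 'I_(size t) -> R, forall D, der D ->
    D m.[y] = \sum_(l < size t) i (c l) * D t`_l + i m^`().[y] * D y.
Proof.
elim/poly_ind: m => [_|p c IH Em].
  exists (fun=> 0) => D dD; rewrite deriv0 !horner0 (der0 dD) rmorph0 mul0r addr0.
  by rewrite big1 // => l _; rewrite mul0r.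
have coefs j : (p * 'X + c%:P)`_j = if j is k.+1 then p`_k else c.
  by case: j => [|j]; rewrite coefD coefMX coefC /= ?add0r ?addr0.
have [|a ap] := IH; first by move=> j; have := Em j.+1; rewrite coefs.
have [|b bc] := @der_adjs t c; first by have := Em 0%N; rewrite coefs.
exists (fun l => y * a l + b l) => D dD.
rewrite hornerMXaddC derD // derM // (ap D dD) (bc D dD) derivD derivC addr0 derivM derivX mulr1.
rewrite hornerD hornerM hornerX rmorphD rmorphM.
have -> : \sum_(l < size t) i (y * a l + b l) * D t`_l =
    i y * \sum_(l < size t) i (a l) * D t`_l + \sum_(l < size t) i (b l) * D t`_l.
  rewrite mulr_sumr -big_split; apply: eq_bigr => l _ /=.
  by rewrite rmorphD rmorphM mulrDl mulrA.
by ring.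
Qed.

End DerivationTheory.

Lemma det_notin_prime (R : comNzRingType) (P : set R) n (A : 'M[R]_n) : prime_set P ->
  (forall k, ~ P (A k k)) -> (forall k l, k != l -> P (A k l)) -> ~ P (\det A).
Proof.
move=> prP; have [F [j jP]] := residue_field prP.
move=> Ad Ao; rewrite -jP -det_map_mx.
have -> : map_mx j A = diag_mx (\row_k j (A k k)).
  apply/matrixP => k l; rewrite !mxE; case: eqP => [->|/eqP kl]; first by rewrite mulr1n.
  by rewrite mulr0n; apply/jP; apply: Ao.
rewrite det_diag => /eqP; rewrite prodf_seq_eq0 => /hasP[k _ /=].
by rewrite mxE => /eqP/jP; apply: Ad.
Qed.

(** * Generators of the differentials at a prime *)

Section Omega.
Variables (K : fieldType) (R : comAlgType K) (F : fieldType) (i : {rmorphism R -> F}).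
Local Notation der := (@is_der K R F i).
Variables (P : set R) (gens t : seq R) (e : nat) (x : 'I_e -> R).
Hypotheses (prP : prime_set P) (gen : generates [set x | x \in gens]).
Hypothesis xP : forall j, P (x j).
Hypothesis xgen : forall a, P a ->
  exists s (b : 'I_e -> R), ~ P s /\ s * a = \sum_(j < e) b j * x j.
Hypothesis sep : forall y, y \in gens ->
  exists m, [/\ over (adjs (@scalars K R) t) m, P m.[y] & ~ P m^`().[y]].

Definition coords (j : 'I_(e + size t)) : R :=
  match fintype.split j with inl a => x a | inr b => t`_b end.

Lemma coords_sum D (a : 'I_e -> F) (b : 'I_(size t) -> F) :
  \sum_(j < e) a j * D (x j) + \sum_(l < size t) b l * D t`_l =
  \sum_(j < e + size t) (match fintype.split j with inl u => a u | inr v => b v end) * D (coords j).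
Proof.
rewrite big_split_ord; congr (_ + _); apply: eq_bigr => j _; rewrite /coords.
  by rewrite (unsplitK (inl j)).
by rewrite (unsplitK (inr j)).
Qed.

(* Nakayama's lemma for the module generated by the [D y], [y] in [gens]: modulo the
   prime [P] the equations [m y = 0] determine [D y] from the values on the coordinates. *)
Lemma omega_generators : exists h (c : 'I_(size gens) -> 'I_(e + size t) -> R), ~ P h /\
  forall D, der D -> forall k : 'I_(size gens), i h * D gens`_k = \sum_j i (c k j) * D (coords j).
Proof.
have [[P0 PD PM] _ Ppr] := prP.
pose N := size gens.
have [m mP] := choice (fun k : 'I_N =>
  let: ex_intro m mp := sep (mem_nth 0 (ltn_ord k)) in ex_intro _ m mp).
have exs (k : 'I_N) : exists s : R * ('I_e -> R), ~ P s.1 /\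
    s.1 * (m k).[gens`_k] = \sum_(j < e) s.2 j * x j.
  by have [_ /xgen[s [b sb]] _] := mP k; exists (s, b).
have [s sP] := choice exs.
have der_gens r := der_adjs i (generates_adjs gen r).
have [sg sgP] := choice (fun k : 'I_N => der_gens (s k).1).
have [bt btP] := choice (fun kj : 'I_N * 'I_e => der_gens ((s kj.1).2 kj.2)).
have [n nP] := choice (fun k : 'I_N =>
  let: And3 Em _ _ := mP k in der_horner i gens`_k Em).
(* Differentiating [s m(y) = sum b_j x_j], where [m(y)] and the [x_j] lie in [P], gives a linear
   system for the [D y] whose matrix [A] is diagonal modulo [P]. The adjugate solves it with
   denominator [\det A]. *)
pose A : 'M[R]_N := \matrix_(k, l) (((s k).1 * (m k)^`().[gens`_k]) *+ (k == l) +
  (m k).[gens`_k] * sg k l - \sum_(j < e) x j * bt (k, j) l).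
pose B k j := match fintype.split j with inl u => (s k).2 u | inr v => - ((s k).1 * n k v) end.
have PB a b : P a -> P b -> P (a - b) by apply: ideal_setB; case: prP.
have Poff k l : P ((m k).[gens`_k] * sg k l - \sum_(j < e) x j * bt (k, j) l).
  apply: PB; first by rewrite mulrC; apply: PM; case: (mP k).
  by apply: ideal_set_sum => [|j _]; [case: prP|rewrite mulrC; apply: PM].
have main D : der D -> forall k : 'I_N, \sum_l i (A k l) * D gens`_l = \sum_j i (B k j) * D (coords j).
  move=> dD k.
  have -> : \sum_j i (B k j) * D (coords j) =
      \sum_(j < e) i ((s k).2 j) * D (x j) - \sum_(l < size t) i ((s k).1 * n k l) * D t`_l.
    rewrite -sumrN; under [X in _ = _ + X]eq_bigr do rewrite -mulNr -rmorphN.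
    by rewrite coords_sum; apply: eq_bigr => j _; rewrite /B; case: (fintype.split j).
  have -> : \sum_l i (A k l) * D gens`_l =
     i (s k).1 * i (m k)^`().[gens`_k] * D gens`_k + i (m k).[gens`_k] * D (s k).1
     - \sum_(j < e) i (x j) * D ((s k).2 j).
    have -> : \sum_(j < e) i (x j) * D ((s k).2 j) =
        \sum_l i (\sum_(j < e) x j * bt (k, j) l) * D gens`_l.
      under [RHS]eq_bigr do rewrite rmorph_sum mulr_suml.
      rewrite exchange_big; apply: eq_bigr => j _ /=; rewrite (btP (k, j) D dD) mulr_sumr.
      by apply: eq_bigr => l _; rewrite rmorphM mulrA.
    rewrite (sgP k D dD) mulr_sumr -rmorphM.
    rewrite [X in X + _ - _](_ : _ = \sum_l i (((s k).1 * (m k)^`().[gens`_k]) *+ (k == l)) * D gens`_l).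
      rewrite -big_split -sumrB; apply: eq_bigr => l _ /=.
      by rewrite mxE rmorphB rmorphD [i (_ * sg k l)]rmorphM; ring.
    rewrite (bigD1 k) //= eqxx mulr1n big1 ?addr0 // => l.
    by rewrite eq_sym => /negbTE->; rewrite mulr0n rmorph0 mul0r.
  have [_ /(congr1 D)] := sP k; rewrite (derM _ _ dD) (nP k D dD) (der_sum _ _ dD).
  under [X in _ = X -> _]eq_bigr do rewrite (derM _ _ dD).
  rewrite big_split /= => e1; apply/eqP; rewrite subr_eq addrAC; apply/eqP.
  rewrite [X in _ = X - _](_ : _ = \sum_(j < e) i ((s k).2 j) * D (x j) + \sum_(j < e) i (x j) * D ((s k).2 j)) //.
  rewrite -e1.
  have -> : \sum_(l < size t) i ((s k).1 * n k l) * D t`_l =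
      i (s k).1 * \sum_(l < size t) i (n k l) * D t`_l.
    by rewrite mulr_sumr; apply: eq_bigr => l _; rewrite rmorphM mulrA.
  by ring.
exists (\det A), (fun k j => \sum_l (\adj A) k l * B l j); split.
  apply: det_notin_prime => // [k|k l kl]; rewrite mxE; last first.
    by rewrite (negbTE kl) mulr0n add0r; apply: Poff.
  rewrite eqxx mulr1n -addrA => PA.
  have [_ _ nPm'] := mP k; have [nPs _] := sP k.
  have : P ((s k).1 * (m k)^`().[gens`_k]).
    by rewrite -[_ * _](addrK ((m k).[gens`_k] * sg k k - \sum_(j < e) x j * bt (k, j) k)); apply: PB.
  by case/Ppr.
move=> D dD k.
have -> : i (\det A) * D gens`_k = \sum_l i ((\adj A *m A) k l) * D gens`_l.
  rewrite mul_adj_mx (bigD1 k) //= mxE eqxx mulr1n big1 ?addr0 // => l.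
  by rewrite eq_sym => kl; rewrite mxE (negbTE kl) mulr0n rmorph0 mul0r.
under eq_bigr do rewrite mxE rmorph_sum mulr_suml.
rewrite exchange_big /=.
under [RHS]eq_bigr do rewrite rmorph_sum mulr_suml.
rewrite [RHS]exchange_big /=; apply: eq_bigr => l _.
under eq_bigr do rewrite rmorphM -mulrA.
by rewrite -mulr_sumr main // mulr_sumr; apply: eq_bigr => j _; rewrite rmorphM mulrA.
Qed.

End Omega.
Section LocalChart.
Variables (K : fieldType) (R : comAlgType K).

(* Étale coordinates [z] at the prime [P], extending generators [x] of the maximal
   ideal of [R_P]; [Q] is a minimal prime below [P] and [i] is the map to the residue
   field of [Q].  The derivations [h * dd j] map [R] to [R/Q]. *)
Record local_chart (P Q : set R) (F : fieldType) (i : {rmorphism R -> F}) e l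
    (x : 'I_e -> R) (z : 'I_(e + l) -> R) (h : R) (dd : 'I_(e + l) -> R -> F) : Prop := {
  chart_prime : prime_set Q;
  chart_ker : forall r, i r = 0 <-> Q r;
  chart_sub : Q `<=` P;
  chart_mem : forall j, P (x j);
  chart_gen : forall a, P a ->
    exists s (b : 'I_e -> R), ~ P s /\ s * a = \sum_(j < e) b j * x j;
  chart_coord : forall j, z (lshift l j) = x j;
  chart_den : ~ P h;
  chart_der : forall j, is_der i (dd j);
  chart_dual : forall a b, dd a (z b) = (a == b)%:R;
  chart_integral : forall j r, exists r', i r' = i h * dd j r;
  chart_kills : forall j r, Q r -> dd j r = 0;
  chart_inj : forall D, is_der i D -> (forall b, D (z b) = 0) -> forall r, D r = 0
}.

(** A row relation of [Z] is a combination of the [D a] killing every [z b], hence zero, while its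
    value at [w b] is its [b]-th coefficient. So [Z] is invertible, and its inverse makes the [D a]
    dual to [z] instead of [w]. *)
Lemma dual_derivations (F : fieldType) (i : {rmorphism R -> F}) d (z : 'I_d -> R)
    (w : 'I_d -> R) (D : 'I_d -> R -> F) :
  (forall a, is_der i (D a)) -> (forall a b, D a (w b) = (a == b)%:R) ->
  (forall D, is_der i D -> (forall b, D (z b) = 0) -> forall r, D r = 0) ->
  exists dd : 'I_d -> R -> F, [/\ forall a, is_der i (dd a),
    forall a b, dd a (z b) = (a == b)%:R
    & forall r, (forall a, D a r = 0) -> forall a, dd a r = 0].
Proof.
move=> dD Dw inj; pose Z : 'M[F]_d := \matrix_(a, b) D a (z b).
have Zu : Z \in unitmx.
  rewrite -row_free_unit; apply: inj_row_free => v vZ.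
  have vz c : \sum_(a < d) v 0 a * D a (z c) = 0.
    have /rowP/(_ c) := vZ; rewrite !mxE => e; rewrite -[RHS]e.
    by apply: eq_bigr => a _; rewrite mxE.
  apply/rowP => b; have := inj _ (der_comb (v 0) dD) vz (w b).
  rewrite (bigD1 b) //= Dw eqxx mulr1 big1 ?addr0 ?mxE // => a.
  by rewrite Dw => /negbTE->; rewrite mulr0.
exists (fun a r => \sum_(c < d) invmx Z a c * D c r); split=> [a|a b|r Dr a].
- exact: der_comb.
- have /matrixP/(_ a b) := mulVmx Zu; rewrite !mxE => <-.
  by apply: eq_bigr => c _; rewrite mxE.
- by rewrite big1 // => c _; rewrite Dr mulr0.
Qed.

Lemma exists_local_chart (f : R) (P : set R) : [pchar K] =i pred0 -> finitely_generated R ->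
  in_singular_locus f -> prime_set P -> ~ P f ->
  exists Q F i e l x z h dd, @local_chart P Q F i e l x z h dd.
Proof.
move=> charK [gens gen] sing prP nPf.
have [e [x [C [xP xgen prC CP chain]]]] := regular_prime_data sing prP nPf.
have [idP _ _] := prP; have sS := subring_scalars R.
have [t [trt mt alg]] := exists_transcendental gens sS idP (scalars_meets prP).
have st := subring_adjs t sS.
have sep y : y \in gens -> exists m, [/\ over (adjs (@scalars K R) t) m, P m.[y] & ~ P m^`().[y]].
  by move=> /alg[p [Ep p0 Pp]]; apply: (separable_mod charK st prP mt Ep p0 Pp).
(* As many independent elements as coordinates: [size t] from the residue field of [P] and [e] from
   the chain. Regularity is this agreement of numbers. *)
have [w [sw trw]] : exists w, size w = (e + size t)%N /\ trmod (@scalars K R) w (C 0%N).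
  apply: chain_transcendental => //; first exact: trmod_sub trt.
  by move=> a Ea /CP; apply: mt.
have [F [i iC]] := residue_field (prC 0%N).
have [h [c [nPh hc]]] := omega_generators i prP gen xP xgen sep.
pose z : 'I_(e + size t) -> R := @coords _ _ t e x.
have ih0 : i h != 0 by apply/eqP => /iC/CP.
have inj D : is_der i D -> (forall b, D (z b) = 0) -> forall r, D r = 0.
  move=> dD Dz r; have [a ar] := der_adjs i (generates_adjs gen r).
  rewrite (ar D dD) big1 // => k _; have := hc D dD k.
  rewrite [RHS]big1 => [/eqP|b _]; last by rewrite Dz mulr0.
  by rewrite mulf_eq0 (negbTE ih0) /= => /eqP->; rewrite mulr0.
have trF := trmod_trseq (fun r => (iC r).1) sS trw.
have exD (a : 'I_(e + size t)) : exists D, [/\ is_der i D,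
    forall b : 'I_(e + size t), D w`_b = (a == b)%:R & forall x, i x = 0 -> D x = 0].
  have [D [dD Dw Dk]] := exists_der (fun b => (val a == b)%:R) charK gen sS (@subset_refl _ _) trF.
  by exists D; split=> // [b|r ir]; [rewrite Dw // sw|apply: Dk; left].
have [D DP] := choice exD.
have [|a b|dd [ddd ddz ddk]] :=
  @dual_derivations F i _ z (fun b : 'I_(e + size t) => w`_b) D _ _ inj.
- by move=> a; case: (DP a).
- by case: (DP a).
exists (C 0%N), F, i, e, (size t), x, z, h, dd; split=> //.
- by move=> j; rewrite /z /coords (unsplitK (inl j)).
- move=> j r; have [a ar] := der_adjs i (generates_adjs gen r).
  (* By [omega_generators] the [c k j] represent [h] times the partial derivatives of the
     generators, so [h] is a common denominator for all [r]. *)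
  exists (\sum_k a k * c k j); rewrite (ar _ (ddd j)) rmorph_sum mulr_sumr.
  apply: eq_bigr => k _; rewrite rmorphM mulrCA (hc _ (ddd j) k); congr (_ * _).
  rewrite (bigD1 j) //= ddz eqxx mulr1 big1 ?addr0 // => b.
  by rewrite ddz eq_sym => /negbTE->; rewrite mulr0.
- by move=> j r /iC ir; apply: ddk => a; case: (DP a) => _ _; apply.
Qed.

End LocalChart.
(** * The local ring is a domain *)

Section OrderFiltration.
Variables (R : comNzRingType) (n : nat).

(** Membership in the [m]-th power of the ideal generated by the variables. *)
Definition mord m (p : mpoly n R) := forall a, (mdeg a < m)%N -> mcoeff a p = 0.

Lemma mordD m p q : mord m p -> mord m q -> mord m (p + q).
Proof. by move=> mp mq a am; rewrite mcoeffD mp // mq // addr0. Qed.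

Lemma mord0 m : mord m 0. Proof. by move=> a _; rewrite mcoeff0. Qed.

Lemma mordZ m c p : mord m p -> mord m (c *: p).
Proof. by move=> mp a am; rewrite mcoeffZ mp // mulr0. Qed.

Lemma mordX m a : (m <= mdeg a)%N -> mord m (mpolyX R a).
Proof.
move=> ma b bm; rewrite mcoeffX; case: eqP => // ab.
by move: bm; rewrite -ab ltnNge ma.
Qed.

Lemma mord_sum m (T : eqType) (r : seq T) (f : T -> mpoly n R) :
  (forall j, j \in r -> mord m (f j)) -> mord m (\sum_(j <- r) f j).
Proof.
move=> mf; rewrite big_seq; elim/big_ind: _ => //; [exact: mord0|exact: mordD].
Qed.

Lemma mcoeff_msupp_sum (p : mpoly n R) (c : multinom n -> R) a :
  mcoeff a (\sum_(m <- msupp p) c m *: mpolyX R m) = if a \in msupp p then c a else 0.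
Proof.
rewrite raddf_sum /=; under eq_bigr do rewrite mcoeffZ mcoeffX.
case: ifP => [ap|nap].
  rewrite (bigD1_seq a) //= ?msupp_uniq // eqxx mulr1 big1 ?addr0 // => b /negbTE->.
  by rewrite mulr0.
rewrite big_seq big1 // => b bp; case: eqP => [ba|]; last by rewrite mulr0.
by rewrite -ba bp in nap.
Qed.

Lemma mord_msupp m (p : mpoly n R) a : mord m p -> a \in msupp p -> (m <= mdeg a)%N.
Proof.
by move=> mp; rewrite mcoeff_msupp leqNgt => p0; apply/negP => /mp/eqP; rewrite (negbTE p0).
Qed.

Lemma mord_deriv m j (p : mpoly n R) : mord m.+1 p -> mord m (mderiv j p).
Proof.
by move=> mp a am; rewrite mcoeff_deriv mp ?mul0rn // mdegD mdeg1 addn1.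
Qed.

Lemma mord1_ideal (P : set R) (x : 'I_n -> R) p : ideal_set P -> (forall j, P (x j)) ->
  mord 1 p -> P (meval x p).
Proof.
move=> idP xP mp; rewrite [p]mpolyE raddf_sum /= big_seq.
apply: ideal_set_sum => // a ap; have [_ _ PM] := idP.
rewrite mevalZ; apply: (PM); have := mord_msupp mp ap; rewrite lt0n mdeg_eq0 => a0.
have [j aj] : exists j, a j != 0%N.
  apply: contrapT => no; case/eqP: a0; apply/mnmP => j; rewrite mnm0E.
  by apply/eqP/negPn/negP => aj; apply: no; exists j.
rewrite mevalX (bigD1 j) //= -(prednK (n := a j)) ?lt0n // exprSr mulrC mulrA.
exact: PM.
Qed.

End OrderFiltration.

(** * Krull's intersection theorem *)

Section Krull.
Variables (R : comNzRingType) (P : set R) (e : nat) (x : 'I_e -> R).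
Hypotheses (noe : noeth R) (prP : prime_set P) (xP : forall j, P (x j)).

(** Elements whose image in the local ring at [P] lies in every power of the ideal generated by the
    [x j]. *)
Definition deep : set R := [set z | forall m, exists s p,
  [/\ ~ P s, mord m p & s * z = meval x p]].

Lemma ideal_deep : ideal_set deep.
Proof.
have [idP P1 Ppr] := prP; split.
- move=> m; exists 1, 0; split=> //; first exact: mord0.
  by rewrite mulr0 raddf0.
- move=> z w zd wd m; have [s [p [sP mp sz]]] := zd m; have [t [q [tP mq tw]]] := wd m.
  exists (s * t), (t *: p + s *: q); split; first by case/Ppr.
    by apply: mordD; apply: mordZ.
  by rewrite mevalD !mevalZ -sz -tw; ring.
- move=> a z zd m; have [s [p [sP mp sz]]] := zd m.
  exists s, (a *: p); split=> //; first exact: mordZ.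
  by rewrite mevalZ -sz mulrCA.
Qed.

Lemma ispan_mem n (z : 'I_n -> R) j : ispan z (z j).
Proof.
exists (fun k => (k == j)%:R).
by rewrite (bigD1 j) //= eqxx mul1r big1 ?addr0 // => k /negbTE->; rewrite mul0r.
Qed.

(* Krull's intersection theorem for the local ring at [P]. *)
Lemma deep_killed : exists2 s, ~ P s & forall z, deep z -> s * z = 0.
Proof.
have [n [z Dz]] := noe ideal_deep; have [idP P1 Ppr] := prP; have [P0 PD PM] := idP.
have [D0 DD DM] := ideal_deep.
pose PJ : set R := [set w | exists c : 'I_n -> R, (forall j, P (c j)) /\ w = \sum_(j < n) c j * z j].
have idPJ : ideal_set PJ.
  split.
  - by exists (fun=> 0); split=> //; rewrite big1 // => j _; rewrite mul0r.
  - move=> a b [c [Pc ->]] [d [Pd ->]]; exists (fun j => c j + d j); split.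
      by move=> j; apply: PD.
    by rewrite -big_split; apply: eq_bigr => j _; rewrite mulrDl.
  - move=> a b [c [Pc ->]]; exists (fun j => a * c j); split; first by move=> j; apply: PM.
    by rewrite mulr_sumr; apply: eq_bigr => j _; rewrite mulrA.
(* [N] is maximal among ideals above [P deep] that meet [deep] inside [P deep]. It will contain a
   power of each [x j], hence all values of high order, and so a multiple [s * z j], [s] outside
   [P], of each generator of [deep]. *)
have [||N [[idN NPJ] PJN maxN]] := @Zorn_above R
    [set N | ideal_set N /\ forall w, N w -> deep w -> PJ w] PJ.
- by split.
- move=> C C0 Cg totC; split.
    by apply: ideal_set_chain => // X /Cg[].
  by move=> w [X CX Xw]; have [_] := Cg _ CX; apply.
have [N0 ND NM] := idN.
have PxPJ y w : P y -> deep w -> PJ (y * w).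
  move=> Py; rewrite Dz => -[c ->]; exists (fun j => y * c j); split.
    by move=> j; rewrite mulrC; apply: PM.
  by rewrite mulr_sumr; apply: eq_bigr => j _; rewrite mulrA.
(* The colon ideals of [N] by the powers of [x j] stop growing at some step [k]. Then
   [N + (x j ^+ k)] still meets [deep] inside [P deep], and maximality puts [x j ^+ k] in [N]. *)
have pow j : exists k, N (x j ^+ k).

  have [|k|k kP] := @noeth_chain R (fun k => [set a | N (a * x j ^+ k)]) noe.
  - by move=> k; apply: ideal_set_colon.
  - by move=> a /= Na; rewrite exprS mulrCA; apply: NM.
  exists k; apply: (maxN [set b | exists a c, N a /\ b = a + c * x j ^+ k]).
  - by move=> a Na; exists a, 0; rewrite mul0r addr0.
  - split.
      split.
      + by exists 0, 0; rewrite mul0r addr0.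
      + move=> _ _ [a [c [Na ->]]] [b [d [Nb ->]]]; exists (a + b), (c + d).
        by split; [exact: ND|rewrite mulrDl addrACA].
      + move=> r _ [a [c [Na ->]]]; exists (r * a), (r * c).
        by split; [exact: NM|rewrite mulrDr mulrA].
    move=> b [a [c [Na eb]]] db; apply: NPJ => //; rewrite eb; apply: (ND) => //.
    apply: kP => /=; rewrite exprS mulrCA.
    have -> : x j * (c * x j ^+ k) = x j * b - x j * a by rewrite eb mulrDr addrAC subrr add0r.
    apply: ideal_setB => //; last exact: NM.
    by apply: PJN; apply: PxPJ => //; exact: xP.
  - by exists 0, 1; rewrite mul1r add0r.
have [k kN] := choice pow.
have deepN p : mord (\sum_j k j).+1 p -> N (meval x p).
  move=> mp; rewrite [p]mpolyE raddf_sum /= big_seq; apply: ideal_set_sum => // a ap.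
  rewrite mevalZ; apply: (NM); have := mord_msupp mp ap; rewrite mdegE => lt_ka.
  have [j kj] : exists j, (k j <= a j)%N.
    apply: contrapT => no; move: lt_ka; rewrite ltnNge => /negP; apply; apply: leq_sum => j _.
    by rewrite leqNgt; apply/negP => ajk; apply: no; exists j; apply: ltnW.
  rewrite mevalX (bigD1 j) //= -(subnK kj) exprD mulrAC; exact: NM.
have DzP j : exists s (c : 'I_n -> R), [/\ ~ P s, forall l, P (c l) & s * z j = \sum_(l < n) c l * z l].
  have dz : deep (z j) by rewrite Dz; exact: ispan_mem.
  have [s [p [sP mp sz]]] := dz (\sum_j k j).+1.
  have [c [Pc ec]] : PJ (s * z j) by apply: NPJ; [rewrite sz; exact: deepN|exact: DM].
  by exists s, c.
have [s sP] := choice DzP; have [c cP] := choice sP.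
(* Nakayama by determinants: [A] kills the vector of generators of [deep], and modulo [P] it is
   diagonal with nonzero entries. *)
pose A : 'M[R]_n := \matrix_(j, l) (s j *+ (j == l) - c j l).
have Az j : \sum_l A j l * z l = 0.
  under eq_bigr do rewrite mxE mulrBl.
  rewrite sumrB; have [_ _ <-] := cP j; rewrite (bigD1 j) //= eqxx mulr1n big1 ?addr0 ?subrr //.
  by move=> l; rewrite eq_sym => /negbTE->; rewrite mulr0n mul0r.
exists (\det A).
  apply: det_notin_prime => // [j|j l jl]; rewrite mxE; have [nPs Pc _] := cP j.
    rewrite eqxx mulr1n => PA; apply: nPs; rewrite -(subrK (c j j) (s j)); exact: PD.
  by rewrite (negbTE jl) mulr0n sub0r; apply: ideal_setN.
have detz j : \det A * z j = 0.
  have -> : \det A * z j = \sum_l (\adj A *m A) j l * z l.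
    rewrite mul_adj_mx (bigD1 j) //= mxE eqxx mulr1n big1 ?addr0 // => l.
    by rewrite eq_sym => jl; rewrite mxE (negbTE jl) mulr0n mul0r.
  under eq_bigr do rewrite mxE mulr_suml.
  rewrite exchange_big big1 // => l _ /=; under eq_bigr do rewrite -mulrA.
  by rewrite -mulr_sumr Az mulr0.
move=> w; rewrite Dz => -[a ->]; rewrite mulr_sumr big1 // => j _.
by rewrite mulrCA detz mulr0.
Qed.

End Krull.

(** * Vanishing of [Q] in the local ring at [P] *)

Section LocalDomain.
Variables (K : fieldType) (R : comAlgType K).
Hypotheses (charK : [pchar K] =i pred0) (noe : noeth R).
Variables (P Q : set R) (F : fieldType) (i : {rmorphism R -> F}) (e l : nat).
Variables (x : 'I_e -> R) (z : 'I_(e + l) -> R) (h : R) (dd : 'I_(e + l) -> R -> F).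
Hypotheses (prP : prime_set P) (lc : local_chart P Q i x z h dd).

Lemma prime_mulrn a n : P (a *+ n.+1) -> P a.
Proof.
have [[_ _ PM] _ _] := prP; move/pcharf0P: charK => ch; rewrite -scaler_nat => Pa.
by rewrite -(scale1r a) -(@mulVf _ n.+1%:R) ?ch // -scalerA -mulr_algl; apply: PM.
Qed.

(** Independence of leading forms in a regular local ring. The operator [h d/dx_j] sends [Q] to zero
    in [F], lowers the order by one and multiplies a leading coefficient by [h] and an exponent,
    neither of which lies in [P]. *)
Lemma coef_in_prime m (p : mpoly e R) : mord m p -> Q (meval x p) ->
  forall a, mdeg a = m -> P (mcoeff a p).
Proof.
have [idP P1 Ppr] := prP; have [P0 PD PM] := idP.
elim: m p => [|m IH] p mp Qp a am.
  have -> : a = mnm0 by apply/eqP; rewrite -mdeg_eq0 am.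
  have -> : mcoeff mnm0 p = meval x p - meval x (p - mpolyC e (mcoeff mnm0 p)).
    by rewrite mevalB mevalC opprB addrC subrK.
  apply: ideal_setB => //; first exact: (chart_sub lc).
  apply: mord1_ideal => //; first exact: (chart_mem lc).
  move=> b; rewrite ltnS leqn0 mdeg_eq0 => /eqP->.
  by rewrite mcoeffB mcoeffC eqxx mulr1 subrr.
have [j aj] : exists j, a j != 0%N.
  apply: contrapT => no; have : mdeg a == 0%N.
    rewrite mdeg_eq0; apply/eqP/mnmP => j; rewrite mnm0E.
    by apply/eqP/negPn/negP => aj; apply: no; exists j.
  by rewrite am.
have [th thP] := choice (chart_integral lc (lshift l j)).
(* At [x] this represents [h] times the derivative of [meval x p]. The second sum, from
   differentiating coefficients, uses only monomials of [p], so it has order [m + 1] and leaves the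
   coefficients of degree [m] alone. *)
pose p2 := h *: mderiv j p + \sum_(b <- msupp p) th (mcoeff b p) *: mpolyX R b.
have mp2 : mord m p2.
  apply: mordD; first by apply: mordZ; apply: mord_deriv.
  apply: mord_sum => b bp; apply: mordZ; apply: mordX.
  by apply: ltnW; apply: mord_msupp bp.
have Qp2 : Q (meval x p2).
  apply/(chart_ker lc); rewrite mevalD mevalZ rmorphD rmorphM.
  have -> : i (meval x (\sum_(b <- msupp p) th (mcoeff b p) *: mpolyX R b)) =
      i h * \sum_(b <- msupp p) i (meval x (mpolyX R b)) * dd (lshift l j) (mcoeff b p).
    have -> : meval x (\sum_(b <- msupp p) th (mcoeff b p) *: mpolyX R b) =
        \sum_(b <- msupp p) th (mcoeff b p) * meval x (mpolyX R b).
      by rewrite raddf_sum; apply: eq_bigr => b _ /=; rewrite mevalZ.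
    rewrite rmorph_sum mulr_sumr; apply: eq_bigr => b _ /=.
    by rewrite rmorphM thP -mulrA [dd _ _ * _]mulrC.
  rewrite -mulrDr.
  have ddx b : dd (lshift l j) (x b) = (j == b)%:R * 1.
    by rewrite -(chart_coord lc) (chart_dual lc) mulr1 (inj_eq (@lshift_inj _ _)).
  have := der_meval p (chart_der lc (lshift l j)) ddx.
  by rewrite mulr1 => <-; rewrite (chart_kills lc) // mulr0.
have := IH _ mp2 Qp2 (mnm_sub a (mnm1 j)).
have aE : mnm_add (mnm_sub a (mnm1 j)) (mnm1 j) = a.
  by apply/mnmP => b; rewrite mnmDE mnmBE mnm1E; case: eqP => [<-|_]; rewrite ?subn0 ?addn0 // subnK // lt0n.
have dm : mdeg (mnm_sub a (mnm1 j)) = m.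
  by apply/eqP; rewrite -eqSS -am -[in X in _ == X]aE mdegD mdeg1 addn1.
move=> /(_ dm); rewrite mcoeffD mcoeffZ mcoeff_deriv aE mcoeff_msupp_sum.
rewrite mcoeff_msupp mp ?dm // eqxx /= addr0 => /Ppr[|]; first by move/(chart_den lc).
exact: prime_mulrn.
Qed.

Lemma common_multiplier (p : mpoly e R) (r : seq (multinom e)) :
  (forall a, a \in r -> P (mcoeff a p)) ->
  exists2 s, ~ P s & forall a, a \in r -> exists b : 'I_e -> R,
    s * mcoeff a p = \sum_(j < e) b j * x j.
Proof.
have [_ P1 Ppr] := prP.
elim: r => [|a r IH] Pr; first by exists 1.
have [|s nPs sr] := IH; first by move=> b br; apply: Pr; rewrite inE br orbT.
have [|t [b [nPt tb]]] := chart_gen lc (a := mcoeff a p); first by apply: Pr; rewrite inE eqxx.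
exists (s * t) => [/Ppr[]//|c]; rewrite inE => /orP[/eqP->|/sr[d sd]].
  exists (fun j => s * b j); rewrite -mulrA tb mulr_sumr.
  by apply: eq_bigr => j _; rewrite mulrA.
exists (fun j => t * d j); rewrite [s * t]mulrC -mulrA sd mulr_sumr.
by apply: eq_bigr => j _; rewrite mulrA.
Qed.

(** The leading coefficients of a representation of [q] lie in [P]; after multiplication by some [t]
    outside [P] they become combinations of the [x j], and the order rises by one. *)
Lemma kernel_deep q : Q q -> deep P x q.
Proof.
have [idP P1 Ppr] := prP; have [_ _ QM] := (let: And3 idQ _ _ := chart_prime lc in idQ).
move=> Qq; elim=> [|m [s [p [nPs mp sq]]]].
  by exists 1, (mpolyC e q); rewrite mul1r mevalC.
have Qp : Q (meval x p) by rewrite -sq; apply: QM.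
have [|t nPt tp] := @common_multiplier p [seq a <- msupp p | mdeg a == m].
  by move=> a; rewrite mem_filter => /andP[/eqP am _]; apply: coef_in_prime am.
have exb a : exists b : 'I_e -> R, a \in [seq a <- msupp p | mdeg a == m] ->
    t * mcoeff a p = \sum_(j < e) b j * x j.
  by case: (boolP (a \in _)) => [/tp[b tb]|_]; [exists b|exists (fun=> 0)].
have [b bP] := choice exb.
exists (t * s), (\sum_(a <- msupp p) if mdeg a == m then
    \sum_j b a j *: mpolyX R (mnm_add a (mnm1 j)) else (t * mcoeff a p) *: mpolyX R a); split.
- by case/Ppr.
- apply: mord_sum => a ap; have := mord_msupp mp ap; case: eqP => [am _|/eqP am ma].
    by apply: mord_sum => j _; apply: mordZ; apply: mordX; rewrite mdegD mdeg1 addn1 am.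
  by apply: mordZ; apply: mordX; rewrite ltn_neqAle eq_sym am.
- rewrite -mulrA sq {1}[p]mpolyE !raddf_sum /= mulr_sumr big_seq [RHS]big_seq.
  apply: eq_bigr => a ap; case: eqP => [am|_]; last by rewrite !mevalZ mulrA.
  rewrite raddf_sum /= mevalZ mulrA bP ?mem_filter ?am ?eqxx // mulr_suml.
  apply: eq_bigr => j _; rewrite mevalZ -mulrA; congr (_ * _).
  by rewrite mpolyXD mevalM mevalXU mulrC.
Qed.

Lemma kernel_killed : exists2 s, ~ P s & forall q, Q q -> s * q = 0.
Proof.
have [s nPs sD] := deep_killed noe prP (chart_mem lc).
by exists s => // q /kernel_deep; apply: sD.
Qed.

End LocalDomain.
(** * Graded components *)

Section Components.
Variables (K : fieldType) (R : comAlgType K) (G : nat -> {pred R}).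
Hypothesis gG : is_grading G.

Lemma piece0 i : 0 \in G i. Proof. by case: (grading_submod gG i). Qed.
Lemma pieceP i k x y : x \in G i -> y \in G i -> k *: x + y \in G i.
Proof. by case: (grading_submod gG i) => _; apply. Qed.
Lemma pieceZ i k x : x \in G i -> k *: x \in G i.
Proof. by move=> xG; rewrite -[k *: x]addr0; apply: pieceP => //; exact: piece0. Qed.
Lemma sum_support (c : nat -> R) n m : (n <= m)%N -> (forall i, (n <= i)%N -> c i = 0) ->
  \sum_(i < m) c i = \sum_(i < n) c i.
Proof.
move=> nm c0; rewrite -!(big_mkord xpredT c) (big_cat_nat (leq0n n) nm) /=.
rewrite [X in _ + X]big_nat_cond [X in _ + X]big1 ?addr0 // => i.
by move=> /andP[/andP[ni _] _]; rewrite c0.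
Qed.

Lemma exists_components x : exists cn : (nat -> R) * nat,
  [/\ forall i, cn.1 i \in G i, forall i, (cn.2 <= i)%N -> cn.1 i = 0
    & x = \sum_(i < cn.2) cn.1 i].
Proof.
have [n [c [cG xc]]] := grading_sum gG x.
exists (fun i => if (i < n)%N then c i else 0, n); split => /=.
- by move=> i; case: ifP => // _; exact: piece0.
- by move=> i; rewrite ltnNge => ->.
- by rewrite xc; apply: eq_bigr => i _; rewrite ltn_ord.
Qed.

Definition cmp x := (sval (cid (exists_components x))).1.
Definition dgr x := (sval (cid (exists_components x))).2.

Lemma cmpG x i : cmp x i \in G i.
Proof. by rewrite /cmp; case: cid => /= cn []. Qed.
Lemma cmp_ge x i : (dgr x <= i)%N -> cmp x i = 0.
Proof. by rewrite /cmp /dgr; case: cid => /= cn [_ + _]; apply. Qed.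
Lemma cmp_sum x m : (dgr x <= m)%N -> x = \sum_(i < m) cmp x i.
Proof.
move=> xm; rewrite (sum_support xm); last exact: cmp_ge.
by rewrite /cmp /dgr; case: cid => /= cn [].
Qed.

Lemma cmp_unique x c n : (forall i, c i \in G i) -> (forall i, (n <= i)%N -> c i = 0) ->
  x = \sum_(i < n) c i -> forall i, cmp x i = c i.
Proof.
move=> cG c0 xc i; pose m := maxn i.+1 (maxn n (dgr x)).
have [nm xm im] : [/\ n <= m, dgr x <= m & i < m]%N.
  by rewrite /m !leq_max !leqnn !orbT.
apply/eqP; rewrite -subr_eq0; apply/eqP; rewrite -scaleN1r addrC.
apply: (grading_direct gG (c := fun j => -1 *: c j + cmp x j) (n := m)) => //.
  by move=> j; apply: pieceP => //; exact: cmpG.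
rewrite big_split /= -(cmp_sum xm) -scaler_sumr (sum_support nm c0) -xc.
by rewrite scaleN1r addNr.
Qed.

Lemma cmpP k x y i : cmp (k *: x + y) i = k *: cmp x i + cmp y i.
Proof.
pose n := maxn (dgr x) (dgr y).
apply: (@cmp_unique _ (fun i => k *: cmp x i + cmp y i) n) => [j|j|]; first by apply: pieceP; exact: cmpG.
  by rewrite geq_max => /andP[xj yj]; rewrite !cmp_ge // scaler0 addr0.
by rewrite big_split /= -scaler_sumr -!cmp_sum // leq_max leqnn ?orbT.
Qed.

Lemma cmpD x y i : cmp (x + y) i = cmp x i + cmp y i.
Proof. by rewrite -[x]scale1r cmpP !scale1r. Qed.

Lemma cmp_homog j x i : x \in G j -> cmp x i = if i == j then x else 0.
Proof.
move=> xG; apply: (@cmp_unique _ (fun i => if i == j then x else 0) j.+1) => [k|k|].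
- by case: eqP => [->//|_]; exact: piece0.
- by rewrite ltn_neqAle eq_sym => /andP[/negbTE->].
- rewrite (bigD1 ord_max) //= eqxx big1 ?addr0 // => k.
  by rewrite -val_eqE /= => /negbTE->.
Qed.

Lemma cmp0 i : cmp 0 i = 0.
Proof. by rewrite (cmp_homog i (piece0 0)) if_same. Qed.

Lemma cmpsum (T : Type) (r : seq T) (f : T -> R) i :
  cmp (\sum_(j <- r) f j) i = \sum_(j <- r) cmp (f j) i.
Proof. by elim: r => [|j r IH]; rewrite ?big_nil ?cmp0 // !big_cons cmpD IH. Qed.

Lemma cmp_mul_homog j x y i : x \in G j ->
  cmp (x * y) i = if (j <= i)%N then x * cmp y (i - j) else 0.
Proof.
move=> xG.
rewrite {1}(cmp_sum (leqnn (dgr y))) mulr_sumr cmpsum.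
have -> : \sum_(k < dgr y) cmp (x * cmp y k) i =
    \sum_(k < dgr y) if i == (j + k)%N then x * cmp y k else 0.
  by apply: eq_bigr => k _; apply: cmp_homog; apply: gradingM (cmpG y k).
case: leqP => [ji|ij]; last first.
  by rewrite big1 // => k _; case: ifP => // /eqP ie; move: ij; rewrite ie ltnNge leq_addr.
case: (ltnP (i - j) (dgr y)) => [lt|le]; last first.
  rewrite cmp_ge // mulr0 big1 // => k _; case: ifP => // /eqP ie; move: le.
  by rewrite ie addKn leqNgt ltn_ord.
rewrite (bigD1 (Ordinal lt)) //= subnKC // eqxx big1 ?addr0 // => k.
by rewrite -val_eqE /= => kij; case: ifP => // /eqP ie; move: kij; rewrite ie addKn eqxx.
Qed.

(** The component [a] of degree zero is a scalar with [a * a = a]. If all components of degree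
    strictly between [0] and [i] vanish, the one of degree [i] equals [2 a] times itself, and is
    zero for [a = 0] as well as [a = 1]. *)
Lemma graded_idempotent (x : R) : (forall y : R, y \in G 0%N -> exists k : K, y = k%:A) ->
  x * x = x -> x = 0 \/ x = 1.
Proof.
move=> G0 xx; have [a xa] := G0 _ (cmpG x 0).
have cx i : cmp x i = \sum_(j < dgr x) if (j <= i)%N then cmp x j * cmp x (i - j) else 0.
  rewrite -[in LHS]xx {1}(cmp_sum (leqnn (dgr x))) mulr_suml cmpsum.
  by apply: eq_bigr => j _; apply: cmp_mul_homog; exact: cmpG.
have cx' i : cmp x i = \sum_(j < i.+1) cmp x j * cmp x (i - j).
  rewrite cx; pose c j := if (j <= i)%N then cmp x j * cmp x (i - j) else 0.
  rewrite -(@sum_support c _ (maxn i.+1 (dgr x))) ?leq_maxr //; last first.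
    by move=> j jx; rewrite /c; case: ifP => // _; rewrite cmp_ge // mul0r.
  rewrite (@sum_support c i.+1) ?leq_maxl //; last first.
    by move=> j ij; rewrite /c leqNgt ij.
  by apply: eq_bigr => j _; rewrite /c -ltnS ltn_ord.
have a01 : a = 0 \/ a = 1.
  have := cx' 0%N; rewrite big_ord1 subn0 xa -scalerAl mul1r scalerA => e.
  have : (a * (a - 1)) *: (1 : R) = 0.
    by rewrite mulrBr mulr1 scalerBl -e subrr.
  move/eqP; case: (eqVneq (a * (a - 1)) 0) => [/eqP|n0].
    by rewrite mulf_eq0 => /orP[/eqP|/eqP a1 _]; [left|right; apply/eqP; rewrite -subr_eq0 a1].
  move=> /eqP e0; have := oner_neq0 R.
  by rewrite -(scale1r 1) -(mulVf n0) -scalerA e0 scaler0 eqxx.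
have x0 i : (0 < i)%N -> cmp x i = 0.
  have [n] := ubnP i; elim: n i => // n IH [|i] //; rewrite ltnS => le_in _.
  have := cx' i.+1; rewrite (bigD1 ord0) //= (bigD1 ord_max) //= subn0 subnn.
  rewrite big1 ?addr0; last first.
    move=> j; rewrite -!val_eqE /= -lt0n => /andP[j0 ji].
    have lt_ji : (j < i.+1)%N by rewrite ltn_neqAle ji -ltnS ltn_ord.
    by rewrite (IH j) ?mul0r // (leq_trans lt_ji).
  rewrite [cmp x i.+1 * _]mulrC xa -scalerAl mul1r.
  case: a01 => ->; rewrite ?scale0r ?addr0 // scale1r => /eqP.
  by rewrite -subr_eq0 opprD addNKr oppr_eq0 => /eqP.
have : x = a%:A.
  rewrite (cmp_sum (leqnSn (dgr x))) big_ord_recl xa big1 ?addr0 // => j _.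
  by rewrite x0.
by case: a01 => ->; rewrite ?scale0r ?scale1r; [left|right].
Qed.

End Components.

(** * Two-sided generation in filtered algebras *)

Section TwoSided.
Variables (K : fieldType) (D : algType K) (B : nat -> set D).

Record alg_filtration : Prop := AlgFiltration {
  filt_scalar : forall k : K, B 0%N k%:A;
  filtD : forall n u v, B n u -> B n v -> B n (u + v);
  filtM : forall m n u v, B m u -> B n v -> B (m + n)%N (u * v);
  filt_leq : forall m n, (m <= n)%N -> B m `<=` B n;
  filt_exhaustive : forall u, exists n, B n u
}.

Hypothesis fB : alg_filtration.

(* [sand n u] is the span of the products [a * u * b] with [a], [b] in [B n]. *)
Definition sand n (u : D) : set D := [set v | exists s : seq (D * D),
  (forall ab, ab \in s -> B n ab.1 /\ B n ab.2) /\ v = \sum_(ab <- s) ab.1 * u * ab.2].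

Lemma sand_mono m n u : (m <= n)%N -> sand m u `<=` sand n u.
Proof.
move=> mn v [s [sB ->]]; exists s; split=> // ab /sB[a b].
by split; apply: (filt_leq fB mn).
Qed.

Lemma sandD n u v w : sand n u v -> sand n u w -> sand n u (v + w).
Proof.
move=> [s [sB ->]] [t [tB ->]]; exists (s ++ t); split; last by rewrite big_cat.
by move=> ab; rewrite mem_cat => /orP[/sB|/tB].
Qed.

Lemma sand0 n u : sand n u 0.
Proof. by exists [::]; rewrite big_nil. Qed.

Lemma sand_sum n u (T : eqType) (r : seq T) (f : T -> D) :
  (forall j, j \in r -> sand n u (f j)) -> sand n u (\sum_(j <- r) f j).
Proof.
by move=> uf; rewrite big_seq; elim/big_ind: _ => //; [exact: sand0|exact: sandD].
Qed.

Lemma sandMl m n a u v : B m a -> sand n u v -> sand (m + n) u (a * v).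
Proof.
move=> Ba [s [sB ->]]; exists [seq (a * xy.1, xy.2) | xy <- s]; split.
  move=> _ /mapP[xy /sB[x y] ->]; split; first exact: filtM.
  by apply: (filt_leq fB (leq_addl m n)).
by rewrite big_map mulr_sumr; apply: eq_bigr => xy _; rewrite !mulrA.
Qed.

Lemma sandMr m n a u v : B m a -> sand n u v -> sand (m + n) u (v * a).
Proof.
move=> Ba [s [sB ->]]; exists [seq (xy.1, xy.2 * a) | xy <- s]; split.
  move=> _ /mapP[xy /sB[x y] ->]; split; first by apply: (filt_leq fB (leq_addl m n)).
  by rewrite addnC; apply: filtM.
by rewrite big_map mulr_suml; apply: eq_bigr => xy _; rewrite !mulrA.
Qed.

Lemma sandZ n k u v : sand n u v -> sand n u (k *: v).
Proof. by rewrite -mulr_algl => /(sandMl (filt_scalar fB k)). Qed.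

Lemma sandN n u v : sand n u v -> sand n u (- v).
Proof. by rewrite -scaleN1r; exact: sandZ. Qed.

Lemma sandB n u v w : sand n u v -> sand n u w -> sand n u (v - w).
Proof. by move=> uv uw; apply: sandD => //; apply: sandN. Qed.

Lemma sand_refl u : sand 0 u u.
Proof.
exists [:: (1, 1)]; rewrite big_seq1 mul1r mulr1; split=> // ab.
by rewrite inE => /eqP->; rewrite -(scale1r 1); split; exact: (filt_scalar fB).
Qed.

(** Levels add when reductions are composed, so linearly many steps of bounded level stay within a
    linear level. *)
Lemma sand_trans m n u v w : sand m u v -> sand n v w -> sand (m + n) u w.
Proof.
move=> uv [s [sB ->]]; apply: sand_sum => ab /sB[a b].
have [t [tB ->]] := uv; rewrite mulr_sumr mulr_suml; apply: sand_sum => xy /tB[x y].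
exists [:: (ab.1 * xy.1, xy.2 * ab.2)]; split; last by rewrite big_seq1 !mulrA.
by move=> cd; rewrite inE => /eqP-> /=; split; [rewrite addnC|]; apply: filtM.
Qed.

Lemma filt_nat n : B 0%N n%:R.
Proof. by rewrite -scaler_nat; exact: (filt_scalar fB). Qed.

Lemma filt0 n : B n 0.
Proof.
by apply: (filt_leq fB (leq0n n)); rewrite -(scale0r 1); exact: (filt_scalar fB).
Qed.

Lemma filtX m n u : B m u -> B (m * n)%N (u ^+ n).
Proof.
move=> Bu; elim: n => [|n IH]; last by rewrite exprS mulnS; apply: filtM.
by rewrite muln0 expr0 -(scale1r 1); exact: (filt_scalar fB).
Qed.

Lemma filt_common (s : seq D) : exists n, forall u, u \in s -> B n u.
Proof.
elim: s => [|u s [n sB]]; first by exists 0%N.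
have [m um] := filt_exhaustive fB u; exists (maxn m n) => v; rewrite inE.
move=> /orP[/eqP->|/sB]; first by apply: (filt_leq fB) um; exact: leq_maxl.
by apply: (filt_leq fB); exact: leq_maxr.
Qed.

Lemma filt_horner n (p : {poly D}) m : (forall u, u \in (p : seq D) -> B n u) -> B n p.[m%:R].
Proof.
move=> pB; rewrite horner_coef; elim/big_ind: _ => [||j _]; [exact: filt0|exact: filtD|].
rewrite -[n]addn0 -natrX; apply: (filtM fB) (filt_nat _).
by apply: pB; apply: mem_nth.
Qed.

End TwoSided.

(** * Descent from powers of [f] to [1] *)

Section SandwichPowers.
Variables (K : fieldType) (R : comAlgType K) (f : R) (B : nat -> set (diffop R)).
Hypothesis fB : alg_filtration B.
Hypothesis sbs : forall n : nat, ~~ root (SBS f) n%:R.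

(** Evaluated at [n], the operators of the sandwich equation are scalar combinations of finitely
    many fixed coefficients, so one [C] bounds their level for all [n]. The value of [SBS f] at [n]
    is nonzero and can be divided out. *)
Lemma sandwich_powers : exists C, forall n, sand B (C * n) (mulop (f ^+ n)) 1.
Proof.
have [s sP] : sandwich_bs f (SBS f) by apply/(SBSP f).2.
have [C CP] := filt_common fB (flatten [seq polyseq ab.1 ++ polyseq ab.2 | ab <- s]).
have step n : sand B C (mulop (f ^+ n.+1)) (mulop (f ^+ n)).
  have bn : (SBS f).[n%:R] != 0 by exact: sbs.
  rewrite -[mulop (f ^+ n)]scale1r -(mulVf bn) -scalerA -sP; apply: sandZ => //.
  exists [seq (ab.1.[n%:R], ab.2.[n%:R]) | ab <- s]; split; last by rewrite big_map.
  move=> _ /mapP[ab abs ->] /=.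
  have inC u : u \in polyseq ab.1 ++ polyseq ab.2 -> B C u.
    by move=> uab; apply: CP; apply/flattenP; eexists; [apply: map_f abs|exact: uab].
  by split; apply: filt_horner => // u us; apply: inC; rewrite mem_cat us ?orbT.
exists C; elim=> [|n IH]; first by rewrite muln0 expr0; exact: sand_refl.
by rewrite mulnS; apply: sand_trans (step n) IH.
Qed.

End SandwichPowers.

(** * The ring is a domain *)

Section Domain.
Variables (K : fieldType) (R : comAlgType K).

(** The commutator of [d] with [a] sends [b * r] to [- a * d (b * r)]. Induction on the order then
    shows that [a ^+ n.+1] kills [d (b * r)], and reducedness lowers the exponent to one. *)
Lemma diffop_reduced n (d : R -> R) (a b : R) : (forall x : R, forall k, x ^+ k = 0 -> x = 0) ->
  a * b = 0 -> diffop_le n d -> forall r, a * d (b * r) = 0.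
Proof.
move=> red ab dn r; suff e : a ^+ n.+1 * d (b * r) = 0.
  by apply: (red _ n.+1); rewrite exprMn [d _ ^+ _]exprS mulrA e mul0r.
elim: n d dn => [|n IH] d /=.
  by move=> [c dc]; rewrite dc expr1 mulrCA [a * _]mulrA ab mul0r mulr0.
move=> [ld /(_ a)/IH]; rewrite mulrA ab mul0r => e.
have d0 : d 0 = 0.
  by have := ld (-1) 0 0; rewrite scaler0 addr0 scaleN1r addNr.
by move: e; rewrite d0 sub0r mulrN mulrA -exprSr => /eqP; rewrite oppr_eq0 => /eqP.
Qed.

Variables (G : nat -> {pred R}) (f : R).
Hypotheses (charK : [pchar K] =i pred0) (fgR : finitely_generated R) (gG : is_grading G).
Hypothesis G0 : forall y : R, y \in G 0%N -> exists k : K, y = k%:A.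
Hypotheses (regf : GRing.lreg f) (sing : in_singular_locus f).
Hypothesis sbs : forall n : nat, ~~ root (SBS f) n%:R.

Lemma expf_neq0 k : f ^+ k <> 0.
Proof.
elim: k => [|k IH]; first by apply/eqP; rewrite expr0 oner_eq0.
by rewrite exprS -(mulr0 f) => /regf.
Qed.

Lemma expf_reg k x : f ^+ k * x = 0 -> x = 0.
Proof.
elim: k => [|k IH]; first by rewrite expr0 mul1r.
by rewrite exprS -mulrA => e; apply: IH; apply: regf; rewrite e mulr0.
Qed.

Lemma chart_data P : prime_set P -> ~ P f -> exists Q s,
  [/\ prime_set Q, Q `<=` P, ~ P s & forall q, Q q -> s * q = 0].
Proof.
move=> prP nPf; have [Q [F [i [e [l [x [z [h [dd lc]]]]]]]]] := exists_local_chart charK fgR sing prP nPf.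
have [s nPs sQ] := kernel_killed charK (fg_noeth fgR) prP lc.
by exists Q, s; split=> //; [exact: chart_prime lc|exact: chart_sub lc].
Qed.

Lemma avoid_or (I : set R) : ideal_set I ->
  (forall P, prime_set P -> I `<=` P -> ~ P f -> False) -> exists k, I (f ^+ k).
Proof.
move=> idI noP; apply: contrapT => /forallNP nI.
by have [P [prP IP nPf]] := exists_prime_avoiding idI nI; apply: noP nPf.
Qed.

(** If no power of [f] killed [x], some prime [P] missing [f] would contain the annihilator of [x].
    The chart at [P] provides a prime [Q], which contains the nilpotent [x], and some [s] outside
    [P] that kills [Q]. *)
Lemma sing_reduced (x : R) k : x ^+ k = 0 -> x = 0.
Proof.
move=> xk; have [|P prP IP nPf|m] := @avoid_or [set a | a * x = 0].
- have id0 : ideal_set [set 0 : R].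
    by split=> [//|a b -> ->|a b ->]; rewrite /= ?addr0 ?mulr0.
  exact: ideal_set_colon x id0.
- have [Q [s [[idQ Q1 prQ] QP nPs sQ]]] := chart_data prP nPf.
  apply: nPs; apply: IP; rewrite /=; apply: sQ.
  elim: k xk => [|k IH]; first by rewrite expr0 => e; case: Q1; rewrite e; case: idQ.
  rewrite exprS => e; have : Q (x * x ^+ k) by rewrite e; case: idQ.
  case/prQ => // Qk; elim: k {IH e} Qk => [//|k IH].
  by rewrite exprS => /prQ[|/IH].
- exact: expf_reg.
Qed.

Lemma sing_domain (x y : R) : x * y = 0 -> x = 0 \/ y = 0.
Proof.
have id0 : ideal_set [set 0 : R].
  by split=> [//|a b -> ->|a b ->]; rewrite /= ?addr0 ?mulr0.
have [P0 [prP0 _ nP0f]] := exists_prime_avoiding id0 expf_neq0.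
have [Q0 [s0 [prQ0 QP0 nPs0 sQ0]]] := chart_data prP0 nP0f.
have [idQ0 Q01 prpQ0] := prQ0.
pose An : set R := [set a | forall q, Q0 q -> a * q = 0].
have idAn : ideal_set An.
  split=> [q _|a b aA bA q Qq|a b bA q Qq] /=; first by rewrite mul0r.
    by rewrite mulrDl aA ?bA ?addr0.
  by rewrite -mulrA bA ?mulr0.
(* A prime [P] missing [f] above [Q0] and its annihilator would have a chart whose [Q] equals [Q0];
   the [s] outside [P] killing [Q] would then annihilate [Q0] and lie in [P]. *)
have [P prP IP nPf|k [q [q' [Qq Aq' fk]]]] := avoid_or (ideal_set_add idQ0 idAn).
  have [Q [s [prQ QP nPs sQ]]] := chart_data prP nPf; have [idQ _ prpQ] := prQ.
  have Q0P : Q0 `<=` P.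
    by move=> a Qa; apply: IP; exists a, 0; rewrite addr0; split=> //; case: idAn.
  have QQ0 : Q `<=` Q0.
    move=> a /sQ sa; have : Q0 (s * a) by rewrite sa; case: idQ0.
    by case/prpQ0 => // /Q0P.
  have Q0Q : Q0 `<=` Q.
    move=> a /sQ0 sa; have : Q (s0 * a) by rewrite sa; case: idQ.
    by case/prpQ => // /QQ0/QP0.
  by apply: nPs; apply: IP; exists 0, s; rewrite add0r; split=> // [|a /Q0Q/sQ//]; case: idQ0.
have qq' : q * q' = 0 by rewrite mulrC; apply: Aq'.
have q'q : q' * q = 0 by apply: Aq'.
have kill a b (u : diffop R) : a * b = 0 -> mulop a * u * mulop b = 0.
  move=> ab; apply: diffop_eq => r; have [n un] := diffopP u.
  exact: (diffop_reduced sing_reduced ab un).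
(* With the constant filtration, [sandwich_powers] says that [f ^+ k] generates [D] as a two-sided
   ideal. *)
have triv : alg_filtration (fun _ : nat => [set: diffop R]) by split=> // u; exists 0%N.
have [C CP] := sandwich_powers triv sbs.
have [s [_ one]] := CP k; rewrite fk in one.
(* [f ^+ k = q + q'] splits [1] as [eps + eps'] with [eps D eps' = eps' D eps = 0], which makes
   [eps] a central idempotent. Commuting with [mulop r], it is the multiplication by its value at
   [1]. *)
pose eps := \sum_(ab <- s) ab.1 * mulop q * ab.2.
pose eps' := \sum_(ab <- s) ab.1 * mulop q' * ab.2.
have eps1 : eps + eps' = 1.
  rewrite one /eps /eps' -big_split; apply: eq_bigr => ab _.
  have -> : mulop (q + q') = mulop q + mulop q' by apply: diffop_eq => r /=; rewrite mulrDl.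
  by rewrite mulrDr mulrDl.
have ee' u : eps * u * eps' = 0.
  rewrite /eps /eps' !mulr_suml big1 // => ab _; rewrite mulr_sumr big1 // => cd _.
  have -> : ab.1 * mulop q * ab.2 * u * (cd.1 * mulop q' * cd.2) =
      ab.1 * (mulop q * (ab.2 * u * cd.1) * mulop q') * cd.2 by rewrite !mulrA.
  by rewrite kill // mulr0 mul0r.
have e'e u : eps' * u * eps = 0.
  rewrite /eps /eps' !mulr_suml big1 // => ab _; rewrite mulr_sumr big1 // => cd _.
  have -> : ab.1 * mulop q' * ab.2 * u * (cd.1 * mulop q * cd.2) =
      ab.1 * (mulop q' * (ab.2 * u * cd.1) * mulop q) * cd.2 by rewrite !mulrA.
  by rewrite kill // mulr0 mul0r.
have central u : eps * u = u * eps.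
  transitivity (eps * u * eps).
    by rewrite -[LHS]mulr1 -eps1 mulrDr ee' addr0.
  by rewrite -[RHS]mul1r -eps1 mulrDl !mulrA e'e addr0.
have epsM r : (eps : R -> R) r = r * (eps : R -> R) 1.
  have := congr1 (fun u : diffop R => u 1) (central (mulop r)).
  by rewrite /= mulr1.
have idem : (eps : R -> R) 1 * (eps : R -> R) 1 = (eps : R -> R) 1.
  have : eps * eps = eps.
    have e0 : eps * eps' = 0 by have := ee' 1; rewrite mulr1.
    by rewrite -[RHS]mulr1 -eps1 mulrDr e0 addr0.
  by move/(congr1 (fun u : diffop R => u 1)) => /=; rewrite epsM.
have epsE u : (eps : R -> R) 1 = u -> eps = mulop u.
  by move=> <-; apply: diffop_eq => r; rewrite epsM /= mulrC.
(* If [eps = 0] then [q = 0], the nonzerodivisor [f ^+ k] kills [Q0], and the zero ideal is prime.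
   If [eps = 1] then [q' = 0] and [f ^+ k] lies in [Q0], inside [P0], which is excluded. *)
have [/epsE e0|/epsE e1] := graded_idempotent gG G0 idem.
  have eps0 : eps = 0 by rewrite e0; apply: diffop_eq => r /=; rewrite mul0r.
  have q0 : mulop q = 0.
    rewrite -[mulop q]mul1r -eps1 eps0 add0r /eps' mulr_suml big1 // => ab _.
    by rewrite -!mulrA [mulop q' * _]mulrA kill ?mulr0.
  have {}q0 : q = 0 by have := congr1 (fun u : diffop R => u 1) q0; rewrite /= mulr1.
  have Q0E a : Q0 a -> a = 0.
    by move=> /Aq'; have := fk; rewrite q0 add0r => <-; exact: expf_reg.
  move=> xy; have : Q0 (x * y) by rewrite xy; case: idQ0.
  by case/prpQ0 => /Q0E; [left|right].
have eps'0 : eps' = 0.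
  have : eps = 1 by rewrite e1.
  by move=> ee; move: eps1; rewrite ee => /(congr1 (fun u => u - 1)); rewrite addrAC subrr add0r.
have q0 : mulop q' = 0.
  rewrite -[mulop q']mul1r -eps1 eps'0 addr0 /eps mulr_suml big1 // => ab _.
  by rewrite -!mulrA [mulop q * _]mulrA kill ?mulr0.
have {}q0 : q' = 0 by have := congr1 (fun u : diffop R => u 1) q0; rewrite /= mulr1.
case: nP0f; rewrite q0 addr0 in fk; rewrite -fk in Qq.
elim: k Qq {CP one fk} => [|k IH]; first by rewrite expr0.
by rewrite exprS => /prpQ0[/QP0|/IH].
Qed.

End Domain.
(** * Coordinates on the domain *)

Section Charts.
Variables (K : fieldType) (R : comAlgType K).

Definition kpoly d (z : 'I_d -> R) (p : mpoly d K) : R := meval z (map_mpoly (in_alg R) p).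

Record chart d (z : 'I_d -> R) (h : R) (th : 'I_d -> R -> R) : Prop := {
  chart_neq0 : h <> 0;
  chart_is_der : forall j, @is_der K R R idfun (th j);
  chart_eq : forall a b, th a (z b) = (a == b)%:R * h;
  chart_alg : forall g, g <> 0 -> exists g' p, p <> 0 /\ kpoly z p = g * g';
  chart_dim : forall n, prime_chain R n -> (n <= d)%N
}.

Lemma mcoeff_kmap d (p : mpoly d K) a :
  mcoeff a (map_mpoly (in_alg R) p) = (mcoeff a p)%:A.
Proof. exact: mcoeff_map_mpoly. Qed.

Lemma kpolyB d (z : 'I_d -> R) p q : kpoly z (p - q) = kpoly z p - kpoly z q.
Proof. by rewrite /kpoly raddfB mevalB. Qed.
Lemma kpolyM d (z : 'I_d -> R) p q : kpoly z (p * q) = kpoly z p * kpoly z q.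
Proof. by rewrite /kpoly rmorphM mevalM. Qed.
Lemma kpolyC d (z : 'I_d -> R) c : kpoly z (mpolyC d c) = c%:A.
Proof. by rewrite /kpoly map_mpolyC mevalC. Qed.
Lemma kpolyX d (z : 'I_d -> R) j : kpoly z (mpolyX K (mnm1 j)) = z j.
Proof. by rewrite /kpoly map_mpolyX mevalXU. Qed.
Lemma kpoly0 d (z : 'I_d -> R) : kpoly z 0 = 0.
Proof. by rewrite /kpoly !raddf0. Qed.

Lemma kpoly_adjs d (z : 'I_d -> R) a : adjs (@scalars K R) (codom z) a ->
  exists p, a = kpoly z p.
Proof.
move: a; apply: (@adjs_sub _ _ [set a | exists p, a = kpoly z p]).
- split; first by exists (mpolyC d 1); rewrite kpolyC scale1r.
    by move=> _ _ [p ->] [q ->]; exists (p - q); rewrite kpolyB.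
  by move=> _ _ [p ->] [q ->]; exists (p * q); rewrite kpolyM.
- by move=> _ [k ->]; exists (mpolyC d k); rewrite kpolyC.
- by move=> _ /codomP[j ->]; exists (mpolyX K (mnm1 j)); rewrite kpolyX.
Qed.

Lemma is_der_kpoly d (z : 'I_d -> R) (th : R -> R) j (c : R) p :
  @is_der K R R idfun th -> (forall b, th (z b) = (j == b)%:R * c) ->
  th (kpoly z p) = kpoly z (mderiv j p) * c.
Proof.
move=> dth thz; rewrite /kpoly (der_meval _ dth thz) /=.
rewrite big1 ?addr0 => [|m _]; last first.
  by rewrite mcoeff_kmap; case: dth => _ _ ->; rewrite mulr0.
congr (meval z _ * c); apply/mpolyP => a.
by rewrite mcoeff_deriv !mcoeff_kmap mcoeff_deriv -scalerMnl.
Qed.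

Hypothesis dom : forall x y : R, x * y = 0 -> x = 0 \/ y = 0.

(** Once a power of ['X] is divided out, the relation has a nonzero constant term, which is a
    multiple of [g]. *)
Lemma multiple_of_algebraic E (g : R) p : subring_set E -> g <> 0 -> over E p ->
  p.[g] = 0 -> p <> 0 -> exists c g', [/\ E c, c <> 0 & c = g * g'].
Proof.
move=> sE g0; elim/poly_ind: p => [//|p c IH Ep].
have coefs j : (p * 'X + c%:P)`_j = if j is k.+1 then p`_k else c.
  by case: j => [|j]; rewrite coefD coefMX coefC /= ?add0r ?addr0.
rewrite hornerMXaddC => e p0.
have [c0|c0] := pselect (c = 0); last first.
  exists c, (- p.[g]); split=> //; first by have := Ep 0%N; rewrite coefs.
  by apply/eqP; rewrite mulrN -addr_eq0 addrC mulrC e.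
move: e; rewrite c0 addr0 => /dom[pg|//]; apply: IH => //.
  by move=> j; have := Ep j.+1; rewrite coefs.
by move=> pe; apply: p0; rewrite pe c0 mul0r add0r.
Qed.

Hypotheses (charK : [pchar K] =i pred0) (fgR : finitely_generated R).

Lemma zero_prime : prime_set [set 0 : R].
Proof.
split; last by move=> a b /dom.
  by split=> [//|a b -> ->|a b ->]; rewrite /= ?addr0 ?mulr0.
by move/eqP; rewrite oner_eq0.
Qed.

Lemma exists_chart f P : in_singular_locus f -> prime_set P -> ~ P f ->
  exists h, ~ P h /\ exists d z th, @chart d z h th.
Proof.
move=> sing prP nPf; have [gens gen] := fgR.
have [Q [F [i [e [l [x [z [h [dd lc]]]]]]]]] := exists_local_chart charK fgR sing prP nPf.
have [s nPs sQ] := kernel_killed charK (fg_noeth fgR) prP lc.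
have [P0 _ _] := (let: And3 idP _ _ := prP in idP).
have s0 : s <> 0 by move=> e0; apply: nPs; rewrite e0.
have iz r : i r = 0 -> r = 0 by move=> /(chart_ker lc)/sQ/dom[|].
have inji : injective i.
  by move=> a b e0; apply/eqP; rewrite -subr_eq0; apply/eqP/iz; rewrite rmorphB e0 subrr.
exists h; split; first exact: (chart_den lc).
have exth j : exists th : R -> R, forall r, i (th r) = i h * dd j r.
  by have [th thP] := choice (chart_integral lc j); exists th.
have [th thP] := choice exth.
exists (e + l)%N, z, th; split.
- by move=> h0; apply: (chart_den lc); rewrite h0.
- move=> j; have [dD dM dK] := chart_der lc j; split=> [a b|a b|k]; apply: inji.
  + by rewrite thP dD mulrDr rmorphD !thP.
  + by rewrite thP dM rmorphD !rmorphM !thP mulrDr !(mulrCA (i h)).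
  + by rewrite thP dK mulr0 rmorph0.
- by move=> a b; apply: inji; rewrite thP (chart_dual lc) rmorphM rmorph_nat mulrC.
- move=> g g0; pose E := adjs (@scalars K R) (codom z).
  have sE : subring_set E := subring_adjs _ (subring_scalars R).
  have scE : @scalars K R `<=` E by apply: sub_adjs; exact: subring_scalars.
  (* Otherwise [g] is transcendental over [K[z]], and some derivation kills the coordinates but has
     value [1] at [g], against [chart_inj]. *)
  have [p [Ep pg p0]] : exists p, [/\ over E p, p.[g] = 0 & p <> 0].
    apply: contrapT => no.
    have trg : trmod E [:: g] [set 0].
      split=> // p Ep pg; apply: contrapT => p0; apply: no; by exists p.
    have trF := trmod_trseq iz sE trg.
    have [D [dD Dg D0]] := exists_der (fun=> 1) charK gen sE scE trF.
    have := Dg 0%N isT; rewrite /= (chart_inj lc dD) => [/esym/eqP|b].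
      by rewrite oner_eq0.
    apply: D0; right; apply: mem_adjs; first exact: subring_scalars.
    exact: codom_f.
  have [c [g' [Ec c0 cg]]] := multiple_of_algebraic sE g0 Ep pg p0.
  have [q qc] := kpoly_adjs Ec; exists g', q; rewrite -qc; split=> // q0.
  by apply: c0; rewrite qc q0 kpoly0.
(* A chain of length [n] yields [n] independent elements and derivations dual to them. By
   [chart_inj] the values of these on the coordinates form a matrix with [n] independent rows and
   [e + l] columns. *)
- move=> n [C chain].
  pose C' k : set R := [set a | a \in (C k : pred R)].
  have prC k : prime_set (C' k).
    split; [split| |].
    + exact: idealr0.
    + by move=> a b aC bC; apply: rpredD.
    + by move=> a b bC; apply: idealMr.
    + by rewrite /C' /= idealr1.
    + by move=> a b; rewrite /C' /= prime_idealrM => /orP.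
  have [w [sw trw]] : exists w, size w = (n + 0)%N /\ trmod (@scalars K R) w (C' 0%N).
    apply: (@chain_transcendental _ _ C' n [::]) => //; first exact: subring_scalars.
      move=> j jn; have [sC nC] := chain _ jn; split=> // .
      apply: contrapT => no; apply: nC => u uC; apply/negPn/negP => nu.
      by apply: no; exists u => //; apply/negP.
    exact: scalars_meets.
  have sC0 : [set 0 : R] `<=` C' 0%N by move=> _ ->; exact: idealr0.
  have trF := trmod_trseq iz (subring_scalars R) (trmod_sub sC0 trw).
  have exD (a : 'I_n) : exists D, is_der i D /\ forall b : 'I_n, D w`_b = (a == b)%:R.
    have [D [dD Dw _]] := exists_der (fun b => (val a == b)%:R) charK gen
      (subring_scalars R) (@subset_refl _ _) trF.
    by exists D; split=> // b; rewrite Dw // sw addn0.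
  have [D DP] := choice exD.
  pose Z : 'M[F]_(n, e + l) := \matrix_(a, b) D a (z b).
  suff : row_free Z by rewrite /row_free => /eqP <-; exact: rank_leq_col.
  apply: inj_row_free => v vZ.
  have vz c : \sum_(a < n) v 0 a * D a (z c) = 0.
    have /rowP/(_ c) := vZ; rewrite !mxE => e0; rewrite -[RHS]e0.
    by apply: eq_bigr => a _; rewrite mxE.
  have derD a := (DP a).1.
  apply/rowP => b; have := chart_inj lc (der_comb (v 0) derD) vz w`_b.
  rewrite (bigD1 b) //= (DP b).2 eqxx mulr1 big1 ?addr0 ?mxE // => a.
  by rewrite (DP a).2 => /negbTE->; rewrite mulr0.
Qed.

(** The combinations of chart denominators form an ideal; a prime above it missing [f] would carry a
    chart with denominator outside that prime. *)
Lemma charts_cover f : in_singular_locus f -> GRing.lreg f ->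
  exists k (s : seq (R * R)), f ^+ k = \sum_(ah <- s) ah.1 * ah.2 /\
    forall ah, ah \in s -> exists d z th, @chart d z ah.2 th.
Proof.
move=> sing regf.
pose I : set R := [set x | exists s : seq (R * R), x = \sum_(ah <- s) ah.1 * ah.2 /\
    forall ah, ah \in s -> exists d z th, @chart d z ah.2 th].
have idI : ideal_set I.
  split; first by exists [::]; rewrite big_nil; split=> // ah; rewrite in_nil.
    move=> _ _ [s [-> sc]] [t [-> tc]]; exists (s ++ t); rewrite big_cat; split=> // ah.
    by rewrite mem_cat => /orP[/sc|/tc].
  move=> r _ [s [-> sc]]; exists [seq (r * ah.1, ah.2) | ah <- s]; split.
    by rewrite big_map mulr_sumr; apply: eq_bigr => ah _; rewrite mulrA.
  by move=> _ /mapP[ah /sc ahc ->].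
have [P prP IP nPf|k [s [fk sc]]] := @avoid_or _ _ f I idI; last by exists k, s.
have [h [nPh ch]] := exists_chart sing prP nPf; apply: nPh; apply: IP.
exists [:: (1, h)]; rewrite big_seq1 mul1r; split=> // ah.
by rewrite inE => /eqP->.
Qed.

End Charts.
(** * Linear simplicity *)

Section LinearSimplicity.
Variables (K : fieldType) (R : comAlgType K) (B : nat -> set (diffop R)).
Hypotheses (fB : alg_filtration B) (charK : [pchar K] =i pred0).
Local Notation D := (diffop R).

Lemma mulopD (a b : R) : mulop (a + b) = mulop a + mulop b :> D.
Proof. by apply: diffop_eq => x /=; rewrite mulrDl. Qed.
Lemma mulopB (a b : R) : mulop (a - b) = mulop a - mulop b :> D.
Proof. by apply: diffop_eq => x /=; rewrite mulrBl. Qed.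
Lemma mulopN (a : R) : mulop (- a) = - mulop a :> D.
Proof. by apply: diffop_eq => x /=; rewrite mulNr. Qed.
Lemma mulopM (a b : R) : mulop (a * b) = mulop a * mulop b :> D.
Proof. by apply: diffop_eq => x /=; rewrite mulrA. Qed.
Lemma mulop1 : mulop 1 = 1 :> D. Proof. by []. Qed.
Lemma mulop0 : mulop 0 = 0 :> D.
Proof. by apply: diffop_eq => x /=; rewrite mul0r. Qed.
Lemma mulopZ (k : K) (a : R) : mulop (k *: a) = k *: mulop a :> D.
Proof. by apply: diffop_eq => x /=; rewrite -scalerAl. Qed.
Lemma mulopX (a : R) n : mulop (a ^+ n) = mulop a ^+ n :> D.
Proof. by elim: n => [//|n IH]; rewrite !exprS mulopM IH. Qed.
Lemma mulop_sum (T : Type) (r : seq T) (f : T -> R) :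
  mulop (\sum_(j <- r) f j) = \sum_(j <- r) mulop (f j) :> D.
Proof. exact: (big_morph _ mulopD mulop0). Qed.
Lemma mulopC (a b : R) : mulop a * mulop b = mulop b * mulop a :> D.
Proof. by rewrite -!mulopM mulrC. Qed.

Lemma is_der_linear (th : R -> R) : @is_der K R R idfun th -> linear th.
Proof.
move=> [tD tM tK] k x y; rewrite tD; congr (_ + _).
by rewrite -[k *: x]mulr_algl tM tK /= mulr0 addr0 mulr_algl.
Qed.

Lemma is_der_diffop (th : R -> R) : @is_der K R R idfun th -> is_diffop th.
Proof.
move=> dth; apply/is_diffopP; exists 1%N; split; first exact: is_der_linear.
move=> r; exists (th r) => x; case: dth => _ -> _ /=.
by rewrite addrAC subrr add0r mulrC.
Qed.

Lemma mderiv_neq0 d (p : mpoly d K) : (1 < msize p)%N ->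
  exists j, mderiv j p <> 0 /\ (msize (mderiv j p) < msize p)%N.
Proof.
move=> p1; have p0 : p != 0 by rewrite -msize_poly_eq0 -lt0n ltnW.
have [a ap aE] : exists2 a, a \in msupp p & mdeg a = (msize p).-1.
  exists (mlead p); first exact: mlead_supp.
  by rewrite -(mlead_deg p0).
have [j aj] : exists j, a j != 0%N.
  apply: contrapT => no; have : mdeg a == 0%N.
    rewrite mdeg_eq0; apply/eqP/mnmP => j; rewrite mnm0E.
    by apply/eqP/negPn/negP => aj; apply: no; exists j.
  by rewrite aE; case: (msize p) p1 => [|[]].
have aS : mnm_add (mnm_sub a (mnm1 j)) (mnm1 j) = a.
  apply/mnmP => b; rewrite mnmDE mnmBE mnm1E.
  by case: eqP => [<-|_]; rewrite ?subn0 ?addn0 // subnK // lt0n.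
exists j; split.
  move/mpolyP/(_ (mnm_sub a (mnm1 j))); rewrite mcoeff_deriv aS mcoeff0 -mulr_natl.
  have /pcharf0P ch := charK.
  by move/eqP; rewrite mulf_eq0 ch /= mcoeff_eq0 ap.
rewrite -(prednK (ltnW p1)) ltnS msizeE; apply/bigmax_leqP_seq => b bp _.
have : mcoeff (mnm_add b (mnm1 j)) p != 0.
  move: bp; rewrite mcoeff_msupp mcoeff_deriv; apply: contra => /eqP->.
  by rewrite mul0rn.
rewrite -mcoeff_msupp => /msize_mdeg_lt; rewrite mdegD mdeg1 addn1.
by rewrite -{1}(prednK (ltnW p1)) ltnS.
Qed.

Lemma der_op (T : D) r : @is_der K R R idfun T ->
  T * mulop r = mulop (T r) + mulop r * T.
Proof. by move=> [_ tM _]; apply: diffop_eq => x /=; rewrite tM /= addrC [x * _]mulrC. Qed.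

Section OneChart.
Variables (d : nat) (z : 'I_d -> R) (h : R) (T : 'I_d -> D).
Hypothesis ch : chart z h T.

Let dT j : @is_der K R R idfun (T j) := chart_is_der ch j.

Lemma filt_common_chart : exists C, [/\ B C (mulop h), forall j, B C (T j),
  forall j, B C (mulop (T j h)) & forall j, B C (mulop (z j))].
Proof.
have [C CP] := filt_common fB (mulop h :: [seq T j | j <- enum 'I_d] ++
  [seq mulop (T j h) | j <- enum 'I_d] ++ [seq mulop (z j) | j <- enum 'I_d]).
exists C; split=> [|j|j|j]; apply: CP; rewrite inE ?eqxx //; apply/orP; right;
  rewrite !mem_cat; apply/orP; [left|right|right].
- by apply: map_f; rewrite mem_enum.
- by apply/orP; left; apply: (map_f (fun j => mulop (T j h))); rewrite mem_enum.
- by apply/orP; right; apply: (map_f (fun j => mulop (z j))); rewrite mem_enum.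
Qed.

(* With [d_j = T j / h], the combination [h [T j, u] - n T_j(h) u] sends
   [u = p h^n] to [(d_j p) h^(n + 2)]. *)
Lemma poly_step p n j :
  mulop (kpoly z (mderiv j p) * h ^+ n.+2) =
  mulop h * (T j * mulop (kpoly z p * h ^+ n) - mulop (kpoly z p * h ^+ n) * T j) -
  n%:R *: (mulop (T j h) * mulop (kpoly z p * h ^+ n)).
Proof.
rewrite der_op // addrK -!mulopM -mulopZ -mulopB; congr (mulop _).
have [_ tM _] := dT j; rewrite tM (derX _ _ (dT j)) /=.
rewrite (is_der_kpoly p (dT j) (chart_eq ch j)) scaler_nat.
move: (kpoly z p) (kpoly z _) (T j h) => a b t; rewrite mulrnAr mulrDr mulrnAr.
rewrite (_ : h * (a * (h ^+ n.-1 * t)) *+ n = t * (a * h ^+ n) *+ n).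
  by rewrite addrAC subrr add0r 2!exprS; move: (h ^+ n) => c; ring.
by case: n => [//|n] /=; congr (_ *+ _); rewrite exprS; ring.
Qed.

(** Each derivative lowers the degree and costs [h ^+ 2]; in characteristic zero some derivative of
    a nonconstant polynomial is nonzero. *)
Lemma poly_descent : exists C, forall s p n, p <> 0 -> (msize p <= s.+1)%N ->
  sand B (C * s) (mulop (kpoly z p * h ^+ n)) (mulop (h ^+ (n + 2 * s))).
Proof.
have [C [Ch CT CTh _]] := filt_common_chart.
exists (C + C)%N; elim=> [|s IH] p n p0 sp.
  have pE := msize1_polyC sp; set c := mcoeff mnm0 p in pE.
  have c0 : c != 0 by apply/eqP => c0; apply: p0; rewrite pE c0 mpolyC0.
  rewrite pE kpolyC mulr_algl mulopZ !muln0 addn0.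
  by rewrite -[X in sand _ _ _ X](scalerK c0); apply: sandZ => //; exact: sand_refl.
(* A polynomial of smaller degree skips the derivative but still pays [h ^+ 2], so that the final
   exponent depends on [n] and [s] only. *)
have [sps|sps] := leqP (msize p) s.+1.
  have := IH p n p0 sps => IHp.
  rewrite mulnS (_ : n + 2 * s.+1 = 2 + (n + 2 * s))%N; last by lia.
  rewrite exprD [mulop (h ^+ 2 * _)]mulopM; apply: sandMl => //.
  by rewrite mulopX expr2; apply: filtM.
have [j [dp0 sdp]] : exists j, mderiv j p <> 0 /\ (msize (mderiv j p) < msize p)%N.
  by apply: mderiv_neq0; apply: leq_trans sps.
have {}sdp : (msize (mderiv j p) <= s.+1)%N by rewrite -ltnS (leq_trans sdp).
rewrite mulnS (_ : n + 2 * s.+1 = n.+2 + 2 * s)%N; last by lia.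
apply: (sand_trans fB) (IH _ n.+2 dp0 sdp).
have r0 := sand_refl fB (mulop (kpoly z p * h ^+ n)).
rewrite poly_step; apply: sandB => //.
  apply: sandMl => //; apply: sandB => //; rewrite -[C]addn0; [exact: sandMl|exact: sandMr].
apply: sandZ => //; apply: (sand_mono fB (leq_addr C C)).
by rewrite -[C]addn0; apply: sandMl.
Qed.

Lemma filtZ n k (u : D) : B n u -> B n (k *: u).
Proof. by rewrite -mulr_algl -[X in _ -> B X _]add0n; apply: (filtM fB); exact: (filt_scalar fB). Qed.

Lemma filtB n (u v : D) : B n u -> B n v -> B n (u - v).
Proof. by move=> Bu Bv; apply: (filtD fB) => //; rewrite -scaleN1r; apply: filtZ. Qed.

(* [Zop s] is [h ^ (2 * size s)] times the product of the [T j / h], [j] in [s]. *)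
Definition Lop m j : D := mulop h * T j - mulop ((2 * m)%:R * T j h).

Fixpoint Zop (s : seq 'I_d) : D := if s is j :: s' then Lop (size s') j * Zop s' else 1.

(** [Lop m j] is [h^(2m+2) (T j / h) h^(-2m)], so moving [h ^+ 2] across it shifts [m] by one. *)
Lemma Lop_h2 m j : Lop m.+1 j * mulop (h ^+ 2) = mulop (h ^+ 2) * Lop m j.
Proof.
rewrite /Lop mulrBl mulrBr -mulrA der_op // mulrDr !mulrA -!mulopM.
have -> : h ^+ 2 * h = h * h ^+ 2 by rewrite mulrC.
rewrite addrAC -mulopB [LHS]addrC; congr (_ + _); have [_ tM _] := dT j.
rewrite -mulopN; congr (mulop _); rewrite expr2 tM /= mulnS natrD.
by move: (T j h) (2 * m)%:R => t c; ring.
Qed.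

Lemma Lop_coord m j k : Lop m j * mulop (z k) - mulop (z k) * Lop m j =
  (j == k)%:R *: mulop (h ^+ 2).
Proof.
rewrite /Lop mulrBl mulrBr [mulop (_ * T j h) * _]mulopC opprB addrA subrK.
rewrite -mulrA der_op // mulrDr !mulrA [mulop h * mulop (z k)]mulopC addrK -mulopM.
by rewrite (chart_eq ch) -mulopZ scaler_nat expr2 mulrCA mulr_natl.
Qed.

Definition leo : rel 'I_d := fun a b => (a <= b)%N.
Lemma leo_trans : transitive leo. Proof. by move=> b a c; exact: leq_trans. Qed.
Lemma leo_anti : antisymmetric leo.
Proof. by move=> a b /andP[ab ba]; apply/val_inj/eqP; rewrite eqn_leq; apply/andP. Qed.
Lemma leo_total : total leo. Proof. by move=> a b; exact: leq_total. Qed.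

(** As in the Weyl algebra, the commutator with [z k] differentiates by the symbol of [T k / h].
    Sorting does the work of commutation among the [T j / h]: if [k] heads the list and occurs again
    in the tail [s], then [k :: rem k s] is [s] itself. *)
Lemma Zop_coord s k : sorted leo s ->
  Zop s * mulop (z k) - mulop (z k) * Zop s =
  (count_mem k s)%:R *: (mulop (h ^+ 2) * Zop (rem k s)).
Proof.
elim: s => [_|j s IH jsort]; first by rewrite /= mul1r mulr1 subrr scale0r.
have ssort : sorted leo s by apply: path_sorted jsort.
rewrite [Zop (j :: s)]/= -mulrA.
have -> : Zop s * mulop (z k) =
    mulop (z k) * Zop s + (count_mem k s)%:R *: (mulop (h ^+ 2) * Zop (rem k s)).
  by rewrite -IH // addrC subrK.
rewrite mulrDr !mulrA addrAC -mulrBl Lop_coord -scalerAl -scalerAr.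
case: (boolP (k \in s)) => [ks|nks]; last first.
  rewrite /= (count_memPn nks) addn0 scale0r addr0.
  by case: eqP => [_|_]; rewrite ?scale0r.
have sz : size s = (size (rem k s)).+1 by rewrite size_rem // prednK //; case: (s) ks.
rewrite sz mulrA Lop_h2 -mulrA -[Lop _ j * _]/(Zop (j :: rem k s)) /=.
case: eqP => [jk|_]; last by rewrite scale0r add0r add0n.
suff : Zop (k :: rem k s) = Zop s by rewrite -jk /= => ->; rewrite natrD scalerDl.
case: s ks jsort {IH ssort sz} => [//|i s] /= ks /andP[ji isort].
have [<-|ki] := eqVneq i k; first by [].
move: ks; rewrite inE eq_sym (negbTE ki) /= => ks; case/eqP: ki; apply: leo_anti.
have /allP/(_ _ ks) ik := order_path_min leo_trans isort.
by rewrite ik /= -jk.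
Qed.
Definition sq (b : multinom d) : seq 'I_d :=
  sort leo (flatten [seq nseq (b i) i | i <- index_enum 'I_d]).

Lemma count_sq b k : count_mem k (sq b) = b k.
Proof.
rewrite /sq (permP (permEl (perm_sort _ _))) count_flatten -map_comp sumnE big_map /=.
rewrite (bigD1 k) //= count_nseq /= eqxx mul1n big1 ?addn0 // => i ik.
by rewrite count_nseq /= (negbTE ik).
Qed.

Lemma size_sq b : size (sq b) = mdeg b.
Proof.
rewrite size_sort size_flatten sumnE !big_map mdegE /=.
by apply: eq_bigr => i _; rewrite size_nseq.
Qed.

Lemma rem_sq b k : rem k (sq b) = sq (mnm_sub b (mnm1 k)).
Proof.
apply: (sorted_eq leo_trans leo_anti); [|exact: sort_sorted leo_total _|].
  by apply: (subseq_sorted leo_trans (rem_subseq k (sq b))); apply: sort_sorted; exact: leo_total.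
apply/allP => x _ /=; rewrite count_mem_rem !count_sq mnmBE mnm1E; exact: eqxx.
Qed.

Lemma sq0 : sq mnm0 = [::].
Proof. by apply/size0nil; rewrite size_sq mdeg0. Qed.

Lemma filt_Zop C s : B C (mulop h) -> (forall j, B C (T j)) ->
  (forall j, B C (mulop (T j h))) -> B ((C + C) * size s)%N (Zop s).
Proof.
move=> Ch CT CTh; elim: s => [|j s IH] /=.
  by rewrite muln0 -(scale1r 1); exact: (filt_scalar fB).
rewrite mulnS; apply: filtM => //; apply: filtB; first exact: filtM.
apply: (filt_leq fB (leq_addr C C)); rewrite mulr_natl -scaler_nat mulopZ.
exact: filtZ.
Qed.

Definition weyl_op (l : seq (mpoly d K * multinom d)) : D :=
  \sum_(qb <- l) mulop (kpoly z qb.1) * Zop (sq qb.2).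

(** The derivative by the symbol of [T k / h]. Terms without it are dropped, so that all
    coefficients stay nonzero. *)
Definition weyl_deriv k (l : seq (mpoly d K * multinom d)) :=
  [seq ((qb.2 k)%:R *: qb.1, mnm_sub qb.2 (mnm1 k)) |
    qb : mpoly d K * multinom d <- l & qb.2 k != 0%N].

Lemma weyl_op_coord n l k :
  mulop (h ^+ n) * weyl_op l * mulop (z k) - mulop (z k) * (mulop (h ^+ n) * weyl_op l) =
  mulop (h ^+ n.+2) * weyl_op (weyl_deriv k l).
Proof.
rewrite /weyl_op mulr_sumr mulr_suml mulr_sumr -sumrB.
rewrite /weyl_deriv big_map big_filter mulr_sumr [RHS]big_mkcond /=; apply: eq_bigr => -[q b] _ /=.
have -> : mulop (h ^+ n) * (mulop (kpoly z q) * Zop (sq b)) * mulop (z k) -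
    mulop (z k) * (mulop (h ^+ n) * (mulop (kpoly z q) * Zop (sq b))) =
    mulop (h ^+ n) * mulop (kpoly z q) * (Zop (sq b) * mulop (z k) - mulop (z k) * Zop (sq b)).
  rewrite mulrBr -!mulrA; congr (_ - _).
  by rewrite !mulrA -!mulopM; congr (mulop _ * _); rewrite -mulrA mulrC.
rewrite Zop_coord; last exact: sort_sorted leo_total _.
rewrite count_sq rem_sq; case: ifPn => [_|]; last first.
  by rewrite negbK => /eqP->; rewrite scale0r mulr0.
rewrite -scalerAr [_ * (mulop (h ^+ 2) * _)]mulrA scalerAl [RHS]mulrA; congr (_ * _).
rewrite -!mulopM -mulopZ; congr (mulop _).
rewrite /kpoly scaler_nat scaler_nat raddfMn [in RHS]raddfMn mulrnAr; congr (_ *+ _).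
by rewrite mulrAC -exprD addn2.
Qed.

Lemma weyl_deriv_uniq k l : uniq (map snd l) -> uniq (map snd (weyl_deriv k l)).
Proof.
move=> ul; rewrite -map_comp (map_comp (fun b => mnm_sub b (mnm1 k)) snd).
rewrite map_inj_in_uniq.
  apply: subseq_uniq ul; apply: map_subseq; exact: filter_subseq.
have pos c : c \in [seq qb.2 | qb : mpoly d K * multinom d <- l & qb.2 k != 0%N] ->
    mnm_add (mnm_sub c (mnm1 k)) (mnm1 k) = c.
  move=> /mapP[qb]; rewrite mem_filter => /andP[qk _] ->; apply/mnmP => j.
  by rewrite mnmDE mnmBE mnm1E; case: eqP => [<-|_]; rewrite ?subn0 ?addn0 // subnK // lt0n.
by move=> a b /pos ea /pos eb ab; rewrite -ea ab eb.
Qed.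

(** Commutators with coordinates lower the exponents of the [T j / h] until a multiplication
    operator remains. Distinct exponents with nonzero coefficients prevent cancellation, and the
    degree bound [M] is preserved. *)
Lemma weyl_descent : exists C, forall M s l n, uniq (map snd l) -> l <> [::] ->
  (forall qb, qb \in l -> [/\ qb.1 <> 0, (msize qb.1 <= M)%N & (mdeg qb.2 <= s)%N]) ->
  exists q, [/\ q <> 0, (msize q <= M)%N &
    sand B (C * s) (mulop (h ^+ n) * weyl_op l) (mulop (kpoly z q * h ^+ (n + 2 * s)))].
Proof.
have [C [Ch _ _ Cz]] := filt_common_chart; exists (C + C)%N => M.
(* When all exponents are zero, [uniq] leaves a single term; the remaining steps only multiply by
   [h ^+ 2] to reach the announced exponent. *)
have const s l n : uniq (map snd l) -> l <> [::] ->
    (forall qb, qb \in l -> [/\ qb.1 <> 0, (msize qb.1 <= M)%N & qb.2 = mnm0]) ->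
    exists q, [/\ q <> 0, (msize q <= M)%N &
      sand B ((C + C) * s) (mulop (h ^+ n) * weyl_op l) (mulop (kpoly z q * h ^+ (n + 2 * s)))].
  case: l => [//|[q b] l] /= /andP[bl _] _ lP.
  have [/= q0 qM b0] := lP _ (mem_head _ _).
  have l0 : l = [::].
    case: l bl lP => [//|[q' b'] l] /= bl lP.
    have [|_ _ /= b'0] := lP (q', b'); first by rewrite !inE eqxx orbT.
    by move: bl; rewrite b0 b'0 inE eqxx.
  exists q; split=> //; rewrite l0 /weyl_op big_seq1 /= b0 sq0 mulr1 -mulopM.
  elim: s => [|s IH].
    by rewrite !muln0 addn0 mulrC; exact: sand_refl.
  rewrite mulnS (_ : n + 2 * s.+1 = 2 + (n + 2 * s))%N; last by lia.
  rewrite exprD mulrCA [X in sand _ _ _ X]mulopM; apply: sandMl IH => //.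
  by rewrite mulopX expr2; apply: filtM.
elim=> [|s IH] l n ul l0 lP.
  apply: const => // qb /lP[q0 qM]; rewrite leqn0 mdeg_eq0 => /eqP qb0; by split.
have [allz|] := pselect (forall qb, qb \in l -> qb.2 = mnm0).
  by apply: const => // qb ql; have [q0 qM _] := lP _ ql; split=> //; apply: allz.
move=> /existsNP[[q b] /not_implyP[ql /= b0]].
have [k bk] : exists k, b k != 0%N.
  apply: contrapT => no; apply: b0; apply/mnmP => j; rewrite mnm0E.
  by apply/eqP/negPn/negP => bj; apply: no; exists j.
have [||q' [q'0 q'M sq']] := IH (weyl_deriv k l) n.+2 (weyl_deriv_uniq k ul).
- have : ((b k)%:R *: q, mnm_sub b (mnm1 k)) \in weyl_deriv k l.
    apply/mapP; exists (q, b) => //; by rewrite mem_filter /= bk.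
  by case: (weyl_deriv k l).
- move=> qb /mapP[[p c]]; rewrite mem_filter /= => /andP[ck pl] ->.
  have [/= p0 pM cs] := lP _ pl.
  have ck0 : (c k)%:R != 0 :> K by have /pcharf0P -> := charK.
  split; rewrite /= ?msizeZ //.
    by apply/eqP; rewrite scaler_eq0 negb_or ck0; apply/eqP.
  rewrite -ltnS -addn1 -(mdeg1 k) -mdegD (_ : mnm_add _ _ = c) //.
  apply/mnmP => j; rewrite mnmDE mnmBE mnm1E.
  by case: eqP => [<-|_]; rewrite ?subn0 ?addn0 // subnK // lt0n.
exists q'; split=> //.
rewrite mulnS (_ : n + 2 * s.+1 = n.+2 + 2 * s)%N; last by lia.
apply: (sand_trans fB) sq'; rewrite -weyl_op_coord.
have r0 := sand_refl fB (mulop (h ^+ n) * weyl_op l).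
apply: (sand_mono fB (leq_addr C C)); rewrite -[C]addn0.
by apply: sandB => //; [exact: sandMr|exact: sandMl].
Qed.

Lemma chart_descent : exists C, forall s l, uniq (map snd l) -> l <> [::] ->
  (forall qb, qb \in l -> [/\ qb.1 <> 0, (msize qb.1 <= s.+1)%N & (mdeg qb.2 <= s)%N]) ->
  sand B (C * s) (weyl_op l) (mulop (h ^+ (4 * s))).
Proof.
have [C1 C1P] := weyl_descent; have [C2 C2P] := poly_descent.
exists (C1 + C2)%N => s l ul l0 lP.
have [q [q0 sq' sand1]] := C1P s.+1 s l 0%N ul l0 lP.
rewrite expr0 mulop1 mul1r add0n in sand1.
rewrite mulnDl (_ : 4 * s = 2 * s + 2 * s)%N; last by lia.
by apply: (sand_trans fB) sand1 _; apply: C2P.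
Qed.

End OneChart.

(** [g] divides a polynomial [p] in [z] of degree [m], so [g ^+ N] generates [p ^+ N], of degree
    [m * N], and the descent ends at [h ^+ (2 * m * N)]. *)
Lemma chart_transfer d (z : 'I_d -> R) h (T : 'I_d -> D) g : chart z h T -> g <> 0 ->
  exists C e, forall N, sand B (C * N) (mulop (g ^+ N)) (mulop (h ^+ (e * N))).
Proof.
move=> ch g0; have [g' [p [p0 pg]]] := chart_alg ch g0.
have [C CP] := poly_descent ch; have [C' C'P] := filt_exhaustive fB (mulop g').
pose m := (msize p).-1; have mp : msize p = m.+1.
  by rewrite prednK // lt0n msize_poly_eq0; apply/eqP.
have pN N : p ^+ N <> 0 /\ msize (p ^+ N) = (m * N).+1.
  elim: N => [|N [IH0 IHs]].
    by rewrite expr0 muln0; split; [apply/eqP; exact: oner_neq0|rewrite -mpolyC1 msizeC oner_neq0].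
  rewrite exprS; split; first by apply/eqP; rewrite mulf_neq0 //; apply/eqP.
  by rewrite msizeM ?IHs ?mp; [rewrite addSn /= addnS mulnS|apply/eqP|apply/eqP].
exists (C' + C * m)%N, (2 * m)%N => N; have [pN0 pNs] := pN N.
have := CP (m * N)%N (p ^+ N) 0%N pN0; rewrite pNs leqnn => /(_ isT).
rewrite expr0 mulr1 add0n mulnA.
have -> : kpoly z (p ^+ N) = g' ^+ N * g ^+ N.
  elim: N {pN0 pNs} => [|N IH]; first by rewrite !expr0 mulr1 /kpoly !rmorph1.
  by rewrite !exprS kpolyM IH pg; ring.
rewrite mulnDl mulnA; apply: (sand_trans fB); rewrite -[(C' * N)%N]addn0 mulopM.
by apply: (sandMl fB); [rewrite mulopX; apply: filtX|exact: sand_refl].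
Qed.

Lemma cover_transfer g (s : seq (R * R)) : g <> 0 ->
  (forall ah, ah \in s -> exists d (z : 'I_d -> R) (T : 'I_d -> D), chart z ah.2 T) ->
  exists C e, forall N,
    sand B (C * N) (mulop (g ^+ N)) (mulop ((\sum_(ah <- s) ah.1 * ah.2) ^+ (e * N))).
Proof.
move=> g0; elim: s => [|[a h] s IH] sc.
  (* The exponent factor [1] makes the power of the empty sum vanish for [N > 0]. *)
  exists 0%N, 1%N => N; rewrite mul0n mul1n big_nil; case: N => [|N].
    by rewrite !expr0; exact: sand_refl.
  by rewrite [0 ^+ _]expr0n /= mulop0; exact: sand0.
have [|C [e Ce]] := IH; first by move=> ah ahs; apply: sc; rewrite inE ahs orbT.
have [d [z [T ch]]] := sc _ (mem_head _ _); have [C' [e' Ce']] := chart_transfer ch g0.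
rewrite /= {ch} in Ce'; set w := \sum_(ah <- s) _ in Ce.
have [L [La Lh Lw]] : exists L, [/\ B L (mulop a), B L (mulop h) & B L (mulop w)].
  have [L LP] := filt_common fB [:: mulop a; mulop h; mulop w].
  by exists L; split; apply: LP; rewrite !inE eqxx ?orbT.
(* Each term of the binomial expansion of exponent [(e' + e) * N] contains [w ^+ (e * N)] or
   [h ^+ (e' * N)]; the remaining factors have linear level. *)
pose E := (e' + e)%N; exists ((L + L + L) * E + (C + C'))%N, E => N.
rewrite big_cons /= -/w exprDn mulop_sum; apply: sand_sum => // -[j jE] _ /=.
rewrite -scaler_nat mulopZ; apply: sandZ => //.
have lev x m n : (m <= E * N)%N -> (n <= E * N)%N -> (x <= E * N)%N ->
    B ((L + L + L) * E * N)%N (mulop (a ^+ m * h ^+ n * w ^+ x)).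
  move=> mE nE xE; apply: (filt_leq fB (m := (L * m + L * n + L * x)%N)).
    rewrite -mulnA (mulnDl (L + L)) (mulnDl L).
    by apply: leq_add; [apply: leq_add|]; apply: leq_mul.
  by rewrite !mulopM !mulopX; apply: (filtM fB); [apply: (filtM fB)|]; apply: (filtX fB).
have [le|lt] := leqP (e * N) j.
  have -> : (a * h) ^+ (E * N - j) * w ^+ j =
      a ^+ (E * N - j) * h ^+ (E * N - j) * w ^+ (j - e * N) * w ^+ (e * N).
    by rewrite exprMn -!mulrA -exprD subnK.
  rewrite mulopM (mulnDl (_ * E)); apply: (sandMl fB).
    by apply: lev; rewrite ?leq_subr // leq_subLR (leq_trans _ (leq_addl _ _)).
  by apply: (sand_mono fB) (Ce N); rewrite leq_mul2r leq_addr orbT.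
have le : (e' * N <= E * N - j)%N by rewrite /E mulnDl; lia.
have -> : (a * h) ^+ (E * N - j) * w ^+ j =
    a ^+ (E * N - j) * h ^+ (E * N - j - e' * N) * w ^+ j * h ^+ (e' * N).
  by rewrite exprMn -{2}(subnK le) [h ^+ (_ + _)]exprD -!mulrA; congr (_ * (_ * _)); rewrite mulrC.
rewrite mulopM (mulnDl (_ * E)); apply: (sandMl fB).
  by apply: lev; lia.
by apply: (sand_mono fB) (Ce' N); rewrite leq_mul2r leq_addl orbT.
Qed.

End LinearSimplicity.

(** * The linear bound *)

Section LinearSimplicityTheorem.
Variables (K : fieldType) (R : comAlgType K) (B : nat -> set (diffop R)) (f : R).
Hypotheses (fB : alg_filtration B) (charK : [pchar K] =i pred0).
Hypothesis dom : forall x y : R, x * y = 0 -> x = 0 \/ y = 0.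
Hypotheses (fgR : finitely_generated R) (sing : in_singular_locus f) (regf : GRing.lreg f).
Hypothesis sbs : forall n : nat, ~~ root (SBS f) n%:R.

Lemma chart_diffop d (z : 'I_d -> R) h th : chart z h th ->
  exists T : 'I_d -> diffop R, chart z h T.
Proof. by move=> ch; exists (fun j => DiffOp (is_der_diffop (chart_is_der ch j))). Qed.

Lemma linearly_simple d (z : 'I_d -> R) h (T : 'I_d -> diffop R) : chart z h T ->
  exists C, forall s l, uniq (map snd l) -> l <> [::] ->
    (forall qb, qb \in l -> [/\ qb.1 <> 0, (msize qb.1 <= s.+1)%N & (mdeg qb.2 <= s)%N]) ->
    sand B (C * s) (weyl_op z h T l) 1.
Proof.
move=> ch; have [C1 C1P] := chart_descent fB charK ch.
have [k [t [fk tc]]] := charts_cover dom charK fgR sing regf.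
have [|C2 [e C2P]] := cover_transfer fB charK (s := t) (chart_neq0 ch).
  by move=> ah /tc[d' [z' [th ch']]]; have [T' chT'] := chart_diffop ch'; exists d', z', T'.
have [C3 C3P] := sandwich_powers fB sbs.
(* The three summands pay for the passages from [weyl_op] to [h ^+ (4 * s)], from there to
   [f ^+ (k * (e * (4 * s)))], and from there to [1]. *)
exists (C1 + (C2 * 4 + C3 * (k * (e * 4))))%N => s l ul l0 lP.
rewrite !mulnDl; apply: (sand_trans fB) (C1P s l ul l0 lP) _.
have := C2P (4 * s)%N; rewrite -fk -exprM mulnA => /(sand_trans fB); apply.
by have := C3P (k * (e * (4 * s)))%N; rewrite !mulnA.
Qed.

End LinearSimplicityTheorem.
(** * The Bernstein filtration *)

Section BernsteinFiltration.
Variables (K : fieldType) (R : comAlgType K) (G : nat -> {pred R}).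
Hypothesis gG : is_grading G.
Local Notation cmp := (cmp gG).
Local Notation dgr := (dgr gG).

Section Span.
Variables (V : lmodType K) (A : set V).

Lemma lspan_mem u : A u -> lspan A u.
Proof. by move=> Au; exists 1%N, (fun=> 1), (fun=> u); rewrite big_ord1 scale1r. Qed.

Lemma lspan_min (S : set V) : S 0 -> (forall k u v, S u -> S v -> S (k *: u + v)) ->
  A `<=` S -> lspan A `<=` S.
Proof.
move=> S0 SP AS _ [n [c [u [Au ->]]]]; elim: n c u Au => [|n IH] c u Au.
  by rewrite big_ord0.
by rewrite big_ord_recl; apply: SP; [apply: AS|apply: IH => i; apply: Au].
Qed.

Lemma lspan0 : lspan A 0.
Proof. by exists 0%N, (fun=> 0), (fun=> 0); split=> [[]//|]; rewrite big_ord0. Qed.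

Lemma lspanP k u v : lspan A u -> lspan A v -> lspan A (k *: u + v).
Proof.
move=> [m [c [x [Ax ->]]]] [n [c' [y [Ay ->]]]].
exists (m + n)%N, (fun i => match fintype.split i with inl a => k * c a | inr b => c' b end),
  (fun i => match fintype.split i with inl a => x a | inr b => y b end); split.
  by move=> i; case: (fintype.split i).
rewrite big_split_ord scaler_sumr; congr (_ + _); apply: eq_bigr => i _.
  by rewrite (unsplitK (inl i)) scalerA.
by rewrite (unsplitK (inr i)).
Qed.

End Span.

Lemma ord_le n (u : diffop R) : diffop_le n u -> (ord u <= n)%N.
Proof. by move=> un; rewrite /ord; case: ex_minnP => m _; apply; apply/asboolP. Qed.

Lemma diffop_ord (u : diffop R) : diffop_le (ord u) u.
Proof. by rewrite /ord; case: ex_minnP => m /asboolP. Qed.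

Lemma ordM (u v : diffop R) : (ord (u * v)%R <= ord u + ord v)%N.
Proof. by apply: ord_le; apply: diffop_leM; exact: diffop_ord. Qed.

Lemma homogeneousM i j (u v : diffop R) : homogeneous_of_degree G i u ->
  homogeneous_of_degree G j v -> homogeneous_of_degree G (i + j) (u * v).
Proof.
move=> hu hv k x xk /=; have := hv k x xk; rewrite [i + j]addrC addrA.
case: (k%:Z + j) => [n|n] /= vx; first exact: hu.
move: vx => /eqP->; have -> : u 0 = 0.
  by have := diffop_linear u (-1) 0 0; rewrite scaler0 addr0 scaleN1r addNr.
by case: (Negz n + i) => m /=; [exact: piece0|rewrite inE].
Qed.

(* [R_j], indexed by all integers, as the range of a projection. *)
Definition zcmp (x : R) (j : int) : R := if j is Posz n then cmp x n else 0.

Lemma zcmp_piece x j : zcmp x j \in piece G j.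
Proof. by case: j => n /=; [exact: cmpG|rewrite inE]. Qed.

Lemma zcmpP k x y j : zcmp (k *: x + y) j = k *: zcmp x j + zcmp y j.
Proof. by case: j => n /=; rewrite ?cmpP // scaler0 addr0. Qed.

Lemma zcmp0 j : zcmp 0 j = 0.
Proof. by case: j => n /=; rewrite ?cmp0. Qed.

Lemma zcmp_mul i x y j : x \in G i -> zcmp (x * y) (i%:Z + j) = x * zcmp y j.
Proof.
move=> xG; case: j => n.
  by rewrite -PoszD /= (cmp_mul_homog _ _ _ xG) leq_addr addKn.
rewrite /= mulr0; case E : (i%:Z + Negz n) => [m|//] /=.
rewrite (cmp_mul_homog _ _ _ xG) leqNgt; have -> // : (m < i)%N.
by move: E; rewrite NegzE; lia.
Qed.

(** The part of degree [m] of [d], taken for plain functions: that it is again a differential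
    operator is shown by induction on the order. *)
Definition hpart (d : R -> R) (m : int) (x : R) : R :=
  \sum_(i < dgr x) zcmp (d (cmp x i)) (i%:Z + m).

Section HomogeneousPart.
Variable d : R -> R.
Hypothesis ld : linear d.

Lemma lin0 : d 0 = 0.
Proof. by have := ld (-1) 0 0; rewrite scaler0 addr0 scaleN1r addNr. Qed.

Lemma hpartE m x n : (dgr x <= n)%N ->
  hpart d m x = \sum_(i < n) zcmp (d (cmp x i)) (i%:Z + m).
Proof.
move=> xn; rewrite /hpart.
rewrite -(@sum_support K R (fun i => zcmp (d (cmp x i)) (i%:Z + m)) _ _ xn) // => i xi.
by rewrite cmp_ge // lin0 zcmp0.
Qed.

Lemma hpart_linear m : linear (hpart d m).
Proof.
move=> k x y; pose n := maxn (dgr (k *: x + y)) (maxn (dgr x) (dgr y)).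
rewrite !(@hpartE m _ n) ?leq_max ?leqnn ?orbT // scaler_sumr -big_split.
by apply: eq_bigr => i _; rewrite cmpP ld zcmpP.
Qed.

Lemma hpart_homog m i x : x \in G i -> hpart d m x = zcmp (d x) (i%:Z + m).
Proof.
move=> xG; rewrite (@hpartE m x (maxn (dgr x) i.+1)) ?leq_maxl //.
have lt_i : (i < maxn (dgr x) i.+1)%N by rewrite leq_max leqnn orbT.
rewrite (bigD1 (Ordinal lt_i)) //= (cmp_homog gG _ xG) eqxx big1 ?addr0 // => j.
by rewrite -val_eqE /= => /negbTE ji; rewrite (cmp_homog gG _ xG) ji lin0 zcmp0.
Qed.

End HomogeneousPart.

Lemma linear_ext (d e : R -> R) : linear d -> linear e ->
  (forall i x, x \in G i -> d x = e x) -> d =1 e.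
Proof.
move=> ld le de x; rewrite (cmp_sum (leqnn (dgr x))).
elim: (dgr x) => [|n IH]; first by rewrite big_ord0 !lin0.
rewrite big_ord_recr /= addrC -[cmp x n]scale1r ld le IH; congr (_ *: _ + _).
by apply: (de n); exact: cmpG.
Qed.

(** For [y] homogeneous of degree [e], the commutator of the degree [m] part with [y] is the degree
    [m + e] part of the commutator; a general [r] is a sum of homogeneous elements. *)
Lemma hpart_diffop n d m : diffop_le n d -> diffop_le n (hpart d m).
Proof.
elim: n d m => [|n IH] d m dn; have ld := diffop_le_linear dn.
  case: dn => a da; exists (zcmp a m); apply: linear_ext; first exact: hpart_linear.
    by move=> k x y; rewrite mulrDr scalerAr.
  by move=> i x xG; rewrite (hpart_homog ld _ xG) da mulrC (zcmp_mul _ _ xG) mulrC.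
case: dn => _ hd; split=> [|r]; first exact: hpart_linear.
have key e y : y \in G e -> diffop_le n (fun x => hpart d m (y * x) - y * hpart d m x).
  move=> yG; apply: diffop_le_ext (IH _ (m + e%:Z) (hd y)).
  have lh := hpart_linear ld m; have lc := diffop_le_linear (hd y).
  apply: linear_ext; first exact: hpart_linear.
    move=> k u v; rewrite mulrDr -scalerAr lh lh mulrDr -scalerAr scalerBr opprD.
    by rewrite -!addrA; congr (_ + _); rewrite addrCA.
  move=> i x xG; rewrite (hpart_homog lc _ xG) (hpart_homog ld _ xG).
  rewrite (hpart_homog ld _ (gradingM gG yG xG)) PoszD.
  rewrite -scaleN1r addrC zcmpP scaleN1r addrC; congr (_ - _).
    by congr zcmp; ring.
  by rewrite -(zcmp_mul _ _ yG); congr zcmp; ring.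
rewrite (cmp_sum (leqnn (dgr r))); elim: (dgr r) => [|N IHN].
  apply: diffop_le_ext (@diffop_le0 K R n) => x.
  by rewrite big_ord0 !mul0r lin0 ?subr0 //; exact: hpart_linear.
apply: diffop_le_ext (diffop_leP 1 IHN (key N _ (cmpG gG r N))) => x.
have hD a b : hpart d m (a + b) = hpart d m a + hpart d m b.
  by have := hpart_linear ld m 1 a b; rewrite !scale1r.
by rewrite scale1r big_ord_recr /= !mulrDl hD opprD addrACA.
Qed.

Lemma hpart_degree (u : diffop R) m (v : diffop R) :
  v =1 hpart u m -> homogeneous_of_degree G m v.
Proof.
move=> vE i x xG; rewrite vE (hpart_homog (@diffop_linear _ _ u) _ xG).
exact: zcmp_piece.
Qed.

Definition bounded c (d : R -> R) := forall i x j, x \in G i -> cmp (d x) j <> 0 ->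
  (i <= j + c)%N /\ (j <= i + c)%N.

Hypothesis fgR : finitely_generated R.
Hypothesis G0 : forall y : R, y \in G 0%N -> exists k : K, y = k%:A.

(** The positive-degree components of algebra generators generate the ideal of positive-degree
    elements; taking components of the coefficients makes the representation homogeneous. *)
Lemma irrelevant_ideal_gens : exists N (y : 'I_N -> R) (e : 'I_N -> nat),
  (forall k, y k \in G (e k) /\ (0 < e k)%N) /\
  forall i r, (0 < i)%N -> r \in G i -> exists c : 'I_N -> R,
    (forall k, if (e k <= i)%N then c k \in G (i - e k)%N else c k == 0) /\
    r = \sum_k y k * c k.
Proof.
have [s gen] := fgR; have sT : subring_set [set: R] by [].
pose ys := [seq (cmp y e, e) | y <- s, e <- iota 1 (dgr y)].
pose y (k : 'I_(size ys)) := (nth (0, 0%N) ys k).1.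
pose e (k : 'I_(size ys)) := (nth (0, 0%N) ys k).2.
have yP k : y k \in G (e k) /\ (0 < e k)%N.
  have : nth (0, 0%N) ys k \in ys by rewrite mem_nth.
  rewrite /y /e; move: (nth _ _ _) => ye /allpairsPdep[x [i [_ + ->]]].
  by rewrite mem_iota => /andP[i0 _]; split=> //; exact: cmpG.
exists (size ys), y, e; split=> //.
pose J := Espan [set: R] (map fst ys).
have JD a b : J a -> J b -> J (a + b) by apply: EspanD.
have JM a b : J b -> J (a * b) by apply: EspanM.
have J0 : J 0 by apply: Espan0.
have cmpJ x : J (x - cmp x 0).
  move: x; suff all x : adjs (@scalars K R) s x -> J (x - cmp x 0).
    by move=> x; apply: all; apply: generates_adjs.
  move: x; apply: (@adjs_sub _ _ [set x | J (x - cmp x 0)]).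
  - split=> [|a b Ja Jb|a b Ja Jb] /=.
    + by rewrite (cmp_homog gG _ (grading1 gG)) eqxx subrr.
    + have -> : a - b - cmp (a - b) 0 = (a - cmp a 0) + (-1) * (b - cmp b 0).
        by rewrite -[- b in LHS]scaleN1r [a + _]addrC cmpP mulN1r !scaleN1r; ring.
      by apply: JD => //; apply: JM.
    + have c0 : cmp (a * b) 0 = cmp a 0 * cmp b 0.
        have -> : a * b = (a - cmp a 0) * b + cmp a 0 * b by ring.
        rewrite cmpD (cmp_mul_homog _ _ _ (cmpG gG a 0)) leqnn subnn.
        have -> : a - cmp a 0 = \sum_(i < dgr a) if val i == 0%N then 0 else cmp a i.
          case: (dgr a) (cmp_sum (leqnn (dgr a))) (@cmp_ge _ _ _ gG a) => [|n] an a0.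
            by rewrite an !big_ord0 cmp0 subrr.
          rewrite {1}an big_ord_recl addrC addKr big_ord_recl add0r.
          by apply: eq_bigr.
        rewrite mulr_suml cmpsum big1 ?add0r // => i _; case: eqP => [_|/eqP i0].
          by rewrite mul0r cmp0.
        by rewrite (cmp_mul_homog _ _ _ (cmpG gG a i)) leqn0 (negbTE i0).
      rewrite c0; have -> : a * b - cmp a 0 * cmp b 0 = a * (b - cmp b 0) + cmp b 0 * (a - cmp a 0) by ring.
      by apply: JD; apply: JM.
  - move=> _ [k ->] /=.
    by rewrite (cmp_homog gG _ (pieceZ gG k (grading1 gG))) eqxx subrr.
  - move=> x xs /=; rewrite {1}(cmp_sum (leqnSn (dgr x))) big_ord_recl addrC addKr.
    elim/big_ind: _ => // i _; apply: mem_Espan => //; apply/mapP.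
    exists (cmp x (lift ord0 i), val (lift ord0 i)) => //; apply/allpairsPdep.
    exists x, (val (lift ord0 i)); split=> //; rewrite mem_iota /= /bump /= add1n add1n.
    by rewrite !ltnS ltn_ord.
move=> i r i0 rG; have : J r.
  by have := cmpJ r; rewrite (cmp_homog gG _ rG) eq_sym -[_ == _]negbK -lt0n i0 subr0.
move=> [a _ ra]; rewrite size_map in ra.
exists (fun k => if (e k <= i)%N then cmp (a k) (i - e k) else 0); split.
  by move=> k; case: leqP => // _; exact: cmpG.
have ri : r = cmp r i by rewrite (cmp_homog gG _ rG) eqxx.
rewrite ri ra cmpsum; apply: eq_bigr => k _.
rewrite (nth_map (0, 0%N)) // mulrC (cmp_mul_homog _ _ _ (yP k).1).
by case: ifP => // _; rewrite mulr0.
Qed.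

(** Induction on the order, then on the degree, via [d (y * a) = y * d a + [d, y] a] for the
    finitely many generators [y]. The first term keeps the shift of degrees, the second has smaller
    order, and [R_0 = K] reduces degree zero to [d 1]. *)
Lemma diffop_bounded n d : diffop_le n d -> exists c, bounded c d.
Proof.
elim: n d => [|n IH] d dn; have ld := diffop_le_linear dn.
  case: dn => a da; exists (dgr a) => i x j xG; rewrite da mulrC (cmp_mul_homog _ _ _ xG).
  case: leqP => // ij ne; split; first exact: leq_trans ij (leq_addr _ _).
  rewrite leqNgt; apply/negP => lt; apply: ne; rewrite cmp_ge ?mulr0 //.
  by rewrite leq_subRL // ltnW.
have [N [y [e [yP gens]]]] := irrelevant_ideal_gens; case: dn => _ hd.
have [b bP] := choice (fun k => IH _ (hd (y k))).
pose c := (dgr (d 1%R) + \sum_k (b k + e k))%N.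
have bc k : (b k + e k <= c)%N.
  by rewrite /c (bigD1 k) //= addnCA leq_addr.
exists c => i; have [m] := ubnP i; elim: m i => // m IHm i im x j xG.
case: (posnP i) => [i0|i0].
  rewrite i0 in xG *; have [k ->] := G0 xG.
  rewrite -[k%:A]addr0 ld lin0 // addr0 => ne; split=> //; rewrite add0n leqNgt.
  apply/negP => cj; apply: ne; rewrite -[k *: _]addr0 cmpP cmp0 addr0 cmp_ge ?scaler0 //.
  by apply: ltnW; apply: leq_ltn_trans cj; exact: leq_addr.
have [a [aG xE]] := gens i x i0 xG.
have dD (f : 'I_N -> R) : d (\sum_k f k) = \sum_k d (f k).
  apply: (big_morph d) => [u v|]; last exact: lin0.
  by have := ld 1 u v; rewrite !scale1r.
rewrite xE dD cmpsum => ne.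
have [k ck] : exists k, cmp (d (y k * a k)) j <> 0.
  apply: contrapT => no; apply: ne; rewrite big1 // => k _.
  by apply: contrapT => ne; apply: no; exists k.
have := aG k; case: leqP => [ei|_ /eqP ak]; last first.
  by case: ck; rewrite ak mulr0 lin0 // cmp0.
move=> akG; have [yG e0] := yP k.
have dE : d (y k * a k) = y k * d (a k) + (d (y k * a k) - y k * d (a k)).
  by rewrite addrC subrK.
move: ck; rewrite dE cmpD (cmp_mul_homog _ _ _ yG).
have [z1|n1 _] := pselect (cmp (d (y k * a k) - y k * d (a k)) j = 0); last first.
  have [] := bP k _ _ _ akG n1; have := bc k.
  by move: (b k) (e k) ei => bk ek *; lia.
rewrite z1 addr0; case: leqP => // ej.
have [->|n2 _] := pselect (cmp (d (a k)) (j - e k) = 0); first by rewrite mulr0.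
have [|] := IHm (i - e k)%N _ (a k) (j - e k)%N akG n2.
  by rewrite -ltnS in im; move: (e k) e0 ei => ek *; lia.
by move: (e k) e0 ei ej => ek *; lia.
Qed.

Lemma cmp_inj x y : (forall j, cmp x j = cmp y j) -> x = y.
Proof.
move=> xy; rewrite (cmp_sum (leq_maxl (dgr x) (dgr y))) [RHS](cmp_sum (leq_maxr (dgr x) (dgr y))).
by apply: eq_bigr => i _.
Qed.

Lemma cmp_zcmp x m j : cmp (zcmp x m) j = if m == j%:Z then cmp x j else 0.
Proof.
case: m => n /=; last by rewrite cmp0.
rewrite (cmp_homog gG _ (cmpG gG x n)) eqz_nat eq_sym.
by case: eqP => [->|].
Qed.

Lemma diffop_sumE (T : Type) (r : seq T) (v : T -> diffop R) x :
  (\sum_(k <- r) v k : diffop R) x = \sum_(k <- r) v k x.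
Proof. by elim: r => [|k r IH]; rewrite ?big_nil // !big_cons -IH. Qed.

Lemma diffop_homogeneous_sum (u : diffop R) : exists c (v : 'I_(c + c).+1 -> diffop R),
  (forall k : 'I_(c + c).+1, homogeneous_of_degree G (k%:Z - c%:Z) (v k) /\ (ord (v k) <= ord u)%N) /\
  u = \sum_k v k.
Proof.
have [c bc] := diffop_bounded (diffop_ord u); have lu := @diffop_linear _ _ u.
have hd m : is_diffop (hpart u m).
  by apply/is_diffopP; exists (ord u); apply: hpart_diffop; exact: diffop_ord.
(* The index [k] stands for the degree [k - c], between [-c] and [c]. *)
exists c, (fun k : 'I_(c + c).+1 => DiffOp (hd (k%:Z - c%:Z))); split=> [k|].
  split; first exact: hpart_degree.
  by apply: ord_le; apply: hpart_diffop; exact: diffop_ord.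
apply: diffop_eq; apply: linear_ext; [exact: lu|exact: diffop_linear|] => i x xG.
rewrite diffop_sumE; apply: cmp_inj => j; rewrite cmpsum.
have -> : \sum_(k < (c + c).+1) cmp (DiffOp (hd (k%:Z - c%:Z)) x) j =
    \sum_(k < (c + c).+1) if i%:Z + (k%:Z - c%:Z) == j%:Z then cmp (u x) j else 0.
  by apply: eq_bigr => k _; rewrite /= (hpart_homog lu _ xG) cmp_zcmp.
have [->|ne] := pselect (cmp (u x) j = 0).
  by rewrite big1 // => k _; rewrite if_same.
have [ij ji] := bc i x j xG ne.
have lt : (j + c - i < (c + c).+1)%N by lia.
rewrite (bigD1 (Ordinal lt)) //= ifT; last by lia.
rewrite big1 ?addr0 // => k; rewrite -val_eqE /= => kj; rewrite ifF //.
by apply/negbTE; apply: contra kj => /eqP; lia.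
Qed.

Variable w : int.
Hypothesis w0 : 0 <= w.

Let gens n : set (diffop R) := [set u | exists2 j : int,
  homogeneous_of_degree G j u & (j + w * (ord u)%:Z <= n%:Z)%R].

(** Exhaustion rests on the decomposition of an operator into finitely many homogeneous parts of no
    larger order. [w >= 0] turns subadditivity of the order into multiplicativity of the
    filtration. *)
Lemma bernstein_alg_filtration : alg_filtration (bernstein_slope G w).
Proof.
have sub m n : (m <= n)%N -> bernstein_slope G w m `<=` bernstein_slope G w n.
  move=> mn; apply: lspan_min => [|k u v|u [j hu ju]]; [exact: lspan0|exact: lspanP|].
  by apply: lspan_mem; exists j => //; apply: le_trans ju _; rewrite lez_nat.
split=> //.
- move=> k; rewrite -[k *: 1]addr0; apply: lspanP; last exact: lspan0.
  apply: lspan_mem; exists 0.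
    by move=> i x xG; rewrite addr0 (_ : (1 : diffop R) x = x) //; exact: mul1r.
  have -> : ord (1 : diffop R) = 0%N.
    by apply/eqP; rewrite -leqn0; apply: ord_le; exists 1.
  by rewrite mulr0 addr0.
- by move=> n u v Bu Bv; rewrite -[u]scale1r; apply: lspanP.
- move=> m n u v Bu Bv; move: u Bu; apply: lspan_min.
  + by rewrite /= mul0r; exact: lspan0.
  + by move=> k u u' Bu Bu'; rewrite /= mulrDl -scalerAl; apply: lspanP.
  move=> u [i hu iu]; move: v Bv; apply: lspan_min.
  + by rewrite /= mulr0; exact: lspan0.
  + by move=> k v v' Bv Bv'; rewrite /= mulrDr -scalerAr; apply: lspanP.
  move=> v [j hv jv]; apply: lspan_mem; exists (i + j); first exact: homogeneousM.
  apply: le_trans (lerD iu jv); rewrite addrACA -mulrDr lerD2l.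
  by rewrite ler_wpM2l // -PoszD lez_nat ordM.
- move=> u; have [c [v [vP uE]]] := diffop_homogeneous_sum u.
  exists (c + `|w| * ord u)%N; rewrite [X in bernstein_slope _ _ _ X]uE.
  have sum0 : bernstein_slope G w (c + `|w| * ord u) 0 by exact: lspan0.
  elim/big_ind: _ => // [a b Ba Bb|k _]; first by rewrite -[a]scale1r; apply: lspanP.
  have [hv ov] := vP k; apply: lspan_mem; exists (k%:Z - c%:Z) => //.
  rewrite PoszD PoszM gez0_abs // lerD //.
    by rewrite lerBlDr -PoszD lez_nat -ltnS ltn_ord.
  by rewrite ler_wpM2l // lez_nat.
Qed.

End BernsteinFiltration.
(** * Growth of modules *)

Section ModuleGrowth.
Variables (K : fieldType) (R : comAlgType K) (M : lmodType (diffop R)).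
Local Notation D := (diffop R).

Lemma Kscale_comm (u : D) (k : K) (v : M) : u *: (k%:A *: v) = k%:A *: (u *: v).
Proof. by rewrite !scalerA mulr_algr mulr_algl. Qed.

(** The bound [N] provides finite dimension: a free family of greatest size exists and spans. *)
Lemma maximal_Kfree (V : set M) N : Ksubspace V ->
  (forall n (x : 'I_n -> M), (forall i, V (x i)) -> Kfree x -> (n <= N)%N) ->
  exists n (x : 'I_n -> M), [/\ forall i, V (x i), Kfree x &
    forall v, V v -> exists k : 'I_n -> K, v = \sum_(i < n) (k i)%:A *: x i].
Proof.
move=> [V0 VP] bound.
pose P n := `[< exists x : 'I_n -> M, (forall i, V (x i)) /\ Kfree x >].
have exP : exists n, P n by exists 0%N; apply/asboolP; exists (fun=> 0); split=> [[]//|k _ []].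
have bP n : P n -> (n <= N)%N by move=> /asboolP[x [Vx fx]]; apply: bound fx.
case: (ex_maxnP exP bP) => n /asboolP[x [Vx fx]] maxn.
exists n, x; split=> // v Vv.
pose y (i : 'I_n.+1) := if unlift ord0 i is Some j then x j else v.
have Vy i : V (y i) by rewrite /y; case: unlift.
have y0 : y ord0 = v by rewrite /y unlift_none.
have yS i : y (lift ord0 i) = x i by rewrite /y liftK.
have [k [ks kn]] : exists k : 'I_n.+1 -> K,
    \sum_(i < n.+1) (k i)%:A *: y i = 0 /\ ~ forall i, k i = 0.
  apply: contrapT => no; have : P n.+1.
    apply/asboolP; exists y; split=> // k ks; apply: contrapT => kn.
    by apply: no; exists k.
  by move/maxn; rewrite ltnn.
rewrite big_ord_recl y0 in ks.
have k0 : k ord0 != 0.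
  apply/eqP => k0; apply: kn; rewrite k0 scale0r scale0r add0r in ks.
  have kl j : k (lift ord0 j) = 0.
    by apply: (fx (fun j => k (lift ord0 j))); rewrite -[RHS]ks; apply: eq_bigr => l _; rewrite yS.
  by move=> i; case: (unliftP ord0 i) => [j ->|->].
exists (fun i => - ((k ord0)^-1 * k (lift ord0 i))).
have vE : (k ord0)%:A *: v = - \sum_(i < n) (k (lift ord0 i))%:A *: x i.
  apply/eqP; rewrite -addr_eq0; apply/eqP; rewrite -[RHS]ks; congr (_ + _).
  by apply: eq_bigr => i _; rewrite yS.
have -> : v = ((k ord0)^-1)%:A *: ((k ord0)%:A *: v).
  by rewrite scalerA -scalerAl mul1r scalerA mulVf // scale1r scale1r.
rewrite vE scalerN scaler_sumr -sumrN; apply: eq_bigr => i _.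
by rewrite scalerA -scalerAl mul1r scalerA scaleNr scaleNr.
Qed.

(* Pigeonhole: more operators than the dimension of [Hom(<x>, <y>)]. *)
Lemma exists_annihilator (I : finType) (u : I -> D) p r (x : 'I_p -> M) (y : 'I_r -> M) :
  (p * r < #|I|)%N ->
  (forall i a, exists k : 'I_r -> K, u i *: x a = \sum_(b < r) (k b)%:A *: y b) ->
  exists c : I -> K, (exists i, c i != 0) /\ forall a, (\sum_i c i *: u i) *: x a = 0.
Proof.
move=> lt span.
have exg (ia : I * 'I_p) : exists k : 'I_r -> K,
    u ia.1 *: x ia.2 = \sum_(b < r) (k b)%:A *: y b by exact: span.
have [g gP] := choice exg.
pose A : 'M[K]_(#|I|, p * r) := \matrix_i mxvec (\matrix_(a, b) g (enum_val i, a) b).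
have [v [vA v0]] : exists v : 'rV[K]_#|I|, v *m A = 0 /\ v != 0.
  apply: contrapT => no; have : row_free A.
    apply: inj_row_free => v vA; apply/eqP/negPn/negP => v0; by apply: no; exists v.
  by rewrite /row_free => /eqP rA; have := rank_leq_col A; rewrite rA leqNgt lt.
exists (fun i => v 0 (enum_rank i)); split.
  apply: contrapT => no; case/eqP: v0; apply/rowP => j; rewrite mxE.
  apply/eqP/negPn/negP => vj; apply: no; exists (enum_val j); by rewrite enum_valK.
move=> a; rewrite scaler_suml.
under eq_bigr => i _.
  rewrite -mulr_algl -scalerA (gP (i, a)) scaler_sumr.
  under eq_bigr do rewrite scalerA -scalerAl mul1r scalerA.
  over.
rewrite exchange_big big1 //= => b _; rewrite -scaler_suml -scaler_suml.
suff -> : \sum_i v 0 (enum_rank i) * g (i, a) b = 0 by rewrite scale0r scale0r.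
have /rowP/(_ (mxvec_index a b)) := vA; rewrite !mxE => e; rewrite -[RHS]e.
rewrite (reindex (@enum_val I predT)) /=; last exact: onW_bij (enum_val_bij I).
by apply: eq_bigr => j _; rewrite enum_valK mxE mxvecE mxE.
Qed.

Variable B : nat -> set D.
Hypotheses (fB : alg_filtration B) (charK : [pchar K] =i pred0).
Variables (d : nat) (z : 'I_d -> R) (h : R) (T : 'I_d -> D).
Hypothesis ch : chart z h T.

Section Box.
Variable k : nat.

(** Exponents below [k] in each coordinate: such a box has exactly [k ^ d] elements, and total
    degrees stay below [d * k] up to equality. *)
Definition bexp (a : {ffun 'I_d -> 'I_k}) : multinom d := Multinom [tuple (a i : nat) | i < d].

Lemma bexpE a i : bexp a i = a i :> nat.
Proof. exact: mnmE. Qed.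

Lemma bexp_inj : injective bexp.
Proof.
by move=> a b /mnmP ab; apply/ffunP => i; apply: val_inj; have := ab i; rewrite !bexpE.
Qed.

Lemma mdeg_bexp a : (mdeg (bexp a) <= d * k)%N.
Proof.
rewrite mdegE -[d in (d * k)%N]card_ord -sum_nat_const; apply: leq_sum => i _.
by rewrite bexpE ltnW.
Qed.

Definition weyl_monomial (t : {ffun 'I_d -> 'I_k} * {ffun 'I_d -> 'I_k}) : D :=
  mulop (kpoly z (mpolyX K (bexp t.1))) * Zop h T (sq (bexp t.2)).

Definition box_coef (c : {ffun 'I_d -> 'I_k} * {ffun 'I_d -> 'I_k} -> K) b : mpoly d K :=
  \sum_a c (a, b) *: mpolyX K (bexp a).

(** A combination of monomials regrouped by the exponent of the derivations, without zero
    coefficients, as the descent expects. *)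
Definition box_list c : seq (mpoly d K * multinom d) :=
  [seq (box_coef c b, bexp b) | b <- [seq b <- index_enum {ffun 'I_d -> 'I_k} | box_coef c b != 0]].

Lemma mcoeff_box_coef c a b : mcoeff (bexp a) (box_coef c b) = c (a, b).
Proof.
rewrite /box_coef raddf_sum (bigD1 a) //= mcoeffZ mcoeffX eqxx mulr1 big1 ?addr0 // => a' aa'.
by rewrite mcoeffZ mcoeffX (inj_eq bexp_inj) (negbTE aa') mulr0.
Qed.

Lemma kpolyZ (e : K) (q : mpoly d K) : kpoly z (e *: q) = e *: kpoly z q.
Proof. by rewrite -mul_mpolyC kpolyM kpolyC mulr_algl. Qed.

Lemma kpoly_sum (I : Type) (r : seq I) (q : I -> mpoly d K) :
  kpoly z (\sum_(i <- r) q i) = \sum_(i <- r) kpoly z (q i).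
Proof.
elim: r => [|i r IH]; first by rewrite !big_nil kpoly0.
by rewrite !big_cons -IH /kpoly raddfD mevalD.
Qed.

Lemma box_listE c : weyl_op z h T (box_list c) = \sum_t c t *: weyl_monomial t.
Proof.
rewrite /weyl_op /box_list big_map big_filter big_mkcond /=.
rewrite (eq_bigr (fun t => c (t.1, t.2) *: weyl_monomial (t.1, t.2))); last by case.
rewrite -(pair_bigA _ (fun a b => c (a, b) *: weyl_monomial (a, b))) exchange_big /=.
apply: eq_bigr => b _.
have -> : \sum_a c (a, b) *: weyl_monomial (a, b) =
    mulop (kpoly z (box_coef c b)) * Zop h T (sq (bexp b)).
  rewrite /box_coef kpoly_sum mulop_sum mulr_suml; apply: eq_bigr => a _.
  by rewrite kpolyZ mulopZ scalerAl.
by case: ifPn => //; rewrite negbK => /eqP->; rewrite kpoly0 mulop0 mul0r.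
Qed.

Lemma box_listP c : (exists t, c t != 0) ->
  [/\ uniq (map snd (box_list c)), box_list c <> [::] &
    forall qb, qb \in box_list c ->
      [/\ qb.1 <> 0, (msize qb.1 <= (d * k).+1)%N & (mdeg qb.2 <= d * k)%N]].
Proof.
move=> [[a b] cab]; split.
- rewrite -map_comp map_inj_uniq; last exact: bexp_inj.
  by apply: filter_uniq; exact: index_enum_uniq.
- have : (box_coef c b, bexp b) \in box_list c.
    apply: (map_f (fun b => (box_coef c b, bexp b))); rewrite mem_filter mem_index_enum andbT.
    by apply: contra cab => /eqP b0; rewrite -mcoeff_box_coef b0 mcoeff0.
  by case: (box_list c).
- move=> qb /mapP[b']; rewrite mem_filter => /andP[/eqP q0 _] -> /=; split=> //.
    apply: leq_trans (msize_sum _ _ _) _; apply/bigmax_leqP => a' _.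
    apply: leq_trans (mmeasureZ_le _ _ _) _.
    by rewrite mmeasureX ltnS mdeg_bexp.
  exact: mdeg_bexp.
Qed.

End Box.

Lemma weyl_monomial_level : exists C, forall k t, B (C * (d * k))%N (@weyl_monomial k t).
Proof.
have [C [Ch CT CTh Cz]] := filt_common_chart fB z h T.
exists (C + (C + C))%N => k [a b]; rewrite mulnDl /weyl_monomial; apply: (filtM fB).
  rewrite /kpoly map_mpolyX mevalX.
  apply: (filt_leq fB (m := (C * mdeg (bexp a))%N)); first by rewrite leq_mul2l mdeg_bexp orbT.
  rewrite mdegE big_distrr /=.
  have B1 : B 0%N (mulop 1) by have := filt_scalar fB 1; rewrite scale1r.
  elim/big_rec2: _ => // i m y _ Bm; rewrite mulopM mulopX; apply: (filtM fB) => //.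
  exact: (filtX fB).
apply: (filt_leq fB (m := ((C + C) * size (sq (bexp b)))%N)).
  by rewrite size_sq leq_mul2l mdeg_bexp orbT.
exact: (filt_Zop fB).
Qed.

Variable F : nat -> set M.
Hypothesis cF : compatible_filtration B F.

Hypothesis simple : exists C, forall s l, uniq (map snd l) -> l <> [::] ->
    (forall qb, qb \in l -> [/\ qb.1 <> 0, (msize qb.1 <= s.+1)%N & (mdeg qb.2 <= s)%N]) ->
    sand B (C * s) (weyl_op z h T l) 1.

(** If [r1 * r2 < k ^ d * k ^ d], some nonzero combination of the monomials kills [F n1]. But [n1]
    is large enough to contain what the right-hand factors in an expression of [1] make of [m], so
    [m] would vanish. *)
Lemma growth_bound : (exists m : M, m != 0) -> exists A j0, (0 < A)%N /\ forall k N,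
  let n1 := (A * (d * k) + j0)%N in let n2 := (A * (d * k) + n1)%N in
  (forall n, (n = n1 \/ n = n2) -> forall r (x : 'I_r -> M), (forall i, F n (x i)) ->
     Kfree x -> (r <= N)%N) ->
  exists r1 (x1 : 'I_r1 -> M) r2 (x2 : 'I_r2 -> M),
    [/\ forall i, F n1 (x1 i), Kfree x1, forall i, F n2 (x2 i), Kfree x2 &
      ((k ^ d) * (k ^ d) <= r1 * r2)%N].
Proof.
move=> [m m0]; have [C CP] := simple; have [C' C'P] := weyl_monomial_level.
have [j0 _ Fm] : (\bigcup_i F i) m by rewrite (filt_cover cF).
(* [C] bounds the factors around the combination, [C'] the monomials; the successor keeps [A]
   positive, and [j0] is a level containing [m]. *)
pose A := (C + C').+1; exists A, j0; split=> // k N n1 n2 bound.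
have [r1 [x1 [Fx1 fx1 sp1]]] := maximal_Kfree (filt_subspace cF n1) (bound n1 (or_introl erefl)).
have [r2 [x2 [Fx2 fx2 sp2]]] := maximal_Kfree (filt_subspace cF n2) (bound n2 (or_intror erefl)).
exists r1, x1, r2, x2; split=> //; rewrite leqNgt; apply/negP => lt.
have card : #|{: {ffun 'I_d -> 'I_k} * {ffun 'I_d -> 'I_k}}| = (k ^ d * k ^ d)%N.
  by rewrite card_prod card_ffun !card_ord.
have le A' : (A' <= A)%N -> (A' * (d * k) <= A * (d * k))%N by move=> AA'; rewrite leq_mul2r AA' orbT.
have [|i a|c [cn ck]] := @exists_annihilator _ (@weyl_monomial k) _ _ x1 x2.
- by rewrite card.
- apply: sp2; apply: (filt_act cF) (Fx1 a).
  by apply: (filt_leq fB) (C'P k i); apply: le; rewrite /A; lia.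
have [ul l0 lP] := box_listP cn; have [s [sB one]] := CP _ _ ul l0 lP.
case/eqP: m0; rewrite -[m]scale1r one scaler_suml big1_seq // => ab /andP[_ /sB[Ba Bb]].
have : F n1 (ab.2 *: m).
  apply: (filt_act cF) Fm; apply: (filt_leq fB) Bb; apply: le; rewrite /A; lia.
move=> /sp1[g gE]; rewrite -!scalerA gE scaler_sumr big1 ?scaler0 // => i _.
by rewrite Kscale_comm box_listE ck scaler0.
Qed.

End ModuleGrowth.

(** * Dimension of filtrations *)

Section Dimension.
Variables (K : fieldType) (R : comAlgType K) (Re : realType) (M : lmodType (diffop R)).

Lemma free_family_lt (F : nat -> set M) (t eps : Re) n r (x : 'I_r -> M) : (0 < n)%N ->
  (Kdim Re (F n) * ((n%:R `^ t)^-1)%:E < eps%:E)%E ->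
  (forall i, F n (x i)) -> Kfree x -> r%:R < eps * n%:R `^ t.
Proof.
move=> n0 lt Fx fx; have nt : 0 < (n%:R : Re) `^ t by apply: powR_gt0; rewrite ltr0n.
rewrite -ltr_pdivrMr // -lte_fin EFinM; apply: le_lt_trans lt.
apply: lee_wpmul2r; first by rewrite lee_fin invr_ge0 ltW.
by apply: ereal_sup_ubound; exists r => //; exists x.
Qed.

(* With [t <= d] the hypothesis forces free families in [F n], [n <= L * k], to have
   fewer than [k ^ d / 2] members. *)
Lemma free_family_small (F : nat -> set M) (t : Re) (d L k n r : nat) (x : 'I_r -> M) :
  t <= d%:R -> (0 < L)%N -> (0 < n)%N -> (n <= L * k)%N ->
  (Kdim Re (F n) * ((n%:R `^ t)^-1)%:E < ((2 * L%:R ^+ d)^-1 : Re)%:E)%E ->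
  (forall i, F n (x i)) -> Kfree x -> (2 * r < k ^ d)%N.
Proof.
move=> td L0 n0 nL lt Fx fx; have := free_family_lt n0 lt Fx fx.
have Ld : 0 < (L%:R : Re) ^+ d by rewrite exprn_gt0 // ltr0n.
have le : (n%:R : Re) `^ t <= L%:R ^+ d * k%:R ^+ d.
  apply: (@le_trans _ _ (n%:R `^ d%:R)); first by rewrite ler_powR // ler1n.
  by rewrite powR_mulrn ?ler0n // -exprMn -natrM lerXn2r ?nnegrE ?ler0n // ler_nat.
move=> rn; rewrite -(ltr_nat Re) natrM natrX -ltr_pdivlMl ?ltr0n //.
apply: lt_le_trans rn _; apply: le_trans (ler_wpM2l _ le) _.
  by rewrite invr_ge0 mulr_ge0 // ltW.
by rewrite invfM -mulrA mulKf // gt_eqF.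
Qed.

End Dimension.

Lemma scalar_prime_chain (K : fieldType) (R : comAlgType K) n :
  (forall x : R, exists k : K, x = k%:A) -> prime_chain R n -> n = 0%N.
Proof.
case: n => // n sc [P /(_ 0%N isT)[_ /existsNP[u /not_implyP[uP /negP nu]]]].
have [k uk] := sc u; have k0 : k != 0.
  by apply: contra nu => /eqP k0; rewrite uk k0 scale0r idealr0.
have := idealr1 (P 1%N); rewrite -(scale1r 1) -(mulVf k0) -scalerA -uk -mulr_algl.
by rewrite idealMr.
Qed.

(** No degree lies below a negative slope, so the empty set generates and [R = K]; the inequality is
    then [0 <= t]. *)
Lemma negative_slope (K : fieldType) (R : comAlgType K) (G : nat -> {pred R}) (w : int) :
  w < 0 -> admissible_slope G w -> forall x : R, exists k : K, x = k%:A.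
Proof.
move=> w0 gen x; pose S : {pred R} := fun x => `[< scalars x >].
suff : x \in S by move/asboolP.
have sS := subring_scalars R.
apply: gen => [|y [j jw _]]; last by have := lt_trans jw w0; rewrite ltz_nat.
split; first by apply/asboolP; exact: subring1.
  move=> k u v /asboolP Su /asboolP Sv; apply/asboolP; apply: subringD => //.
  by rewrite -[k *: u]mulr_algl; apply: subringM => //; exists k.
by move=> u v /asboolP Su /asboolP Sv; apply/asboolP; exact: subringM.
Qed.

Theorem theorem1p1 (Re : realType) (K : fieldType) (R : comAlgType K)
    (G : nat -> {pred R}) :
  [pchar K] =i pred0 ->
  finitely_generated R ->
  is_grading G ->
  (forall x : R, x \in G 0%N -> exists k : K, x = k%:A) ->
  (exists f : R, [/\ GRing.lreg f, in_singular_locus f &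
     forall n : nat, ~~ root (SBS f) n%:R]) ->
  forall (B : nat -> set (diffop R)) (M : lmodType (diffop R)),
    bernstein_filtration G B ->
    (exists m : M, m != 0) ->
    (krull_dim R Re <= module_dim Re M B)%E.
Proof.
move=> charK fgR gG G0 [f [regf sing sbs]] B M [w admw ->] m0.
apply: ge_ereal_sup => _ [n chain <-].
apply: le_ereal_inf_tmp => _ [F cF <-].
apply: le_ereal_inf_tmp => _ [t [t0 cvgt] <-]; rewrite lee_fin.
case: (ltP w 0) => w0.
  by rewrite (scalar_prime_chain (negative_slope w0 admw) chain).
have fB := bernstein_alg_filtration gG fgR G0 w0.
have dom := sing_domain charK fgR gG G0 regf sing sbs.
have [P [prP _ nPf]] := exists_prime_avoiding (let: And3 id0 _ _ := zero_prime dom in id0)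
  (expf_neq0 regf).
have [h [_ [d [z [th ch0]]]]] := exists_chart dom charK fgR sing prP nPf.
have [T ch] := chart_diffop ch0.
have simple := linearly_simple fB charK dom fgR sing regf sbs ch.
have [A [j0 [A0 growth]]] := growth_bound fB cF simple m0.
rewrite leNgt; apply/negP => tn.
have td : t <= d%:R by apply: le_trans (ltW tn) _; rewrite ler_nat (chart_dim ch0).
have d0 : (0 < d)%N.
  by rewrite -(ltr_nat Re) (le_lt_trans t0) // (lt_le_trans tn) // ler_nat (chart_dim ch0).
(* [n2 = 2 A d k + j0] is at most [L * k] as soon as [k >= 1]. *)
pose L := (2 * (A * d) + j0).+1.
have eps0 : (0 : Re) < (2 * L%:R ^+ d)^-1 by rewrite invr_gt0 mulr_gt0 // exprn_gt0 // ltr0n.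
have [n0 _ small] := cvgt _ (@nbhs_open_ereal_lt Re 0 (fun=> (2 * L%:R ^+ d)^-1) eps0).
(* Since [n2 >= n1 >= k > n0], both levels are in the range where the quotient is already below the
   chosen bound. *)
pose k := n0.+1; pose n1 := (A * (d * k) + j0)%N; pose n2 := (A * (d * k) + n1)%N.
have kn1 : (k <= n1)%N by rewrite /n1 mulnA (leq_trans _ (leq_addr _ _)) // leq_pmull // muln_gt0 A0.
have n12 : (n1 <= n2)%N by exact: leq_addl.
have n2L : (n2 <= L * k)%N.
  have jk : (j0 <= j0 * k)%N by exact: leq_pmulr.
  by rewrite /n2 /n1 /L mulSn mulnDl -!mulnA; move: (A * (d * k))%N (j0 * k)%N jk => a b jk; lia.
have bound n' : n' = n1 \/ n' = n2 -> forall r (x : 'I_r -> M), (forall i, F n' (x i)) ->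
    Kfree x -> (2 * r < k ^ d)%N.
  move=> n'E r x Fx fx; have [kn' n'L] : (k <= n')%N /\ (n' <= L * k)%N.
    case: n'E => ->; first by split=> //; exact: leq_trans n12 n2L.
    by split=> //; exact: leq_trans kn1 n12.
  apply: (free_family_small td _ _ n'L _ Fx fx) => //; first exact: leq_trans kn'.
  exact: small (leq_trans (leqnSn n0) kn').
have [|r1 [x1 [r2 [x2 [Fx1 fx1 Fx2 fx2 le]]]]] := growth k (k ^ d)%N.
  move=> n' n'E r x Fx fx; have := bound n' n'E r x Fx fx.
  by rewrite mul2n -addnn => /ltnW; apply: leq_trans; exact: leq_addr.
have b1 := bound n1 (or_introl erefl) r1 x1 Fx1 fx1.
have b2 := bound n2 (or_intror erefl) r2 x2 Fx2 fx2.
(* [(2 r1) (2 r2) < k^(2d) <= r1 r2] is impossible. *)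
have := ltn_mul b1 b2; rewrite ltnNge => /negP; apply.
by apply: leq_trans le _; apply: leq_mul; rewrite mul2n -addnn leq_addr.
Qed.
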